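(* Let $y\in(0,1)^n$, let $x_1,\dots,x_n\in\mathbb{R}^p$ be the rows of $X\in\mathbb{R}^{n\times p}$, $m_0\in\mathbb{R}^p$, $\Sigma_0\in\mathbb{R}^{p\times p}$ symmetric positive definite, and $\lambda>0$ known. Let $z\in\mathbb{R}^n$ be the working response of the Kolmogorov–Gamma augmentation, $\Pi_{KG}(\cdot\mid X,y)$ the corresponding posterior on $\mathbb{R}^p$ with prior $N(m_0,\Sigma_0)$, and $P_{\mathrm{KG}}$ the Markov transition kernel on $\mathbb{R}^p$ of the Kolmogorov–Gamma Gibbs chain $\{\beta^{(t)}\}_{t\ge0}$. Let $V(\beta)=\|\beta\|^2$. Then the chain is hyper-$V$ uniformly ergodic. In particular, for any $r>1$, with $\gamma_r=1-1/r$, $$K=\|\Sigma_0\|^2\,\|X^\top z+\Sigma_0^{-1}m_0\|^2+\mathrm{tr}(\Sigma_0),\qquad c_i=\|x_i\|\sqrt{rK},\qquad \epsilon_r=\left(\prod_{i=1}^n\frac{c_i/2}{\sinh(c_i/2)}\right)^{\lambda},$$ one has for all $\beta\in\mathbb{R}^p$ and all integers $t\ge1$, $$\|P_{\mathrm{KG}}^{t}(\beta,\cdot)-\Pi_{KG}(\cdot\mid X,y)\|_{\mathrm{TV}}\le\rho_t(\gamma_r,\epsilon_r),\qquad \|P_{\mathrm{KG}}^{t+1}(\beta,\cdot)-\Pi_{KG}(\cdot\mid X,y)\|_{1+V}\le 2(1+K)\,\rho_t(\gamma_r,\epsilon_r).$$ Moreover, if $W_{\ell_2}$ denotes the Wasserstein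 distance induced by the $\ell_2$-metric, then $$W_{\ell_2}\big(P_{\mathrm{KG}}^{t+1}(\beta,\cdot),\Pi_{KG}(\cdot\mid X,y)\big)\le 2(1+K)\,\rho_t(\gamma_r,\epsilon_r)\qquad\text{for all }\beta\in\mathbb{R}^p,\ t\ge1.$$
   Context: Kolmogorov–Gamma distribution: for $b>0$, $c\in\mathbb{R}$, $\mathrm{KG}(b,c)$ is the law on $(0,\infty)$ of $\frac{1}{2\pi^2}\sum_{k=1}^\infty\frac{g_k}{k^2+c^2/(4\pi^2)}$ with $g_k$ i.i.d. $\mathrm{Gamma}(b,1)$. Equivalently its density satisfies $f_{KG}(\omega\mid b,c)=\left(\frac{\sinh(c/2)}{c/2}\right)^{b}e^{-c^2\omega/2}f_{KG}(\omega\mid b,0)$. The convention $\sinh(0)/0=1$ (and hence $0/\sinh(0)=1$) is used throughout. Working response and posterior: $z=\lambda\,(y-\tfrac12\mathbf{1}_n)$, and $\Pi_{KG}(\cdot\mid X,y)$ has Lebesgue density in $\beta$ proportional to $$\prod_{i=1}^n e^{z_i x_i^\top\beta}\left(\frac{x_i^\top\beta/2}{\sinh(x_i^\top\beta/2)}\right)^{\lambda}$$ times the $N(m_0,\Sigma_0)$ density. Chain: given $\beta^{(t)}$, sample independently $\omega_i^{(t+1)}\sim\mathrm{KG}(\lambda,x_i^\top\beta^{(t)})$, $i=1,\dots,n$; then sample $\beta^{(t+1)}\mid\omega^{(t+1)}\sim N(m_{\omega^{(t+1)}},\Sigma_{\omega^{(t+1)}})$, where, with $\Omega=\mathrm{diag}(\omega_1,\dots,\omega_n)$,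 $\Sigma_\omega=(X^\top\Omega X+\Sigma_0^{-1})^{-1}$ and $m_\omega=\Sigma_\omega(X^\top z+\Sigma_0^{-1}m_0)$. $P_{\mathrm{KG}}$ is the transition kernel of $\beta^{(t)}\mapsto\beta^{(t+1)}$. Norms: $\|\cdot\|$ is the Euclidean norm on vectors and the operator (spectral) norm on matrices. $P^t$ is the $t$-step kernel, $Pf(\beta)=\int f\,dP(\beta,\cdot)$. $\|P^t(\beta,\cdot)-\Pi\|_{\mathrm{TV}}=\sup_{f:\mathbb{R}^p\to[0,1]\text{ Borel}}|P^tf(\beta)-\int f\,d\Pi|$, and for $W\ge0$, $\|P^t(\beta,\cdot)-\Pi\|_{W}=\sup_{|f|\le W,\ f\text{ Borel}}|P^tf(\beta)-\int f\,d\Pi|$. $W_{\ell_2}(\mu,\Pi)=\inf_\Gamma\int\|u-v\|\,\Gamma(du,dv)$ over couplings $\Gamma$ of $\mu,\Pi$. Hyper-$V$ uniform ergodicity of a kernel $P$ with invariant probability measure $\Pi$: there are $\alpha\in(0,1)$ and $K'>0$ such that for all $\beta$ and all integers $t\ge1$, $\|P^{2t}(\beta,\cdot)-\Pi\|_{\mathrm{TV}}\le(1-\alpha)^t$ and $\|P^{2t+1}(\beta,\cdot)-\Pi\|_{1+V}\le2(1+K')(1-\alpha)^t$. For $\gamma\in(0,1)$ and $\alpha\in(0,1]$ (with $\wedge,\vee$ the minimum and maximum, and $0^0=1$), $$\lambda_{\pm}(\gamma,\alpha) = \frac{1-\gamma\wedge\alpha \pm \sqrt{(1-\gamma\wedge\alpha)^2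 + 4(\gamma\wedge\alpha)(1-\alpha\vee\gamma)}}{2},$$ $$\rho_t(\gamma,\alpha) = \frac{(1-\lambda_-(\gamma,\alpha))\,\lambda_+(\gamma,\alpha)^t - (1-\lambda_+(\gamma,\alpha))\,\lambda_-(\gamma,\alpha)^t}{\lambda_+(\gamma,\alpha)-\lambda_-(\gamma,\alpha)}$$ (these $\lambda_\pm$ are unrelated to the parameter $\lambda$). *)

(* Defs.v *)
From HB Require Import structures.
From mathcomp Require Import all_boot all_order all_algebra.
From mathcomp Require Import all_classical all_reals all_analysis.
From mathcomp Require Import measurable_realfun.

Set Implicit Arguments.
Unset Strict Implicit.
Unset Printing Implicit Defensive.
Import Order.TTheory GRing.Theory Num.Theory.
Import numFieldNormedType.Exports.
Local Open Scope classical_set_scope.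
Local Open Scope ring_scope.

(* Matrices carry the product sigma-algebra, generated by the entries, exactly
   as the library does for tuples; [measurable_mxE] below shows that for real
   matrices it is the Borel sigma-algebra.  R^p is ['cV[R]_p]. *)

Definition measure_matrix_display : measure_display -> measure_display.
Proof. exact. Qed.

Section measurable_matrix.
Context {d} {T : sigmaRingType d}.
Variables m n : nat.

Definition mx_entries : set (set 'M[T]_(m, n)) :=
  \bigcup_(ij in [set: 'I_m * 'I_n])
    preimage_set_system setT (fun A : 'M[T]_(m, n) => A ij.1 ij.2) measurable.

Let mx_set0 : <<s mx_entries >> set0.
Proof. exact: sigma_algebra0. Qed.

Let mx_setC A : <<s mx_entries >> A -> <<s mx_entries >> (~` A).
Proof. exact: sigma_algebraC. Qed.

Let mx_bigcup (F : _^nat) : (forall i, <<s mx_entries >> (F i)) ->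
  <<s mx_entries >> (\bigcup_i F i).
Proof. exact: sigma_algebra_bigcup. Qed.

HB.instance Definition _ := @isMeasurable.Build (measure_matrix_display d)
  'M[T]_(m, n) <<s mx_entries >> mx_set0 mx_setC mx_bigcup.

End measurable_matrix.

Lemma measurable_entry d (T : measurableType d) m n (i : 'I_m) (j : 'I_n) :
  measurable_fun [set: 'M[T]_(m, n)] (fun A : 'M[T]_(m, n) => A i j).
Proof.
move=> _ B mB; rewrite setTI; apply: sub_sigma_algebra.
by exists (i, j) => //; exists B => //; rewrite setTI.
Qed.

Lemma measurable_fun_mxP d1 (T1 : measurableType d1) d (T : measurableType d)
    m n (f : T1 -> 'M[T]_(m, n)) :
  (forall i j, measurable_fun [set: T1] (fun x => f x i j)) ->
  measurable_fun [set: T1] f.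
Proof.
move=> mf; apply: (measurability (mx_entries (T := T) (m := m) (n := n))) => //.
move=> _ [_ [[i j] _ [B mB <-]] <-]; rewrite !setTI.
by rewrite -[X in measurable X]setTI; exact: mf.
Qed.

Lemma measurable_mxE (R : realType) m n :
  (@measurable _ 'M[R]_(m, n)) = <<s [set U : set 'M[R]_(m, n) | open U] >>.
Proof.
apply/seteqP; split.
- apply: smallest_sub; first exact: smallest_sigma_algebra.
  move=> _ [[i j] _ [B mB <-]] /=; rewrite setTI.
  have mc : @measurable_fun _ _ (g_sigma_algebraType
      [set U : set 'M[R]_(m, n) | open U]) R setT
      (fun A : 'M[R]_(m, n) => A i j).
    apply: (measurability _ (RGenOpens.measurableE R)).
    move=> _ [_ [a [b ->] <-]]; rewrite setTI; apply: sub_sigma_algebra.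
    apply: (@open_comp _ _ (fun A : 'M[R]_(m, n) => A i j) `]a, b[%classic).
      by move=> A _; exact: coord_continuous.
    exact: interval_open.
  by have := mc measurableT B mB; rewrite setTI.
- apply: smallest_sub; first exact: sigma_algebra_measurable.
  move=> U oU.
  pose box (qk : 'M[rat]_(m, n) * nat) :=
    [set A : 'M[R]_(m, n) | forall i j,
      `|ratr (qk.1 i j) - A i j| < qk.2.+1%:R^-1].
  have -> : U = \bigcup_(qk in [set qk | box qk `<=` U]) box qk.
    apply/seteqP; split=> [A UA|A [qk]]; last by apply.
    have /nbhs_ballP[e /= e0 eU] : nbhs A U by exact: open_nbhs_nbhs.
    have [k ke] : exists k, k.+1%:R^-1 < e / 2.
      have e20 : 0 < e / 2 by rewrite divr_gt0.
      have := near_infty_natSinv_lt (PosNum e20).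
      by case=> k _ /(_ _ (leqnn k)) ke; exists k.
    have q_ i j : {q : rat | `|ratr q - A i j| < k.+1%:R^-1}.
      apply/cid.
      have [|q] := @rat_in_itvoo R (A i j - k.+1%:R^-1) (A i j + k.+1%:R^-1).
        by rewrite ltrBlDr -addrA ltrDl addr_gt0.
      rewrite in_itv /= => /andP[q1 q2]; exists q.
      by rewrite ltr_distl q1 q2.
    exists (\matrix_(i, j) sval (q_ i j), k).
      move=> B /= AB; apply: eU; split=> // i j.
      have := AB i j; rewrite mxE.
      move: (svalP (q_ i j)) => h1 h2.
      rewrite /ball /= distrC -(subrKA (ratr (sval (q_ i j)))).
      rewrite (le_lt_trans (ler_normD _ _))// [X in _ < X](splitr e).
      by rewrite ltrD// distrC (lt_trans _ ke)// distrC.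
    by move=> i j /=; rewrite mxE; exact: (svalP (q_ i j)).
  rewrite bigcup_mkcond; apply: countable_bigcupT_measurable => [|qk].
    exact: countableP.
  case: ifP => // _.
  have -> : box qk = \bigcap_(ij in [set: 'I_m * 'I_n])
      [set A : 'M[R]_(m, n) | `|ratr (qk.1 ij.1 ij.2) - A ij.1 ij.2|
        < qk.2.+1%:R^-1].
    apply/seteqP; split=> A /= h; first by move=> ij _; exact: h.
    by move=> i j; exact: (h (i, j)).
  apply: fin_bigcap_measurable => //= -[i j] _ /=.
  rewrite (_ : mkset _ = setT `&` (fun A : 'M[R]_(m, n) => A i j) @^-1`
    ball (ratr (qk.1 i j) : R) qk.2.+1%:R^-1).
    by apply: measurable_entry => //; exact: measurable_ball.
  by rewrite setTI.
Qed.

Section lebesgue_vec.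
Context {R : realType}.

Section cons_vec.
Variable p : nat.

Definition cons_vec (xv : measurableTypeR R * 'cV[R]_p) : 'cV[R]_p.+1 :=
  \col_i (if unlift ord0 i is Some j then xv.2 j 0 else xv.1).

Lemma measurable_cons_vec :
  measurable_fun [set: measurableTypeR R * 'cV[R]_p] cons_vec.
Proof.
apply: measurable_fun_mxP => i j.
have [k ->{i}|->{i}] := unliftP ord0 i.
  apply: (eq_measurable_fun
      (fun x : measurableTypeR R * 'cV[R]_p => x.2 k 0)) => [x _|].
    by rewrite mxE liftK.
  exact: (measurableT_comp (measurable_entry (T := R) k 0) measurable_snd).
apply: (eq_measurable_fun (fst : measurableTypeR R * 'cV[R]_p -> R)).
  by move=> x _; rewrite mxE unlift_none.
exact: measurable_fst.
Qed.

Variable mu : {sigma_finite_measure set 'cV[R]_p -> \bar R}.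

Definition lebesgue_cons : set 'cV[R]_p.+1 -> \bar R :=
  pushforward ((@lebesgue_measure R) \x mu)%E cons_vec.

Let lebesgue_cons0 : lebesgue_cons set0 = 0%E.
Proof. by rewrite /lebesgue_cons /pushforward preimage_set0 measure0. Qed.

Let lebesgue_cons_ge0 A : (0 <= lebesgue_cons A)%E.
Proof. by rewrite /lebesgue_cons /pushforward; exact: measure_ge0. Qed.

Let mpre (A : set 'cV[R]_p.+1) : measurable A -> measurable (cons_vec @^-1` A).
Proof.
by move=> mA; rewrite -[X in measurable X]setTI; exact: measurable_cons_vec.
Qed.

Let lebesgue_cons_sigma_additive : semi_sigma_additive lebesgue_cons.
Proof.
move=> F mF tF mUF; rewrite /lebesgue_cons /pushforward preimage_bigcup.
apply: measure_semi_sigma_additive.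
- by move=> k; exact: mpre.
- apply/trivIsetP => i j _ _ ij; rewrite -preimage_setI.
  by move/trivIsetP : tF => /(_ _ _ _ _ ij) ->//; rewrite preimage_set0.
- by rewrite -preimage_bigcup; exact: mpre.
Qed.

HB.instance Definition _ := isMeasure.Build _ _ _ lebesgue_cons
  lebesgue_cons0 lebesgue_cons_ge0 lebesgue_cons_sigma_additive.

Definition uncons_vec (v : 'cV[R]_p.+1) : measurableTypeR R * 'cV[R]_p :=
  (v ord0 0, \col_j v (lift ord0 j) 0).

Lemma cons_vecK : cancel cons_vec uncons_vec.
Proof.
move=> [x v]; rewrite /uncons_vec mxE unlift_none /=; congr (_, _).
by apply/colP => j; rewrite !mxE liftK.
Qed.

Lemma measurable_uncons_vec : measurable_fun [set: 'cV[R]_p.+1] uncons_vec.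
Proof.
apply: measurable_fun_pair; first exact: measurable_entry.
apply: measurable_fun_mxP => i j.
apply: (eq_measurable_fun (fun v : 'cV[R]_p.+1 => v (lift ord0 i) 0)).
  by move=> v _; rewrite mxE.
exact: measurable_entry.
Qed.

Let lebesgue_cons_sigma_finite : sigma_finite setT lebesgue_cons.
Proof.
have /sigma_finiteP[F [TF ndF Foo]] := sigma_finiteT (@lebesgue_measure R).
have /sigma_finiteP[G [TG ndG Goo]] := sigma_finiteT mu.
exists (fun k => uncons_vec @^-1` (F k `*` G k)).
  rewrite -preimage_bigcup -[LHS](@preimage_setT _ _ uncons_vec).
  congr (_ @^-1` _); apply/seteqP; split=> // -[x v] _.
  have : [set: measurableTypeR R] x by [].
  have : [set: 'cV[R]_p] v by [].
  rewrite TF TG => -[i _ Gi] [j _ Fj]; exists (maxn i j) => //; split => /=.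
    by move: Fj; apply/subsetPset/ndF/leq_maxr.
  by move: Gi; apply/subsetPset/ndG/leq_maxl.
move=> k; have [mF Fk] := Foo k; have [mG Gk] := Goo k; split.
  rewrite -[X in measurable X]setTI; apply: measurable_uncons_vec => //.
  exact: measurableX.
rewrite /lebesgue_cons /pushforward -comp_preimage.
rewrite (_ : uncons_vec \o cons_vec = id); last first.
  by apply/funext => x /=; rewrite cons_vecK.
by rewrite preimage_id product_measure1E// lte_mul_pinfty// ge0_fin_numE.
Qed.

HB.instance Definition _ := Measure_isSigmaFinite.Build _ _ _
  lebesgue_cons lebesgue_cons_sigma_finite.

End cons_vec.

Fixpoint lebesgue_vec p : {sigma_finite_measure set 'cV[R]_p -> \bar R} :=
  match p with
  | 0 => dirac (0 : 'cV[R]_0)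
  | p'.+1 => lebesgue_cons (lebesgue_vec p')
  end.

End lebesgue_vec.

Section vectors_and_matrices.
Context {R : realType}.

(* The library norm on matrices is the sup norm. *)
Definition l2norm p (v : 'cV[R]_p) : R := Num.sqrt (\sum_i v i 0 ^+ 2).

Definition opnorm m n (A : 'M[R]_(m, n)) : R :=
  sup [set l2norm (A *m v) | v in [set v : 'cV[R]_n | l2norm v <= 1]].

Definition symposdef p (A : 'M[R]_p) : Prop :=
  A^T = A /\ forall v : 'cV[R]_p, v != 0 -> 0 < (v^T *m A *m v) 0 0.

Definition normal_vec_pdf p (m : 'cV[R]_p) (Sigma : 'M[R]_p)
    (v : 'cV[R]_p) : R :=
  (Num.sqrt ((2 * pi) ^+ p * \det Sigma))^-1 *
  expR (- (1 / 2) * ((v - m)^T *m invmx Sigma *m (v - m)) 0 0).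

Definition normal_vec p (m : 'cV[R]_p) (Sigma : 'M[R]_p)
    (A : set 'cV[R]_p) : \bar R :=
  (\int[lebesgue_vec p]_(v in A) (normal_vec_pdf m Sigma v)%:E)%E.

End vectors_and_matrices.

Section random_variables.
Context d (W : measurableType d) (R : realType) (Pr : probability W R).

Definition mutually_independent (I : eqType) (X : I -> W -> R) : Prop :=
  forall (s : seq I) (A : I -> set R), uniq s ->
    (forall i, measurable (A i)) ->
    Pr (\bigcap_(i in [set` s]) (X i @^-1` A i)) =
    (\prod_(i <- s) Pr (X i @^-1` A i))%E.

Definition has_pdf (X : W -> R) (f : R -> R) : Prop :=
  forall A : set R, measurable A ->
    Pr (X @^-1` A) = (\int[@lebesgue_measure R]_(x in A) (f x)%:E)%E.

End random_variables.

Section kolmogorov_gamma.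
Context {R : realType}.

Definition Gamma_fun (b : R) : R :=
  \int[@lebesgue_measure R]_(x in `]0, +oo[) (x `^ (b - 1) * expR (- x)).

Definition gamma_pdf (b x : R) : R :=
  if 0 < x then x `^ (b - 1) * expR (- x) / Gamma_fun b else 0.

(* [mu] is the law KG(b, c).  The sequence [g] is indexed from 0, whence
   [k.+1]; the series converges almost surely and [Y] is its sum. *)
Definition KG_law (b c : R) (mu : set R -> \bar R) : Prop :=
  exists (d : measure_display) (W : measurableType d) (Pr : probability W R)
         (g : nat -> {RV Pr >-> R}) (Y : {RV Pr >-> R}),
  [/\ mutually_independent Pr (fun k => g k : W -> R),
      forall k, has_pdf Pr (g k) (gamma_pdf b),
      {ae Pr, forall w,
        (2 * pi ^+ 2)^-1 *
          (\sum_(0 <= k < N) g k w / (k.+1%:R ^+ 2 + c ^+ 2 / (4 * pi ^+ 2)))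
        @[N --> \oo] --> Y w} &
      forall A, measurable A -> mu A = Pr (Y @^-1` A)].

(* t / sinh t, with the convention 0 / sinh 0 = 1. *)
Definition sinh (t : R) : R := (expR t - expR (- t)) / 2.
Definition div_sinh (t : R) : R := if t == 0 then 1 else t / sinh t.

Definition working_response n (lambda : R) (y : 'cV[R]_n) : 'cV[R]_n :=
  lambda *: (y - const_mx (1 / 2)).

Section model.
Variables (n p : nat) (X : 'M[R]_(n, p)) (z : 'cV[R]_n)
  (m0 : 'cV[R]_p) (S0 : 'M[R]_p) (lambda : R).

Definition KG_pseudo_likelihood (beta : 'cV[R]_p) : R :=
  \prod_(i < n) (expR (z i 0 * (X *m beta) i 0) *
                 div_sinh ((X *m beta) i 0 / 2) `^ lambda).

Definition is_KG_posterior (Pi : probability 'cV[R]_p R) : Prop :=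
  exists2 C : R, 0 < C & forall A, measurable A ->
    Pi A = (\int[lebesgue_vec p]_(beta in A)
      (C * (KG_pseudo_likelihood beta * normal_vec_pdf m0 S0 beta))%R%:E)%E.

Definition post_cov (omega : 'I_n -> R) : 'M[R]_p :=
  invmx (X^T *m diag_mx (\row_i omega i) *m X + invmx S0).

Definition post_mean (omega : 'I_n -> R) : 'cV[R]_p :=
  post_cov omega *m (X^T *m z + invmx S0 *m m0).

(* P(beta, .) is the law of the new state: [omega i], i < n, are independent
   with laws KG(lambda, x_i^T beta), and given [omega] the new state has law
   N(m_omega, Sigma_omega). *)
Definition is_KG_Gibbs_kernel (P : R.-pker 'cV[R]_p ~> 'cV[R]_p) : Prop :=
  forall beta : 'cV[R]_p,
  exists (d : measure_display) (W : measurableType d) (Pr : probability W R)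
         (omega : 'I_n -> {RV Pr >-> R}),
  [/\ mutually_independent Pr (fun i => omega i : W -> R),
      forall i, KG_law lambda ((X *m beta) i 0) (distribution Pr (omega i)) &
      forall A, measurable A ->
        P beta A = (\int[Pr]_w
          normal_vec (post_mean (fun i => omega i w))
                     (post_cov (fun i => omega i w)) A)%E].

End model.
End kolmogorov_gamma.

Section kernels_and_distances.
Context d (T : measurableType d) (R : realType).

Fixpoint kernel_iter (P : R.-spker T ~> T) (t : nat) : R.-spker T ~> T :=
  match t with
  | 0 => kdirac (@measurable_id _ T setT)
  | t'.+1 => mkcomp_noparam P (kernel_iter P t')
  end.

(* In [\bar R], (+oo) - (+oo) = -oo: a test function that is not integrable for
   [mu] or [nu] contributes +oo to the suprema below. *)
Definition tv_dist (mu nu : {measure set T -> \bar R}) : \bar R :=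
  ereal_sup [set `|\int[mu]_x (f x)%:E - \int[nu]_x (f x)%:E|%E | f in
    [set f : T -> R | measurable_fun setT f /\ forall x, 0 <= f x <= 1]].

Definition weighted_dist (V : T -> R) (mu nu : {measure set T -> \bar R})
    : \bar R :=
  ereal_sup [set `|\int[mu]_x (f x)%:E - \int[nu]_x (f x)%:E|%E | f in
    [set f : T -> R | measurable_fun setT f /\ forall x, `|f x| <= V x]].

Definition kernel_invariant (P : R.-pker T ~> T) (Pi : probability T R)
    : Prop :=
  forall A, measurable A -> (\int[Pi]_x P x A = Pi A)%E.

Definition hyper_uniformly_ergodic (V : T -> R) (P : R.-pker T ~> T)
    (Pi : probability T R) : Prop :=
  kernel_invariant P Pi /\
  exists alpha K' : R, [/\ 0 < alpha < 1, 0 < K' &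
    forall x (t : nat), (1 <= t)%N ->
      (tv_dist (kernel_iter P (2 * t) x) Pi <= ((1 - alpha) ^+ t)%R%:E)%E /\
      (weighted_dist (fun u => (1 + V u)%R)
         (kernel_iter P (2 * t + 1) x) Pi
       <= (2 * (1 + K') * (1 - alpha) ^+ t)%R%:E)%E].

End kernels_and_distances.

Section wasserstein.
Context {R : realType}.
Variable p : nat.

Definition is_coupling (mu nu : {measure set 'cV[R]_p -> \bar R})
    (G : probability ('cV[R]_p * 'cV[R]_p)%type R) : Prop :=
  forall A, measurable A ->
    G (A `*` [set: 'cV[R]_p]) = mu A /\ G ([set: 'cV[R]_p] `*` A) = nu A.

Definition wasserstein_l2 (mu nu : {measure set 'cV[R]_p -> \bar R})
    : \bar R :=
  ereal_inf [set (\int[G]_uv (l2norm (uv.1 - uv.2)%R)%:E)%E | G in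
    [set G : probability ('cV[R]_p * 'cV[R]_p)%type R | is_coupling mu nu G]].

End wasserstein.

Section rates.
Context {R : realType}.
Implicit Types gamma alpha : R.

Definition rate_disc gamma alpha : R :=
  Num.sqrt ((1 - Num.min gamma alpha) ^+ 2 +
    4 * Num.min gamma alpha * (1 - Num.max alpha gamma)).

Definition lambda_plus gamma alpha : R :=
  (1 - Num.min gamma alpha + rate_disc gamma alpha) / 2.

Definition lambda_minus gamma alpha : R :=
  (1 - Num.min gamma alpha - rate_disc gamma alpha) / 2.

Definition rho (t : nat) gamma alpha : R :=
  ((1 - lambda_minus gamma alpha) * lambda_plus gamma alpha ^+ t -
   (1 - lambda_plus gamma alpha) * lambda_minus gamma alpha ^+ t) /
  (lambda_plus gamma alpha - lambda_minus gamma alpha).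

End rates.

(* Main.v *)
Require Import Defs.
From mathcomp Require Import all_boot all_order all_algebra.
From mathcomp Require Import all_classical all_reals all_analysis.
From HB Require Import structures.
From mathcomp Require Import measurable_realfun ring lra.

(** Why the theorem holds.

    Put c_i = x_i^T beta.  Three facts describe the kernel.

    - Tilting.  KG(b, c) has density (sinh(c/2) / (c/2))^b exp(-c^2 x / 2) with
      respect to KG(b, 0) ([KG_law_tilt], [KG_law_laplace]).  The law being
      defined by its random series, this is first shown for the partial sums,
      each gamma term being tilted separately, and then passes to the limit;
      the normalizing constants converge by the product formula
      prod (1 + x^2 / (pi^2 k^2)) = sinh x / x ([cvg_sinh_prod]).  Hence all
      the laws P(beta, .) can be written over one and the same family omega of
      independent KG(lambda, 0) variables ([gibbs_reference]): P(beta, .) is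
      the mixture of the Gaussian laws N(m_omega, Sigma_omega) with weights
      proportional to exp(- sum_i c_i^2 omega_i / 2).

    - Drift.  Since Sigma_omega <= Sigma_0 in the Loewner order, for every
      omega the second moment |m_omega|^2 + tr Sigma_omega of the Gaussian law
      is at most K ([post_second_moment]), hence int |u|^2 P(beta, du) <= K
      for every beta, with no dependence on beta ([gibbs_drift]).  By Markov's
      inequality, P(beta, C) >= gamma_r for every beta, where
      C = {|beta|^2 <= r K} ([sublevel_mass]).

    - Minorization.  On C, |x_i^T beta| <= c_i by Cauchy-Schwarz; there
      the weights of the mixture are at least exp(- sum_i c_i^2 omega_i / 2)
      with the constants c_i of the statement, so P(beta, .) dominates a fixed
      measure eta, of mass eps_r by the Laplace transform of KG(lambda, 0)
      ([gibbs_minorization], [tilted_mixture_total]).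

    The posterior is invariant because the product of posterior density and
    mixture weight is, as a function of (omega, beta), the density of a joint
    law whose conditional law of beta is N(m_omega, Sigma_omega): completing
    the square ([prior_tilt_posterior]) and exchanging two integrals suffices
    ([gibbs_invariant]).

    Let now f take values in [0, 1], let a bound the oscillation of P^t f over
    the whole space, and b its oscillation over C.  The next bounds are
    gamma b + (1 - gamma) a over the whole space, because every state is sent
    to C with probability at least gamma, and over C either (1 - eps) a or,
    when eps <= gamma, (gamma - eps) b + (1 - gamma) a, because the common part
    eta cancels ([spread_step]).  Starting from a = b = 1, the first bound
    follows the linear recursion of which lambda_+ and lambda_- are the
    characteristic roots, and is therefore rho_t ([rho_rec], [spread_iter]);
    using only (1 - eps) a on C, it is multiplied by 1 - gamma eps every two
    steps ([spread_iter_double]), which gives hyper-V uniform ergodicity.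
    Oscillations bound the distance to equilibrium ([spread_dist]).

    For |f| <= 1 + V, one step of the chain turns f into a function bounded
    by 1 + K, to which the previous bound applies after rescaling: this costs
    one step and the factor 2 (1 + K) ([weighted_dist_le]).  Finally, coupling
    two laws by leaving their common part in place moves mass only from the
    excess of one to the excess of the other, at a cost of at most the integral
    of |u| over both, which is a difference of integrals of the test function
    equal to |u| or - |u|; and |u| <= 1 + |u|^2 ([wasserstein_le_weighted]). *)

Set Implicit Arguments.
Unset Strict Implicit.
Unset Printing Implicit Defensive.
Import Order.TTheory GRing.Theory Num.Theory.
Import numFieldNormedType.Exports.
Local Open Scope classical_set_scope.
Local Open Scope ring_scope.

(** * Nonnegative integrals, mixtures and densities *)

Section nonnegative_measurable_induction.
Context d (T : measurableType d) (R : realType).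
Local Open Scope ereal_scope.
Import HBNNSimple.

(** The usual induction: indicators, nonnegative combinations, increasing
    limits. *)
Lemma ge0_measurable_ind (P : (T -> \bar R) -> Prop) :
    (forall A, measurable A -> P (fun x => (\1_A x)%:E)) ->
    (forall (r : R) f g, (0 <= r)%R ->
      measurable_fun setT f -> (forall x, 0 <= f x) -> P f ->
      measurable_fun setT g -> (forall x, 0 <= g x) -> P g ->
      P (fun x => r%:E * f x + g x)) ->
    (forall u : nat -> T -> \bar R,
      (forall n, measurable_fun setT (u n)) -> (forall n x, 0 <= u n x) ->
      (forall x, {homo u^~ x : n m / (n <= m)%N >-> n <= m}) ->
      (forall n, P (u n)) -> P (fun x => limn (u^~ x))) ->
  forall f, measurable_fun setT f -> (forall x, 0 <= f x) -> P f.
Proof.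
move=> Pind Plin Plim f mf f0.
have Psimple (h : {nnsfun T >-> R}) : P (fun x => (h x)%:E).
  pose g (s : seq R) x := (\sum_(r <- s) r * \1_(h @^-1` [set r]) x)%R.
  have -> : (fun x => (h x)%:E) = (fun x => (g (finmap.enum_fset (fset_set (range h))) x)%:E).
    by apply/funext => x; rewrite fimfunE fsbig_finite.
  pose Q (F : T -> \bar R) :=
    [/\ measurable_fun setT F, forall x, 0 <= F x & P F].
  suff H s : Q (fun x => (g s x)%:E).
    by case: (H (finmap.enum_fset (fset_set (range h)))).
  elim: s => [|r s [ms s0 Ps]].
    have -> : (fun x => (g [::] x)%:E) = (fun x => (\1_(@set0 T) x)%:E).
      by apply/funext => x; rewrite /g big_nil indic0.
    split; [|by move=> x; rewrite lee_fin indicE ler0n|exact: Pind].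
    by apply/measurable_EFinP; exact: measurable_indic.
  have mh : measurable (h @^-1` [set r]).
    by rewrite -[X in measurable X]setTI; exact: measurable_funP.
  have mi : measurable_fun setT (fun x => (\1_(h @^-1` [set r]) x)%:E : \bar R).
    by apply/measurable_EFinP; exact: measurable_indic.
  have E : (fun x => (g (r :: s) x)%:E) = (fun x =>
      (Num.max r 0)%:E * (\1_(h @^-1` [set r]) x)%:E + (g s x)%:E).
    apply/funext => x; rewrite /g big_cons EFinD EFinM; congr (_ + _).
    have [r0|r0] := leP 0%R r; first by [].
    by rewrite preimage_nnfun0// indic0 !mule0.
  rewrite E; split.
  - by apply: emeasurable_funD => //; exact: measurable_funeM.
  - move=> x; rewrite adde_ge0// mule_ge0 ?lee_fin//.
    by rewrite le_max lexx orbT.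
  - apply: Plin => //; first by rewrite le_max lexx orbT.
    by apply: Pind.
pose u := nnsfun_approx measurableT mf.
have -> : f = (fun x => limn (fun n => (u n x)%:E)).
  by apply/funext => x; apply/esym/cvg_lim => //; exact: cvg_nnsfun_approx.
apply: (Plim (fun n x => (u n x)%:E)) => //.
- by move=> n; exact/measurable_EFinP.
- by move=> n x; rewrite lee_fin.
- by move=> x a b ab; rewrite lee_fin; exact/lefP/nd_nnsfun_approx.
Qed.

End nonnegative_measurable_induction.

Section mixtures_and_densities.
Context d (T : measurableType d) (R : realType).
Local Open Scope ereal_scope.

Lemma ge0_integral_lin d' (Y : measurableType d')
    (nu : {measure set Y -> \bar R}) (r : R) (f g : Y -> \bar R) : (0 <= r)%R ->
  measurable_fun setT f -> (forall x, 0 <= f x) ->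
  measurable_fun setT g -> (forall x, 0 <= g x) ->
  \int[nu]_x (r%:E * f x + g x) = r%:E * \int[nu]_x f x + \int[nu]_x g x.
Proof.
move=> r0 mf f0 mg g0; rewrite ge0_integralD//.
- by rewrite ge0_integralZl_EFin.
- by move=> x _; rewrite mule_ge0 ?lee_fin.
- exact: measurable_funeM.
Qed.

Lemma ge0_integral_mixture d' (Y : measurableType d')
    (mu : {measure set Y -> \bar R}) (k : Y -> {measure set T -> \bar R})
    (m : {measure set T -> \bar R}) :
  (forall A, measurable A -> measurable_fun setT (fun y => k y A)) ->
  (forall A, measurable A -> m A = \int[mu]_y k y A) ->
  forall f, measurable_fun setT f -> (forall x, 0 <= f x) ->
    \int[m]_x f x = \int[mu]_y \int[k y]_x f x.
Proof.
move=> mk mE.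
have mint f : measurable_fun setT f -> (forall x, 0 <= f x) ->
    measurable_fun setT (fun y => \int[k y]_x f x).
  by move=> mf f0; exact: measurable_fun_integral_kernel.
have int0 f : (forall x, 0 <= f x) -> forall y, 0 <= \int[k y]_x f x.
  by move=> f0 y; exact: integral_ge0.
apply: ge0_measurable_ind => [A mA|r f g r0 mf f0 IHf mg g0 IHg|u mu_ u0 ndu IH].
- rewrite integral_indic// setIT mE//; apply: eq_integral => y _.
  by rewrite integral_indic// setIT.
- rewrite ge0_integral_lin// IHf IHg.
  under [RHS]eq_integral => y _ do rewrite ge0_integral_lin//.
  by rewrite ge0_integral_lin//; [exact: mint|exact: int0|exact: mint|exact: int0].
- rewrite monotone_convergence//.
  under [RHS]eq_integral => y _ do rewrite monotone_convergence//.
  rewrite monotone_convergence//.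
  + by congr (limn _); apply/funext => n; exact: IH.
  + by move=> n; exact: mint.
  + by move=> n y _; exact: int0.
  + move=> y _ a b ab; apply: ge0_le_integral => //.
    by move=> x _; exact: ndu.
Qed.

Lemma ge0_integral_density (mu m : {measure set T -> \bar R}) (h : T -> R) :
  measurable_fun setT h -> (forall x, (0 <= h x)%R) ->
  (forall A, measurable A -> m A = \int[mu]_(x in A) (h x)%:E) ->
  forall f, measurable_fun setT f -> (forall x, 0 <= f x) ->
    \int[m]_x f x = \int[mu]_x ((h x)%:E * f x).
Proof.
move=> mh h0 mE.
have mhE : measurable_fun setT (EFin \o h) by exact/measurable_EFinP.
have hE0 x : 0 <= (h x)%:E by rewrite lee_fin.
apply: ge0_measurable_ind => [A mA|r f g r0 mf f0 IHf mg g0 IHg|u mu_ u0 ndu IH].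
- rewrite integral_indic// setIT mE// integral_mkcond.
  apply: eq_integral => x _; rewrite patchE indicE.
  by case: ifP => _; rewrite ?mule1 ?mule0.
- rewrite ge0_integral_lin// IHf IHg.
  under [RHS]eq_integral => x _.
    rewrite ge0_muleDr ?g0 ?mule_ge0 ?lee_fin ?f0// muleCA; over.
  rewrite ge0_integral_lin//.
  + exact: emeasurable_funM.
  + by move=> y; exact: mule_ge0.
  + exact: emeasurable_funM.
  + by move=> y; exact: mule_ge0.
- rewrite monotone_convergence//.
  have -> : \int[mu]_x ((h x)%:E * limn (u^~ x)) =
      \int[mu]_x limn (fun n => (h x)%:E * u n x).
    apply: eq_integral => x _; apply/esym/cvg_lim => //.
    by apply: cvgeZl => //; exact: ereal_nondecreasing_is_cvgn.
  rewrite monotone_convergence//.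
  + by congr (limn _); apply/funext => n; exact: IH.
  + by move=> n; exact: emeasurable_funM.
  + by move=> n y _; exact: mule_ge0.
  + by move=> x _ a b ab; apply: lee_wpmul2l => //; exact: ndu.
Qed.

End mixtures_and_densities.

Section density_measure.
Context d (T : measurableType d) (R : realType).
Variables (mu : {measure set T -> \bar R}) (h : T -> R).
Hypotheses (mh : measurable_fun setT h) (h0 : forall x, 0 <= h x).

(** The hypotheses are arguments so that the measure structure below is inferred
    from the term itself. *)
Definition density_measure of measurable_fun setT h & (forall x, 0 <= h x) :=
  fun A : set T => (\int[mu]_(x in A) (h x)%:E)%E.

Local Notation nu := (density_measure mh h0).

Let density_measure0 : nu set0 = 0%E.
Proof. exact: integral_set0. Qed.

Let density_measure_ge0 A : (0 <= nu A)%E.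
Proof. by apply: integral_ge0 => x _; rewrite lee_fin. Qed.

Let density_measure_sigma_additive : semi_sigma_additive nu.
Proof.
apply: semi_sigma_additive_nng_induced; first exact/measurable_EFinP.
by move=> x; rewrite lee_fin.
Qed.

HB.instance Definition _ := isMeasure.Build _ _ _ nu
  density_measure0 density_measure_ge0 density_measure_sigma_additive.

End density_measure.

(** * The product formula for sinh *)

Lemma cvg_at_comp {R : realType} (u : nat -> R) (l : R) (f : R -> R) :
  u n @[n --> \oo] --> l -> {for l, continuous f} -> f (u n) @[n --> \oo] --> f l.
Proof. by move=> ul fl; apply: (cvg_comp u f ul). Qed.

Section sinh_product.
Context {R : realType}.
Local Notation mu := (@lebesgue_measure R).
Implicit Types (a x t : R) (n m : nat).

Lemma is_derive_continuous (F f : R -> R) : (forall x, is_derive x 1 F (f x)) ->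
  continuous F.
Proof.
move=> dF x; apply: differentiable_continuous; apply/derivable1_diffP.
by have [] := dF x.
Qed.

Lemma continuous_integrable_itv (f : R -> R) (a b : R) : continuous f ->
  mu.-integrable `[a, b] (EFin \o f).
Proof.
move=> cf; apply: continuous_compact_integrable; first exact: segment_compact.
exact: continuous_subspaceT.
Qed.

Lemma Rintegral_is_derive (F f : R -> R) (a b : R) : a < b ->
  (forall x, is_derive x 1 F (f x)) -> continuous f ->
  \int[mu]_(x in `[a, b]) f x = F b - F a.
Proof.
move=> ab dF cf; rewrite /Rintegral (@continuous_FTC2 _ f F)//.
- exact: continuous_subspaceT.
- split.
  + by move=> x _; have [] := dF x.
  + by apply: cvg_at_right_filter; exact: (is_derive_continuous dF).
  + by apply: cvg_at_left_filter; exact: (is_derive_continuous dF).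
- by move=> x _; rewrite derive1E; have [_ ->] := dF x.
Qed.

Lemma is_derive_ge0_le (F f : R -> R) (a b : R) : a <= b ->
  (forall x, is_derive x 1 F (f x)) -> (forall x, a <= x <= b -> 0 <= f x) ->
  F a <= F b.
Proof.
move=> ab dF f0; apply: (@ger0_derive1_ndecr _ F a b) => //.
- move=> x; rewrite in_itv/= => /andP[ax xb]; rewrite derive1E.
  by have [_ ->] := dF x; rewrite f0// !ltW.
- by apply: continuous_subspaceT; exact: (is_derive_continuous dF).
Qed.

(* twice the hyperbolic cosine and sine *)
Let C a t := expR (a * t) + expR (- (a * t)).
Let S a t := expR (a * t) - expR (- (a * t)).

Let is_derive_lin a t : is_derive t 1 (fun t => a * t) a.
Proof.
have h := is_deriveZ a (is_derive_id t (1 : R)).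
by apply: (is_derive_eq h); rewrite /GRing.scale /= mulr1.
Qed.

Let is_derive_C a t : is_derive t 1 (C a) (a * S a t).
Proof.
have h1 := is_derive1_comp (is_derive_expR (a * t)) (is_derive_lin a t).
have h2 := @is_derive1_comp _ expR (fun t => - (a * t)) t _ _
  (is_derive_expR (- (a * t))) (is_deriveN (is_derive_lin a t)).
by apply: (is_derive_eq (is_deriveD h1 h2)); rewrite /S; ring.
Qed.

Let is_derive_S a t : is_derive t 1 (S a) (a * C a t).
Proof.
have h1 := is_derive1_comp (is_derive_expR (a * t)) (is_derive_lin a t).
have h2 := @is_derive1_comp _ expR (fun t => - (a * t)) t _ _
  (is_derive_expR (- (a * t))) (is_deriveN (is_derive_lin a t)).
by apply: (is_derive_eq (is_deriveB h1 h2)); rewrite /C; ring.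
Qed.

(** Twice cosh x <= exp (x^2 / 2): by sinh s <= s cosh s, the function
    cosh s exp (- s^2 / 2) decreases on [0, +oo[. *)
Lemma expRDN_le x : expR x + expR (- x) <= 2 * expR (x ^+ 2 / 2).
Proof.
wlog x0 : x / 0 <= x => [h|].
  have [|x0] := leP 0 x; first exact: h.
  by rewrite -sqrrN -[in expR x](opprK x) addrC; apply: h; rewrite oppr_ge0 ltW.
have S_ge0 t : 0 <= t -> 0 <= S 1 t.
  by move=> t0; rewrite subr_ge0 ler_expR !mul1r -subr_ge0 opprK addr_ge0.
have CS t : 0 <= t -> S 1 t <= t * C 1 t.
  move=> t0; pose G s := s * C 1 s - S 1 s.
  have dG (s : R) : is_derive s 1 G (s * S 1 s).
    have h := is_deriveB (is_deriveM (is_derive_id s (1 : R)) (is_derive_C 1 s))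
      (is_derive_S 1 s).
    by apply: (is_derive_eq h); rewrite /GRing.scale /=; ring.
  have := is_derive_ge0_le t0 dG.
  rewrite /G mul0r {2}/S !mulr0 oppr0 subrr subr0 subr_ge0; apply => s /andP[s0 _].
  by rewrite mulr_ge0// S_ge0.
pose F s := - (C 1 s * expR (- (s ^+ 2 / 2))).
have dF (s : R) : is_derive s 1 F ((s * C 1 s - S 1 s) * expR (- (s ^+ 2 / 2))).
  have h1 : is_derive s 1 (fun s : R => - (s ^+ 2 / 2)) (- s).
    have h := is_deriveN (is_deriveM
      (is_deriveM (is_derive_id s (1 : R)) (is_derive_id s (1 : R)))
      (is_derive_cst (2^-1 : R) s (1 : R))).
    by apply: (is_derive_eq h); rewrite /GRing.scale /=; field.
  have h2 := @is_derive1_comp _ expR (fun s => - (s ^+ 2 / 2)) s _ _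
    (is_derive_expR _) h1.
  have h := is_deriveN (is_deriveM (is_derive_C 1 s) h2).
  by apply: (is_derive_eq h); rewrite /GRing.scale /=; ring.
have := is_derive_ge0_le x0 dF.
rewrite /F lerN2 {3}/C mulr0 expr0n mul0r oppr0 expR0 mulr1 => FF.
have {FF} : C 1 x * expR (- (x ^+ 2 / 2)) <= 2.
  by apply: FF => s /andP[s0 _]; rewrite mulr_ge0 ?expR_ge0// subr_ge0 CS.
by rewrite expRN ler_pdivrMr ?expR_gt0// /C mul1r.
Qed.

Let is_derive_cosX n t :
  is_derive t 1 (fun t => cos t ^+ n.+1) (- n.+1%:R * sin t * cos t ^+ n).
Proof.
have h := is_deriveX n.+1 (is_derive_cos t).
rewrite exprfctE in h; apply: (is_derive_eq h).
by rewrite /GRing.scale /=; ring.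
Qed.

(** Twice the integrals of cosh (a t) cos^n t over [0, pi/2] satisfy, by two
    integrations by parts, (n^2 + a^2) J_n = n (n - 1) J_(n-2); the factors of
    the product for sinh are the ratios of this recursion at a to the same
    recursion at 0. *)
Let J n a := \int[mu]_(t in `[0, pi / 2]) (C a t * cos t ^+ n).

Let continuous_C a : continuous (C a).
Proof. exact: is_derive_continuous (is_derive_C a). Qed.

Let continuous_cosX n : continuous (fun t : R => cos t ^+ n).
Proof.
case: n => [|n]; last exact: is_derive_continuous (is_derive_cosX n).
by move=> t; apply: cst_continuous.
Qed.

Let continuous_J n a : continuous (fun t => C a t * cos t ^+ n).
Proof.
by move=> t; apply: cvgM; [exact: continuous_C|exact: continuous_cosX].
Qed.

Let continuous_ZJ k n a : continuous (fun t => k * (C a t * cos t ^+ n)).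
Proof. by move=> t; apply: cvgM; [exact: cvg_cst|exact: continuous_J]. Qed.

Let J_rec n a : (n.+2%:R ^+ 2 + a ^+ 2) * J n.+2 a = n.+2%:R * n.+1%:R * J n a.
Proof.
pose F t := n.+2%:R * (C a t * (cos t ^+ n.+1 * sin t)) + a * (S a t * cos t ^+ n.+2).
pose f t := (n.+2%:R ^+ 2 + a ^+ 2) * (C a t * cos t ^+ n.+2) -
  (n.+2%:R * n.+1%:R) * (C a t * cos t ^+ n).
have dF t : is_derive t 1 F (f t).
  have h1 := is_deriveM (is_derive_C a t)
    (is_deriveM (is_derive_cosX n t) (is_derive_sin t)).
  have h2 := is_deriveM (is_derive_S a t) (is_derive_cosX n.+1 t).
  have h := is_deriveD (is_deriveZ n.+2%:R h1) (is_deriveZ a h2).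
  apply: (is_derive_eq h).
  rewrite /f /GRing.scale /= mulrfctE.
  have E : sin t ^+ 2 = 1 - cos t ^+ 2 by rewrite -(cos2Dsin2 t); ring.
  have -> : C a t * (cos t ^+ n.+1 * cos t + sin t * (- n.+1%:R * sin t * cos t ^+ n)) =
      C a t * (cos t ^+ n.+1 * cos t - n.+1%:R * cos t ^+ n * sin t ^+ 2) by ring.
  rewrite E (exprS _ n.+1) (exprS _ n) -natr1; ring.
have cf : continuous f.
  by move=> t; apply: cvgB; exact: continuous_ZJ.
have := Rintegral_is_derive (_ : 0 < pi / 2) dF cf.
rewrite divr_gt0 ?pi_gt0// => /(_ isT).
rewrite RintegralB//; do ?[exact/continuous_integrable_itv/continuous_ZJ].
rewrite !RintegralZl//; do ?[by apply: continuous_integrable_itv; exact: continuous_J].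
have -> : F (pi / 2) = 0 by rewrite /F cos_pihalf !exprS; ring.
have -> : F 0 = 0 by rewrite /F sin0 /S !mulr0 oppr0; ring.
by rewrite subr0; move/eqP; rewrite subr_eq0 => /eqP.
Qed.

Let J0 a : a * J 0 a = expR (a * (pi / 2)) - expR (- (a * (pi / 2))).
Proof.
have cf : continuous (fun t => a * C a t).
  by move=> t; apply: cvgM; [exact: cvg_cst|exact: continuous_C].
have := Rintegral_is_derive (_ : 0 < pi / 2) (is_derive_S a) cf.
rewrite divr_gt0 ?pi_gt0// => /(_ isT).
rewrite RintegralZl//; last by apply: continuous_integrable_itv; exact: continuous_C.
rewrite /S mulr0 oppr0 subrr subr0 => <-; congr (_ * _).
by apply: eq_Rintegral => t _; rewrite expr0 mulr1.
Qed.

Let cos_ge0 t : `[0, pi / 2]%classic t -> 0 <= cos t.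
Proof.
rewrite /= in_itv/= => /andP[t0 t1]; apply: cos_ge0_pihalf.
by rewrite t1 andbT (le_trans _ t0)// oppr_le0 divr_ge0// pi_ge0.
Qed.

Let C_ge2 a t : 2 <= C a t.
Proof.
have e0 := expR_gt0 (a * t); rewrite /C expRN.
rewrite -subr_ge0 (_ : _ - 2 = (expR (a * t) - 1) ^+ 2 / expR (a * t)).
  by rewrite divr_ge0 ?sqr_ge0// ltW.
by field; rewrite gt_eqF.
Qed.

Lemma sqr_le_expRDN x : 2 + x ^+ 2 <= expR x + expR (- x).
Proof.
wlog x0 : x / 0 <= x => [h|].
  have [|x0] := leP 0 x; first exact: h.
  by rewrite -sqrrN -[in expR x](opprK x) [leRHS]addrC; apply: h; rewrite oppr_ge0 ltW.
have S_ge t : 0 <= t -> 2 * t <= S 1 t.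
  move=> t0; have dG (s : R) : is_derive s 1 (fun s => S 1 s - 2 * s) (C 1 s - 2).
    have h := is_deriveB (is_derive_S 1 s) (is_derive_lin 2 s).
    by apply: (is_derive_eq h); ring.
  have := is_derive_ge0_le t0 dG.
  rewrite /= {1}/S !mulr0 oppr0 subrr addr0 subr_ge0; apply => s _.
  by rewrite subr_ge0 C_ge2.
have dF (s : R) : is_derive s 1 (fun s => C 1 s - s * s) (S 1 s - 2 * s).
  have h := is_deriveB (is_derive_C 1 s)
    (is_deriveM (is_derive_id s (1 : R)) (is_derive_id s (1 : R))).
  by apply: (is_derive_eq h); rewrite /GRing.scale /=; ring.
have := is_derive_ge0_le x0 dF.
rewrite /= {1}/C !mulr0 oppr0 expR0 addr0 -expr2 => FF.
rewrite -lerBrDr -[X in expR X + expR (- X)]mul1r.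
by apply: FF => s /andP[s0 _]; rewrite subr_ge0 S_ge.
Qed.

Let C_le a t : 0 <= a -> 0 <= t <= pi / 2 ->
  C a t <= 2 + a ^+ 2 * expR (a * (pi / 2)) * t ^+ 2.
Proof.
move=> a0 /andP[t0 t1]; have e0 := expR_gt0 (a * t).
have E : C a t - 2 = expR (a * t) * (1 - expR (- (a * t))) ^+ 2.
  by rewrite /C expRN; field; rewrite gt_eqF.
rewrite -lerBlDl E (_ : _ * _ * _ = expR (a * (pi / 2)) * (a * t) ^+ 2); last by ring.
rewrite ler_pM ?sqr_ge0 ?expR_ge0 ?ler_expR ?ler_wpM2l//.
rewrite ler_sqr ?nnegrE ?mulr_ge0//.
  by rewrite lerBlDr -lerBlDl; have := expR_ge1Dx (- (a * t)).
by rewrite subr_ge0 -expR0 ler_expR oppr_le0 mulr_ge0.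
Qed.

Let t_cos_le_sin t : 0 <= t <= pi / 2 -> t * cos t <= sin t.
Proof.
move=> /andP[t0 t1].
have dF (s : R) : is_derive s 1 (fun s : R => sin s - s * cos s) (s * sin s).
  have h := is_deriveB (is_derive_sin s)
    (is_deriveM (is_derive_id s (1:R)) (is_derive_cos s)).
  by apply: (is_derive_eq h); rewrite /GRing.scale /=; ring.
have := is_derive_ge0_le t0 dF.
rewrite sin0 mul0r subrr subr_ge0; apply => x /andP[x0 xt].
by rewrite mulr_ge0// sin_ge0_pi// x0/= (le_trans xt)// (le_trans t1)// ler_pdivrMr// ler_peMr// ?pi_ge0// ler1n.
Qed.

Let J0E n : J n 0 = 2 * \int[mu]_(t in `[0, pi / 2]) (cos t ^+ n).
Proof.
rewrite -RintegralZl//; last exact: continuous_integrable_itv.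
by apply: eq_Rintegral => t _; rewrite /C mul0r oppr0 expR0.
Qed.

Let J0_rec n : n.+2%:R * J n.+2 0 = n.+1%:R * J n 0.
Proof.
apply: (@mulfI _ n.+2%:R); first by rewrite pnatr_eq0.
by have := J_rec n 0; rewrite expr0n addr0 expr2 !mulrA.
Qed.

Let J0_gt0 m : 0 < J m.*2 0.
Proof.
elim: m => [|m IH].
  rewrite double0 J0E; under eq_Rintegral do rewrite expr0.
  rewrite Rintegral_cst//= lebesgue_measure_itv/= lte_fin divr_gt0 ?pi_gt0//=.
  by rewrite mul1r subr0 mulr_gt0// divr_gt0 ?pi_gt0.
by rewrite doubleS -(pmulr_rgt0 _ (_ : 0 < m.*2.+2%:R))// J0_rec mulr_gt0.
Qed.

Let J_ge n a : J n 0 <= J n a.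
Proof.
apply: le_Rintegral => //; do ?[exact: continuous_integrable_itv].
move=> t t01; rewrite ler_wpM2r ?exprn_ge0 ?cos_ge0//.
by rewrite {1}/C mul0r oppr0 expR0 C_ge2.
Qed.

(** From cosh (a t) - 1 = O(t^2) and t cos t <= sin t, the excess over
    J_(n+2)(0) is controlled by the integral of sin^2 cos^n, that is, by
    (J_n(0) - J_(n+2)(0)) / 2, of relative size 1 / (n + 1). *)
Let J_le n a : 0 <= a ->
  J n.+2 a <= J n.+2 0 * (1 + a ^+ 2 * expR (a * (pi / 2)) / 2 / n.+1%:R).
Proof.
move=> a0; set D := a ^+ 2 * _.
have D0 : 0 <= D by rewrite mulr_ge0 ?sqr_ge0 ?expR_ge0.
have -> : J n.+2 0 * (1 + D / 2 / n.+1%:R) =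
    \int[mu]_(t in `[0, pi / 2]) (C 0 t * cos t ^+ n.+2 +
      D / 2 * (C 0 t * cos t ^+ n - C 0 t * cos t ^+ n.+2)).
  rewrite RintegralD//; last 2 first.
  - exact: continuous_integrable_itv.
  - apply: continuous_integrable_itv => t; apply: cvgM.
      exact: cvg_cst.
    by apply: cvgB; exact: continuous_J.
  rewrite RintegralZl//; last first.
    by apply: continuous_integrable_itv => t; apply: cvgB; exact: continuous_J.
  rewrite RintegralB//; do ?[exact: continuous_integrable_itv].
  rewrite -/(J _ _) -/(J n 0).
  have -> : J n 0 = n.+2%:R / n.+1%:R * J n.+2 0.
    by rewrite mulrAC J0_rec; field; rewrite nat1r pnatr_eq0.
  by rewrite -(natr1 n.+1); field; rewrite nat1r pnatr_eq0.
apply: le_Rintegral => //.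
- exact: continuous_integrable_itv.
- apply: continuous_integrable_itv => t; apply: cvgD; first exact: continuous_J.
  apply: cvgM; first exact: cvg_cst.
  by apply: cvgB; exact: continuous_J.
move=> t t01; have c0 := cos_ge0 t01.
have t01' : 0 <= t <= pi / 2 by move: t01; rewrite /= in_itv.
have E : sin t ^+ 2 = 1 - cos t ^+ 2 by rewrite -(cos2Dsin2 t); ring.
have -> : C 0 t = 2 by rewrite /C mul0r oppr0 expR0.
have -> : 2 * cos t ^+ n.+2 + D / 2 * (2 * cos t ^+ n - 2 * cos t ^+ n.+2) =
    2 * cos t ^+ n.+2 + D * sin t ^+ 2 * cos t ^+ n.
  by rewrite E (exprS _ n.+1) (exprS _ n); field.
apply: (@le_trans _ _ ((2 + D * t ^+ 2) * cos t ^+ n.+2)).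
  by rewrite ler_wpM2r ?exprn_ge0// C_le.
rewrite mulrDl lerD2l -[leLHS]mulrA -[leRHS]mulrA ler_wpM2l//.
rewrite (_ : _ * _ = (t * cos t) ^+ 2 * cos t ^+ n); last first.
  by rewrite (exprS _ n.+1) (exprS _ n); ring.
rewrite ler_wpM2r ?exprn_ge0// lerXn2r ?t_cos_le_sin// nnegrE.
  by rewrite mulr_ge0//; case/andP: t01'.
rewrite sin_ge0_pi//; case/andP: t01' => -> /= /le_trans; apply.
by rewrite ler_pdivrMr// ler_peMr// ?pi_ge0// ler1n.
Qed.

Let J_prod a m :
  J m.*2 a / J m.*2 0 * \prod_(k < m) (1 + a ^+ 2 / (4 * k.+1%:R ^+ 2)) = J 0 a / J 0 0.
Proof.
elim: m => [|m <-]; first by rewrite big_ord0 mulr1.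
rewrite big_ord_recr/= doubleS.
have h0 := J0_gt0 m; have h1 := J0_gt0 m.+1; rewrite doubleS in h1.
have Ea := J_rec m.*2 a; have E0 := J0_rec m.*2.
have Eu : m.*2.+2%:R = 2 * m.+1%:R :> R by rewrite -doubleS -muln2 natrM mulrC.
have u0 : m.+1%:R != 0 :> R by rewrite pnatr_eq0.
have v0 : m.*2.+1%:R != 0 :> R by rewrite pnatr_eq0.
rewrite Eu in Ea E0; move: u0 v0 Ea E0.
move: (m.+1%:R : R) (m.*2.+1%:R : R) => u v u0 v0 Ea E0.
have -> : J m.*2 0 = 2 * u / v * J m.*2.+2 0 by rewrite mulrAC E0; field.
have -> : J m.*2 a = ((2 * u) ^+ 2 + a ^+ 2) * J m.*2.+2 a / (2 * u * v).
  by rewrite Ea; field; rewrite u0 v0.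
by field; rewrite v0 u0 gt_eqF.
Qed.

Let cvg_J a : 0 <= a -> (J m.*2 a / J m.*2 0) @[m --> \oo] --> (1 : R).
Proof.
move=> a0; rewrite -(cvg_shiftn 1)/=.
set D := a ^+ 2 * expR (a * (pi / 2)) / 2.
have D0 : 0 <= D by rewrite divr_ge0// mulr_ge0 ?sqr_ge0 ?expR_ge0.
apply: (@squeeze_cvgr _ _ _ _ (cst 1) (fun m => 1 + D * (m.+1%:R)^-1)).
- near=> m; rewrite addn1 /cst ler_pdivlMr// mul1r J_ge/=.
  rewrite ler_pdivrMr// mulrC doubleS (le_trans (J_le _ a0))//.
  rewrite ler_wpM2l ?(ltW (J0_gt0 m.+1))// lerD2l ler_wpM2l//.
  by rewrite lef_pV2 ?posrE// ler_nat ltnS -addnn leq_addr.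
- exact: cvg_cst.
- rewrite -[X in _ --> X]addr0 -(mulr0 D); apply: cvgD; first exact: cvg_cst.
  by apply: cvgM; [exact: cvg_cst|exact: cvg_harmonic].
Unshelve. all: by end_near. Qed.

Let J_prod_cvg a : 0 <= a ->
  \prod_(k < m) (1 + a ^+ 2 / (4 * k.+1%:R ^+ 2)) @[m --> \oo] --> J 0 a / J 0 0.
Proof.
move=> a0; have Jpos m : 0 < J m.*2 a / J m.*2 0.
  by rewrite divr_gt0//; apply: lt_le_trans (J_ge _ _); exact: J0_gt0.
have -> : (fun m => \prod_(k < m) (1 + a ^+ 2 / (4 * k.+1%:R ^+ 2))) =
    (fun m => (J m.*2 a / J m.*2 0)^-1 * (J 0 a / J 0 0)).
  apply/funext => m; rewrite -(J_prod a m) mulKf//.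
  by rewrite gt_eqF.
rewrite -[X in _ --> X]mul1r; apply: cvgM; last exact: cvg_cst.
by rewrite -invr1; apply: cvgV; [exact: oner_neq0|exact: cvg_J].
Qed.

Lemma div_sinhN x : div_sinh (- x) = div_sinh x.
Proof.
rewrite /div_sinh oppr_eq0; case: ifP => // _.
rewrite /sinh opprK (_ : (expR (- x) - _) / 2 = - ((expR x - expR (- x)) / 2)).
  by rewrite invrN mulrNN.
by ring.
Qed.

(** With a = 2 x / pi, the recursion gives the partial product up to m as
    J_0(a) / J_0(0) divided by J_2m(a) / J_2m(0).  The last ratio tends to 1:
    the mass of cos^(2m) concentrates at 0. *)
Lemma cvg_sinh_prod x :
  \prod_(k < N) (1 + x ^+ 2 / (pi ^+ 2 * k.+1%:R ^+ 2)) @[N --> \oo]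
  --> (div_sinh x)^-1.
Proof.
wlog x0 : x / 0 <= x => [h|].
  have [|x0] := leP 0 x; first exact: h.
  by rewrite -sqrrN -div_sinhN; apply: h; rewrite oppr_ge0 ltW.
pose a := 2 * x / pi; have p0 : 0 < pi :> R := pi_gt0 R.
have a0 : 0 <= a by rewrite divr_ge0 ?mulr_ge0 ?pi_ge0.
have -> : (div_sinh x)^-1 = J 0 a / J 0 0.
  rewrite /div_sinh; case: eqVneq => [xE|xn0].
    have -> : a = 0 by rewrite /a xE mulr0 mul0r.
    by rewrite divff ?invr1// gt_eqF//; exact: (J0_gt0 0).
  have an0 : a != 0 by rewrite /a !mulf_neq0 ?invr_eq0 ?pnatr_eq0 ?(gt_eqF p0).
  have -> : J 0 0 = pi.
    rewrite J0E; under eq_Rintegral do rewrite expr0.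
    rewrite Rintegral_cst//= lebesgue_measure_itv/= lte_fin divr_gt0//=.
    by rewrite mul1r subr0; field.
  have -> : J 0 a = (expR x - expR (- x)) / a.
    apply: (mulfI an0); rewrite J0 [RHS]mulrC divfK//.
    suff -> : a * (pi / 2) = x by [].
    by rewrite /a; have := gt_eqF p0; move: (pi : R) => q q0; field; rewrite q0.
  rewrite invf_div /sinh /a; have := gt_eqF p0.
  by move: (pi : R) => q q0; field; rewrite q0 xn0.
apply: cvg_trans (J_prod_cvg a0); apply: near_eq_cvg; near=> m.
apply: eq_bigr => k _; rewrite /a; congr (1 + _); have := gt_eqF p0.
by move: (pi : R) => q q0; field; rewrite q0 nat1r pnatr_eq0.
Unshelve. all: by end_near. Qed.

Lemma div_sinh_gt0 x : 0 < div_sinh x.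
Proof.
wlog x0 : x / 0 <= x => [h|].
  have [|x0] := leP 0 x; first exact: h.
  by rewrite -div_sinhN; apply: h; rewrite oppr_ge0 ltW.
rewrite /div_sinh; case: eqVneq => // xn0.
have xp : 0 < x by rewrite lt_neqAle eq_sym xn0.
rewrite divr_gt0// /sinh divr_gt0// subr_gt0 ltr_expR.
by rewrite gtrN.
Qed.

Lemma div_sinh_le1 x : div_sinh x <= 1.
Proof.
rewrite -invf_ge1 ?div_sinh_gt0//.
rewrite -(cvg_lim _ (@cvg_sinh_prod x))//; apply: limr_ge.
  by apply/cvg_ex; exists (div_sinh x)^-1; exact: cvg_sinh_prod.
apply: nearW => n; elim/big_ind : _ => // [a c a1 c1|k _].
  by rewrite (le_trans a1)// ler_peMr// (le_trans ler01).
by rewrite lerDl divr_ge0 ?sqr_ge0// mulr_ge0 ?sqr_ge0.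
Qed.

End sinh_product.

(** * Independence and joint laws *)

Section independence.
Context d (W : measurableType d) (R : realType) (Pr : probability W R).
Variables (I : eqType) (X : I -> W -> R).
Hypothesis mX : forall i, measurable_fun setT (X i).
Hypothesis indX : mutually_independent Pr X.

Lemma prod_indic_bigcap (s : seq I) (A : I -> set W) w :
  \prod_(i <- s) \1_(A i) w = \1_(\bigcap_(i in [set` s]) A i) w :> R.
Proof.
elim: s => [|i s IH].
  have -> : [set` [::]] = set0 :> set I by apply/seteqP; split.
  by rewrite big_nil bigcap_set0 indicT.
rewrite big_cons IH (_ : [set` i :: s] = i |` [set` s]) ?bigcap_setU1 ?indicI//.
apply/seteqP; split=> j; rewrite /= in_cons; first by case/predU1P; [left|right].
by case=> [->|->]; rewrite ?eqxx ?orbT.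
Qed.

Lemma prod_fineE (s : seq I) (e : I -> \bar R) :
  (forall i, e i \is a fin_num) ->
  (\prod_(i <- s) e i)%E = (\prod_(i <- s) fine (e i))%:E.
Proof.
move=> ef; elim: s => [|i s IH]; first by rewrite !big_nil.
by rewrite !big_cons IH EFinM fineK.
Qed.

Let mpre i (A : set R) : measurable A -> measurable (X i @^-1` A).
Proof. by move=> mA; rewrite -[X in measurable X]setTI; exact: mX. Qed.

(** The product rule is extended from events to functions one index at a
    time: the indices of s1 carry functions, those of s2 still carry events. *)
Let integral_prod_aux (f : I -> R -> R) (e : I -> R) (s1 : seq I) :
  (forall i, measurable_fun setT (f i)) -> (forall i x, 0 <= f i x) ->
  (forall i, \int[Pr]_w (f i (X i w))%:E = (e i)%:E)%E ->
  forall (s2 : seq I) (A : I -> set R), uniq (s1 ++ s2) ->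
    (forall i, measurable (A i)) ->
  (\int[Pr]_w ((\prod_(i <- s1) f i (X i w)) *
               \prod_(i <- s2) \1_(X i @^-1` A i) w)%:E)%E =
  ((\prod_(i <- s1) e i) * \prod_(i <- s2) fine (Pr (X i @^-1` A i)))%:E.
Proof.
move=> mf f0 fe; elim: s1 => [|j s1 IH] s2 A us mA.
  under eq_integral do rewrite big_nil mul1r prod_indic_bigcap.
  rewrite big_nil mul1r integral_indic//; last first.
    by apply: fin_bigcap_measurable => [|i _]; [exact: finite_seq|exact: mpre].
  rewrite setIT; apply: (etrans (indX (us : uniq s2) mA)).
  rewrite prod_fineE// => i.
  by rewrite fin_num_measure//; exact: mpre.
pose G w := (\prod_(i <- s1) f i (X i w)) * \prod_(i <- s2) \1_(X i @^-1` A i) w.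
pose c := (\prod_(i <- s1) e i) * \prod_(i <- s2) fine (Pr (X i @^-1` A i)).
have e0 i : 0 <= e i.
  by rewrite -lee_fin -fe; apply: integral_ge0 => w _; rewrite lee_fin.
have c0 : 0 <= c.
  by rewrite mulr_ge0// prodr_ge0// => i _; rewrite fine_ge0.
have G0 w : 0 <= G w.
  by rewrite mulr_ge0// prodr_ge0// => i _; rewrite f0.
have mG : measurable_fun setT G.
  apply: measurable_funM; apply: measurable_prod => i _.
    exact: measurableT_comp.
  by apply: measurable_indic; exact: mpre.
have mGE : measurable_fun setT (EFin \o G) by exact/measurable_EFinP.
move: us; rewrite cat_cons /= mem_cat negb_or => /andP[/andP[js1 js2] us].
have key : forall h : R -> \bar R, measurable_fun setT h ->
    (forall x, (0 <= h x)%E) ->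
    (\int[Pr]_w ((G w)%:E * h (X j w)) = c%:E * \int[Pr]_w h (X j w))%E.
  apply: ge0_measurable_ind => [B mB|r h1 h2 r0 mh1 h10 IH1 mh2 h20 IH2|
      u mu_ u0 ndu IHu].
  - pose A' i := if i == j then B else A i.
    have mA' i : measurable (A' i) by rewrite /A'; case: ifP.
    have /(IH (j :: s2) A') {IH}: uniq (s1 ++ j :: s2).
      by move: us; rewrite !cat_uniq /= (negbTE js1) js2.
    move=> /(_ mA').
    have A'E i : i \in s2 -> A' i = A i.
      by rewrite /A'; case: eqVneq => // -> js; rewrite js in js2.
    rewrite big_cons.
    have -> : \prod_(i <- s2) fine (Pr (X i @^-1` A' i)) =
       \prod_(i <- s2) fine (Pr (X i @^-1` A i)).
      by apply: eq_big_seq => i is2; rewrite A'E.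
    move=> H; transitivity (c * fine (Pr (X j @^-1` A' j)))%:E.
      rewrite /c -mulrA [X in (_ * X)%:E]mulrC -H; apply: eq_integral => w _.
      rewrite big_cons -EFinM /G; congr (_ %:E).
      rewrite [X in _ = _ * (_ * X)](_ : _ =
        \prod_(i <- s2) \1_(X i @^-1` A i) w); last first.
        by apply: eq_big_seq => i is2; rewrite A'E.
      by rewrite [in RHS]mulrCA mulrC {1}/A' eqxx.
    rewrite EFinM fineK; last by rewrite fin_num_measure//; exact: mpre.
    congr (_ * _)%E; rewrite {1}/A' eqxx.
    by rewrite (integral_indic _ measurableT (mpre _ _))// setIT.
  - have mh1X : measurable_fun setT (fun w => h1 (X j w)) by exact: measurableT_comp.
    have mh2X : measurable_fun setT (fun w => h2 (X j w)) by exact: measurableT_comp.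
    rewrite [in RHS]ge0_integral_lin// ge0_muleDr; last 2 first.
    + by rewrite mule_ge0 ?lee_fin// integral_ge0.
    + exact: integral_ge0.
    rewrite muleCA -IH1 -IH2 -ge0_integral_lin//; last 4 first.
    + exact: emeasurable_funM.
    + by move=> w; rewrite mule_ge0 ?lee_fin.
    + exact: emeasurable_funM.
    + by move=> w; rewrite mule_ge0 ?lee_fin.
    apply: eq_integral => w _.
    by rewrite ge0_muleDr ?mule_ge0 ?lee_fin// muleCA.
  - have muX n : measurable_fun setT (fun w => u n (X j w)) by exact: measurableT_comp.
    rewrite (monotone_convergence _ measurableT muX)//.
    have -> : (\int[Pr]_w ((G w)%:E * limn (u^~ (X j w))) =
        \int[Pr]_w limn (fun n => (G w)%:E * u n (X j w)))%E.
      apply: eq_integral => w _; apply/esym/cvg_lim => //.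
      by apply: cvgeZl => //; exact: ereal_nondecreasing_is_cvgn.
    rewrite monotone_convergence//; last 3 first.
    + by move=> n; exact: emeasurable_funM.
    + by move=> n w _; rewrite mule_ge0 ?lee_fin.
    + by move=> w _ a b ab; rewrite lee_wpmul2l ?lee_fin//; exact: ndu.
    transitivity (limn (fun n => c%:E * \int[Pr]_w u n (X j w))%E).
      by congr (limn _); apply/funext => n; exact: IHu.
    apply/cvg_lim => //; apply: cvgeZl => //.
    apply: ereal_nondecreasing_is_cvgn => a b ab.
    by apply: ge0_le_integral => // w _; exact: ndu.
have -> : (\int[Pr]_w ((\prod_(i <- j :: s1) f i (X i w)) *
    \prod_(i <- s2) \1_(X i @^-1` A i) w)%:E =
    \int[Pr]_w ((G w)%:E * (f j (X j w))%:E))%E.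
  apply: eq_integral => w _; rewrite big_cons -EFinM /G; congr EFin.
  by rewrite [RHS]mulrC mulrA.
rewrite (key (EFin \o f j)).
- by rewrite fe -EFinM /c big_cons; congr EFin; rewrite [LHS]mulrC mulrA.
- by apply/measurable_EFinP.
- by move=> x; rewrite lee_fin.
Qed.

Lemma independent_integral_prod (f : I -> R -> R) (e : I -> R) (s : seq I) :
  (forall i, measurable_fun setT (f i)) -> (forall i x, 0 <= f i x) ->
  (forall i, \int[Pr]_w (f i (X i w))%:E = (e i)%:E)%E -> uniq s ->
  (\int[Pr]_w (\prod_(i <- s) f i (X i w))%:E)%E = (\prod_(i <- s) e i)%:E.
Proof.
move=> mf f0 fe us.
have := @integral_prod_aux f e s mf f0 fe [::] (fun=> set0).
rewrite cats0 big_nil mulr1 => <-//.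
by apply: eq_integral => w _; rewrite big_nil mulr1.
Qed.

End independence.

Section joint_law.
Context {R : realType}.
Variable N : nat.

Definition boxes : set (set 'cV[R]_N) :=
  [set B | exists2 A : 'I_N -> set R, (forall i, measurable (A i)) &
    B = [set v : 'cV[R]_N | forall i, A i (v i 0)]].

Lemma boxes_generate : @measurable _ 'cV[R]_N = <<s boxes >>.
Proof.
apply/seteqP; split.
  apply: smallest_sub; first exact: smallest_sigma_algebra.
  move=> _ [[i j] _ [B mB <-]] /=; rewrite setTI; apply: sub_sigma_algebra.
  exists (fun k => if k == i then B else setT).
    by move=> k; case: ifP.
  apply/seteqP; split=> v /=; rewrite (ord1 j).
    by move=> Bv k; case: eqVneq => [->|].
  by move=> /(_ i); rewrite eqxx.
apply: smallest_sub; first exact: sigma_algebra_measurable.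
move=> _ [A mA ->].
have -> : [set v : 'cV[R]_N | forall i, A i (v i 0)] =
    \bigcap_(i in [set: 'I_N]) ((fun v : 'cV[R]_N => v i 0) @^-1` A i).
  by apply/seteqP; split=> v /= h i; [move=> _; exact: h|exact: h].
apply: fin_bigcap_measurable => // i _; rewrite -[X in measurable X]setTI.
exact: measurable_entry.
Qed.

Lemma boxes_setI_closed : setI_closed boxes.
Proof.
move=> _ _ [A mA ->] [B mB ->]; exists (fun i => A i `&` B i).
  by move=> i; exact: measurableI.
by apply/seteqP; split=> v /=; [case=> h1 h2 i; split|move=> h; split=> i; case: (h i)].
Qed.

Lemma measure_eq_on_boxes (m1 m2 : {measure set 'cV[R]_N -> \bar R}) :
  (m1 setT < +oo)%E ->
  (forall A : 'I_N -> set R, (forall i, measurable (A i)) ->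
    m1 [set v : 'cV[R]_N | forall i, A i (v i 0)] = m2 [set v : 'cV[R]_N | forall i, A i (v i 0)]) ->
  forall B, measurable B -> m1 B = m2 B.
Proof.
move=> m1oo m12; apply: (measure_unique boxes (fun=> setT)).
- exact: boxes_generate.
- exact: boxes_setI_closed.
- by move=> _; exists (fun=> setT) => //; apply/seteqP; split.
- by rewrite bigcup_const//; exists 0%N.
- by move=> _ [A mA ->]; exact: m12.
- by move=> _; exact: m1oo.
Qed.

Definition joint d (W : measurableType d) (X : 'I_N -> W -> R) (w : W) :
  'cV[R]_N := \col_i X i w.

Lemma measurable_joint d (W : measurableType d) (X : 'I_N -> W -> R) :
  (forall i, measurable_fun setT (X i)) -> measurable_fun setT (joint X).
Proof.
move=> mX; apply: measurable_fun_mxP => i j.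
by apply: (eq_measurable_fun (X i)) => // w _; rewrite mxE.
Qed.

Lemma joint_box d (W : measurableType d) (X : 'I_N -> W -> R) (A : 'I_N -> set R) :
  joint X @^-1` [set v : 'cV[R]_N | forall i, A i (v i 0)] =
  \bigcap_(i in [set` index_enum 'I_N]) (X i @^-1` A i).
Proof.
apply/seteqP; split=> w /=.
  by move=> h i _; have := h i; rewrite mxE.
by move=> h i; rewrite mxE; apply: h; rewrite /= mem_index_enum.
Qed.

(** By independence, both sides define measures in F that agree on boxes,
    where everything factorizes; boxes determine a finite measure. *)
Lemma joint_tilt d (W : measurableType d) (Pr : probability W R)
    d0 (W0 : measurableType d0) (Pr0 : probability W0 R)
    (X : 'I_N -> W -> R) (X0 : 'I_N -> W0 -> R) (k : 'I_N -> R)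
    (h : 'I_N -> R -> R) :
  (forall i, measurable_fun setT (X i)) ->
  (forall i, measurable_fun setT (X0 i)) ->
  mutually_independent Pr X -> mutually_independent Pr0 X0 ->
  (forall i, 0 < k i) ->
  (forall i, measurable_fun setT (h i)) -> (forall i x, 0 <= h i x) ->
  (forall i A, measurable A -> Pr (X i @^-1` A) =
    ((k i)%:E * \int[Pr0]_(w in X0 i @^-1` A) (h i (X0 i w))%:E)%E) ->
  forall F : 'cV[R]_N -> \bar R, measurable_fun setT F ->
    (forall v, (0 <= F v)%E) ->
  (\int[Pr]_w F (joint X w) = (\prod_i k i)%:E *
     \int[Pr0]_w ((\prod_i h i (X0 i w))%:E * F (joint X0 w)))%E.
Proof.
move=> mX mX0 indX indX0 k0 mh h0 tilt F mF F0.
pose H w := \prod_i h i (X0 i w).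
have mH : measurable_fun setT H.
  by apply: measurable_prod => i _; exact: measurableT_comp.
have H0 w : 0 <= H w by rewrite prodr_ge0.
have kp0 : 0 <= \prod_i k i by rewrite prodr_ge0// => i _; exact: ltW.
have mpre i (A : set R) : measurable A -> measurable (X0 i @^-1` A).
  by move=> mA; rewrite -[X in measurable X]setTI; exact: mX0.
have mJ := measurable_joint mX; have mJ0 := measurable_joint mX0.
pose m1_ : {measure set 'cV[R]_N -> \bar R} := pushforward Pr (joint X).
pose m1 := m1_ mJ.
pose nu : {measure set W0 -> \bar R} := density_measure Pr0 mH H0.
pose m2_ : {measure set 'cV[R]_N -> \bar R} :=
  mscale (NngNum kp0) (pushforward nu (joint X0)).
pose m2 := m2_ mJ0.
have m12 : forall B, measurable B -> m1 B = m2 B.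
  apply: measure_eq_on_boxes => [|A mA].
    rewrite /m1 /m1_ /= /pushforward preimage_setT.
    by rewrite ltey_eq fin_num_measure.
  rewrite /m1 /m2 /m1_ /m2_ /= /mscale/= /pushforward !joint_box.
  have -> := indX _ _ (index_enum_uniq _) mA.
  pose e i := (fine (\int[Pr0]_(w in X0 i @^-1` A i) (h i (X0 i w))%:E))%E.
  have eE i : (\int[Pr0]_(w in X0 i @^-1` A i) (h i (X0 i w))%:E = (e i)%:E)%E.
    rewrite fineK//.
    have -> : (\int[Pr0]_(w in X0 i @^-1` A i) (h i (X0 i w))%:E =
        ((k i)^-1)%:E * Pr (X i @^-1` A i))%E.
      by rewrite tilt// muleA -EFinM mulVf ?mul1e// gt_eqF.
    apply: fin_numM => //; rewrite fin_num_measure// -[X in measurable X]setTI.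
    exact: mX.
  have -> : (\prod_(i <- index_enum 'I_N) Pr (X i @^-1` A i))%E =
      (\prod_(i <- index_enum 'I_N) (k i * e i))%:E.
    rewrite prod_fineE => [|i]; last first.
      by rewrite fin_num_measure// -[X in measurable X]setTI; exact: mX.
    by congr EFin; apply: eq_bigr => i _; rewrite tilt// eE.
  rewrite big_split /= EFinM; congr (_ * _)%E.
  have <- := independent_integral_prod mX0 indX0
    (f := fun i x => h i x * \1_(A i) x) (e := e) _ _ _ (index_enum_uniq _).
  - rewrite /density_measure integral_mkcond; apply: eq_integral => w _.
    rewrite patchE big_split /=; rewrite -/(H w).
    have := prod_indic_bigcap R (index_enum 'I_N) (fun i => X0 i @^-1` A i) w.
    by rewrite indicE /= => ->; case: ifP => _; rewrite ?mulr1 ?mulr0.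
  - by move=> i; apply: measurable_funM => //; exact: measurable_indic.
  - by move=> i x; rewrite mulr_ge0.
  - move=> i; rewrite -eE [RHS]integral_mkcond; apply: eq_integral => w _.
    rewrite patchE indicE; have -> : (X0 i w \in A i) = (w \in X0 i @^-1` A i).
      by apply/idP/idP; rewrite !inE.
    by case: ifP => _; rewrite ?mulr1 ?mulr0.
transitivity (\int[m1]_v F v)%E.
  by rewrite ge0_integral_pushforward// => v _; exact: F0.
rewrite (eq_measure_integral m2); last by move=> A mA _; exact: m12.
rewrite ge0_integral_mscale//=; congr (_ * _)%E.
rewrite ge0_integral_pushforward//=.
rewrite preimage_setT (@ge0_integral_density _ _ _ Pr0 nu H)//.
  exact: measurableT_comp.
Qed.

End joint_law.

(** * Tilting gamma laws *)

Section gamma.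
Context {R : realType}.
Local Notation leb := (@lebesgue_measure R).

Lemma ge0_lebesgue_scale (s : R) (f : R -> \bar R) : 0 < s ->
  measurable_fun setT f -> (forall x, (0 <= f x)%E) ->
  (\int[leb]_x f x = s%:E * \int[leb]_x f (s * x)%R)%E.
Proof.
move=> s0 mf f0.
have ms : measurable_fun setT ( *%R s : measurableTypeR R -> measurableTypeR R).
  exact: measurable_funM.
pose m_ : {measure set (measurableTypeR R) -> \bar R} :=
  mscale (NngNum (ltW s0)) (pushforward leb ( *%R s : _ -> measurableTypeR R)).
pose m := m_ ms.
have mE A : measurable A -> leb A = m A.
  move=> mA; apply: lebesgue_measure_unique => //= _ [[a b]] _ <-.
  rewrite /m /m_ /= /mscale /= /pushforward.
  have -> : *%R s @^-1` `]a, b] = `]a / s, b / s]%classic :> set R.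
    apply/seteqP; split=> x /=; rewrite !in_itv/= ltr_pdivrMr// ler_pdivlMr//;
      by rewrite mulrC.
  rewrite !lebesgue_measure_itv/= !lte_fin ltr_pM2r ?invr_gt0//.
  by case: ifP => // _; rewrite ?mule0// -EFinD -EFinM mulrBr !mulrA ![s * _]mulrC !mulfK// gt_eqF.
rewrite (eq_measure_integral m); last by move=> A mA _; exact: mE.
rewrite ge0_integral_mscale//; congr (_ * _)%E.
by rewrite ge0_integral_pushforward.
Qed.

Lemma Gamma_fun_ge0 (b : R) : 0 <= Gamma_fun b.
Proof.
by apply: Rintegral_ge0 => x _; rewrite mulr_ge0 ?powR_ge0 ?expR_ge0.
Qed.

Lemma gamma_pdf_ge0 (b x : R) : 0 <= gamma_pdf b x.
Proof.
rewrite /gamma_pdf; case: ifP => // _.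
by rewrite divr_ge0 ?Gamma_fun_ge0// mulr_ge0 ?powR_ge0 ?expR_ge0.
Qed.

Lemma measurable_gamma_pdf (b : R) : measurable_fun setT (gamma_pdf b).
Proof.
apply: measurable_fun_if => //=.
- exact: measurable_fun_ltr.
- apply: measurable_funTS; apply: measurable_funM => //.
  apply: measurable_funM; first exact: measurable_powR.
  by apply: measurableT_comp => //.
Qed.

Lemma gamma_pdf_scale (b s x : R) : 0 < s ->
  s * gamma_pdf b (s * x) = s `^ b * (expR (- ((s - 1) * x)) * gamma_pdf b x).
Proof.
move=> s0; rewrite /gamma_pdf pmulr_rgt0//; case: ifP => [x0|_]; last by rewrite !mulr0.
have -> : s `^ b = s * s `^ (b - 1).
  have sn0 : s != 0 by rewrite gt_eqF.
  by rewrite powRB ?sn0 ?implybT// powRr1 ?ltW// mulrCA divff// mulr1.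
rewrite powRM ?ltW// (_ : - (s * x) = - ((s - 1) * x) - x) ?expRD; last by ring.
by ring.
Qed.

Section pdf.
Context d (W : measurableType d) (Pr : probability W R).

Lemma has_pdf_integral (X : W -> R) (f : R -> R) (F : R -> \bar R) :
  measurable_fun setT X -> measurable_fun setT f -> (forall x, 0 <= f x) ->
  has_pdf Pr X f -> measurable_fun setT F -> (forall x, (0 <= F x)%E) ->
  (\int[Pr]_w F (X w) = \int[leb]_x ((f x)%:E * F x))%E.
Proof.
move=> mX mf f0 pdfX mF F0.
pose m_ : {measure set (measurableTypeR R) -> \bar R} :=
  pushforward Pr (X : W -> measurableTypeR R).
pose m := m_ mX.
transitivity (\int[m]_x F x)%E; first by rewrite ge0_integral_pushforward.
by apply: ge0_integral_density => // A mA; exact: pdfX.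
Qed.

End pdf.

(** The law of g / a is tilted into that of g / a0 because rescaling a gamma
    density multiplies it by an exponential ([gamma_pdf_scale]).  The constant
    (a / a0)^b is found without knowing the value of the Gamma function. *)
Lemma gamma_tilt d (W : measurableType d) (Pr : probability W R)
    d0 (W0 : measurableType d0) (Pr0 : probability W0 R)
    (b a a0 : R) (g : W -> R) (g0 : W0 -> R) (A : set R) :
  0 < a -> 0 < a0 -> measurable_fun setT g -> measurable_fun setT g0 ->
  has_pdf Pr g (gamma_pdf b) -> has_pdf Pr0 g0 (gamma_pdf b) -> measurable A ->
  (Pr ((fun w => g w / a)%R @^-1` A) = ((a / a0) `^ b)%R%:E *
   \int[Pr0]_(w in (fun w => g0 w / a0)%R @^-1` A)
     (expR (- ((a - a0) * (g0 w / a0))))%R%:E)%E.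
Proof.
move=> ap a0p mg mg0 pg pg0 mA; set s := a / a0.
have s0 : 0 < s by rewrite divr_gt0.
have mdiv (c : R) : measurable_fun setT (fun x : R => x / c).
  exact: measurable_funM.
have mphi := measurable_gamma_pdf b; have phi0 := gamma_pdf_ge0 b.
have mB (c : R) : measurable ((fun x : R => x / c) @^-1` A).
  by rewrite -[X in measurable X]setTI; exact: mdiv.
have sE (x : R) : (s * x) / a = x / a0.
  by rewrite /s; field; rewrite !gt_eqF.
have mE (c : R) : measurable_fun setT (fun x : R => expR (- (c * x))).
  by apply: measurableT_comp => //; exact: measurableT_comp.
have -> : Pr ((fun w => g w / a)%R @^-1` A) =
    (\int[leb]_x ((gamma_pdf b x)%:E * (\1_((fun x => x / a)%R @^-1` A) x)%:E))%E.
  have -> : Pr ((fun w => g w / a)%R @^-1` A) =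
      (\int[leb]_(x in (fun x => x / a)%R @^-1` A) (gamma_pdf b x)%:E)%E.
    exact: pg.
  rewrite integral_mkcond; apply: eq_integral => x _; rewrite patchE indicE.
  by case: ifP => _; rewrite ?mule1 ?mule0.
rewrite (ge0_lebesgue_scale s0); last 2 first.
- apply/measurable_EFinP; apply: measurable_funM => //; exact: measurable_indic.
- by move=> x; rewrite -EFinM lee_fin mulr_ge0.
pose F (x : R) : \bar R := (\1_((fun x => x / a0)%R @^-1` A) x * expR (- ((s - 1) * x)))%:E.
have mF : measurable_fun setT F.
  by apply/measurable_EFinP; apply: measurable_funM => //; exact: measurable_indic.
have F0 x : (0 <= F x)%E by rewrite lee_fin mulr_ge0// expR_ge0.
transitivity ((s `^ b)%:E * \int[Pr0]_w F (g0 w))%E; last first.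
  congr (_ * _)%E; rewrite [RHS]integral_mkcond; apply: eq_integral => w _.
  rewrite /F patchE indicE.
  have -> : (g0 w \in (fun x : R => x / a0)%R @^-1` A) =
      (w \in (fun w => g0 w / a0)%R @^-1` A) by apply/idP/idP; rewrite !inE.
  case: ifP => _; rewrite ?mul0r// mul1r; congr (expR (- _))%:E.
  by rewrite /s; field; rewrite gt_eqF.
rewrite (has_pdf_integral mg0 mphi phi0 pg0 mF F0).
rewrite -!ge0_integralZl_EFin ?powR_ge0 ?ltW//; last 4 first.
- by move=> x _; rewrite mule_ge0 ?lee_fin.
- by apply: emeasurable_funM => //; exact/measurable_EFinP.
- by move=> x _; rewrite -EFinM lee_fin mulr_ge0.
- apply/measurable_EFinP; apply: measurable_funM.
    by apply: measurableT_comp => //; exact: measurable_funM.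
  by apply: measurableT_comp; [exact: measurable_indic|exact: measurable_funM].
apply: eq_integral => x _; rewrite /F -!EFinM; congr EFin.
rewrite mulrA gamma_pdf_scale// !indicE.
have -> : (s * x \in (fun x : R => x / a)%R @^-1` A) =
  (x \in (fun x => x / a0)%R @^-1` A) by apply/idP/idP; rewrite !inE /= sE.
by ring.
Qed.

Lemma gamma_laplace d (W : measurableType d) (Pr : probability W R)
    (b a a0 : R) (g : W -> R) :
  0 < a -> 0 < a0 -> measurable_fun setT g -> has_pdf Pr g (gamma_pdf b) ->
  (\int[Pr]_w (expR (- ((a - a0) * (g w / a0))))%R%:E)%E =
  (((a / a0) `^ b)^-1)%:E.
Proof.
move=> ap a0p mg pg.
have /esym := gamma_tilt ap a0p mg mg pg pg (@measurableT _ R).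
rewrite !preimage_setT probability_setT => E.
have k0 : 0 < (a / a0) `^ b by apply: powR_gt0; rewrite divr_gt0.
rewrite -[LHS]mul1e -[in LHS](mulVf (lt0r_neq0 k0)) EFinM -muleA E mule1//.
Qed.

Lemma gamma_ae_ge0 d (W : measurableType d) (Pr : probability W R)
    (b : R) (g : W -> R) : measurable_fun setT g -> has_pdf Pr g (gamma_pdf b) ->
  {ae Pr, forall w, 0 <= g w}.
Proof.
move=> mg pg; exists (g @^-1` `]-oo, 0[); split.
- by rewrite -[X in measurable X]setTI; exact: mg.
- rewrite pg// integral0_eq// => x /=; rewrite in_itv/= => x0.
  by rewrite /gamma_pdf ltNge ltW.
- by move=> w /= /negP; rewrite -ltNge in_itv/=.
Qed.

End gamma.

Section determined_by_continuous_functions.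
Context {R : realType}.

(** Indicators of half-lines ]a, +oo[ are increasing limits of continuous
    functions with values in [0, 1], and half-lines form a pi-system. *)
Lemma eq_measure_continuous (m1 m2 : {measure set R -> \bar R}) :
  (m1 setT < +oo)%E ->
  (forall f : R -> R, continuous f -> (forall x, 0 <= f x <= 1)%R ->
    \int[m1]_x (f x)%:E = \int[m2]_x (f x)%:E)%E ->
  forall A, measurable A -> m1 A = m2 A.
Proof.
move=> m1oo m12.
pose u (a : R) (n : nat) x : R := Num.min 1 (n%:R * Num.max 0 (x - a)).
have u01 a n x : 0 <= u a n x <= 1.
  by rewrite /u le_min ler01 ge_min lexx/= mulr_ge0// le_max lexx.
have cu a n : continuous (u a n).
  move=> x; apply: (@continuous_min _ _ (cst 1) (fun x => n%:R * Num.max 0 (x - a))); first exact: cvg_cst.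
  apply: cvgM; first exact: cvg_cst.
  apply: (@continuous_max _ _ (cst 0) (fun x => x - a)); first exact: cvg_cst.
  by apply: cvgB; [exact: cvg_id|exact: cvg_cst].
have mu a n : measurable_fun setT (fun x => (u a n x)%:E).
  by apply/measurable_EFinP; exact: continuous_measurable_fun.
have limu a x : (u a n x)%:E @[n --> \oo] --> (\1_(`]a, +oo[%classic) x)%:E.
  apply: cvg_EFin; first exact: nearW.
  rewrite indicE; case: (ltP a x) => [ax|xa].
    rewrite mem_set/= ?in_itv/= ?andbT//.
    apply: cvg_near_cst; near=> n.
    have xa0 : 0 < x - a by rewrite subr_gt0.
    rewrite /u (max_idPr (ltW xa0)); apply/min_idPl.
    rewrite -ler_pdivrMr// mul1r; near: n.
    exact: nbhs_infty_ger.
  rewrite memNset/= ?in_itv/= ?andbT; last by apply/negP; rewrite -leNgt.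
  apply: cvg_near_cst; near=> n.
  rewrite /=; have -> : u a n x = 0; last by [].
  rewrite /u (_ : Num.max 0 (x - a) = 0); last by apply/max_idPl; rewrite subr_le0.
  by rewrite mulr0; apply/min_idPr.
have ndu a x : {homo (fun n => (u a n x)%:E) : n m / (n <= m)%N >-> (n <= m)%E}.
  move=> k l kl; rewrite lee_fin /u le_min ge_min lexx/= ge_min.
  by rewrite ler_wpM2r ?orbT ?ler_nat// le_max lexx.
have mi a (m : {measure set R -> \bar R}) :
    m `]a, +oo[%classic = limn (fun n => \int[m]_x (u a n x)%:E)%E.
  rewrite -(setIT `]a, +oo[%classic) -integral_indic//.
  rewrite -monotone_convergence//; last first.
    by move=> n x _; rewrite lee_fin; case/andP: (u01 a n x).
  by apply: eq_integral => x _; apply/esym/cvg_lim => //; exact: limu.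
apply: (measure_unique (@RGenOInfty.G R) (fun n => `]- n%:R, +oo[%classic)).
- exact: RGenOInfty.measurableE.
- move=> _ _ [a ->] [c ->]; exists (Num.max a c).
  by apply/seteqP; split=> x /=; rewrite !in_itv/= !andbT gt_max => /andP.
- by move=> n; exists (- n%:R).
- apply/seteqP; split=> // x _; have [n _ /(_ n (leqnn n)) nx] := nbhs_infty_gtr (- x).
  by exists n => //=; rewrite in_itv/= andbT ltrNl.
- move=> _ [a ->]; rewrite !mi; congr (limn _); apply/funext => n.
  exact: m12.
- by move=> n; apply: le_lt_trans m1oo; rewrite le_measure ?inE.
Unshelve. all: by end_near. Qed.
End determined_by_continuous_functions.

(** * Tilting the Kolmogorov-Gamma laws *)

Section independent_transforms.
Context d (W : measurableType d) (R : realType) (Pr : probability W R).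

Lemma mutually_independent_map (I J : eqType) (phi : J -> I)
    (X : I -> W -> R) (f : J -> R -> R) : injective phi ->
  (forall j, measurable_fun setT (f j)) -> mutually_independent Pr X ->
  mutually_independent Pr (fun j w => f j (X (phi j) w)).
Proof.
move=> phiI mf indX s A us mA.
pose A' i := \bigcap_(j in [set j | j \in s /\ phi j = i]) (f j @^-1` A j).
have mA' i : measurable (A' i).
  apply: fin_bigcap_measurable => [|j _].
    by apply: sub_finite_set (finite_seq s) => j [].
  by rewrite -[X in measurable X]setTI; exact: mf.
have A'E j : j \in s -> A' (phi j) = f j @^-1` A j.
  move=> js; apply/seteqP; split=> x; first by apply.
  by move=> xj k [_ /phiI ->].
have := indX (map phi s) A' _ mA'; rewrite map_inj_uniq// => /(_ us).
rewrite big_map => H.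
transitivity (\prod_(j <- s) Pr (X (phi j) @^-1` A' (phi j)))%E; last first.
  by apply: eq_big_seq => j js; rewrite A'E.
rewrite -H; congr (Pr _); apply/seteqP; split=> w /= h.
  move=> _ /mapP[j js ->]; rewrite /= A'E//; exact: (h j).
move=> j js; have := h (phi j) (map_f _ js).
by rewrite /= A'E.
Qed.

Lemma cvg_integral_le1 (u : nat -> W -> R) (v : W -> R) :
  (forall n, measurable_fun setT (u n)) -> measurable_fun setT v ->
  {ae Pr, forall w, u n w @[n --> \oo] --> v w} ->
  {ae Pr, forall w, forall n, `|u n w| <= 1} ->
  Pr.-integrable setT (EFin \o v) /\
  (\int[Pr]_w (u n w)%:E @[n --> \oo] --> \int[Pr]_w (v w)%:E)%E.
Proof.
move=> mu mv uv u1.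
have [] := @dominated_convergence _ _ _ Pr setT measurableT
  (fun n w => (u n w)%:E) (fun w => (v w)%:E) (cst 1%E).
- by move=> n; exact/measurable_EFinP.
- exact/measurable_EFinP.
- apply: filterS uv => w h _; apply: cvg_EFin => //; exact: nearW.
- exact: finite_measure_integrable_cst.
- by apply: filterS u1 => w h n _; rewrite lee_fin.
- by move=> iv _; split.
Qed.

End independent_transforms.

Section kolmogorov_gamma_tilting.
Context {R : realType}.
Implicit Types (b c x : R) (k N : nat).

(** The k-th term of the series is g_k / [rate c k].  The difference
    [rate c k - rate 0 k] = c^2 / 2 does not depend on k: therefore the terms
    of the tilted series, tilted one by one, contribute together the
    exponential of the whole sum. *)
Let rate c k : R := 2 * pi ^+ 2 * (k.+1%:R ^+ 2 + c ^+ 2 / (4 * pi ^+ 2)).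

Let rate_gt0 c k : 0 < rate c k.
Proof.
rewrite mulr_gt0 ?mulr_gt0 ?exprn_gt0 ?pi_gt0// ltr_pwDl ?exprn_gt0//.
by apply: divr_ge0; [exact: sqr_ge0|apply: mulr_ge0 => //; exact: sqr_ge0].
Qed.

Let rateB c k : rate c k - rate 0 k = c ^+ 2 / 2.
Proof.
rewrite /rate; have := gt_eqF (pi_gt0 R); move: (pi : R) => q q0.
by field; rewrite q0.
Qed.

Let rate_ratio c k :
  rate c k / rate 0 k = 1 + (c / 2) ^+ 2 / (pi ^+ 2 * k.+1%:R ^+ 2).
Proof.
rewrite /rate; have := gt_eqF (pi_gt0 R); move: (pi : R) => q q0.
have : k.+1%:R != 0 :> R by rewrite pnatr_eq0.
by move: (k.+1%:R : R) => r r0; field; rewrite q0 r0.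
Qed.

Let kg_sum d (W : measurableType d) c (g : nat -> W -> R) N w : R :=
  \sum_(k < N) g k w / rate c k.

Let kg_sumE d (W : measurableType d) c (g : nat -> W -> R) N w :
  (2 * pi ^+ 2)^-1 *
    (\sum_(0 <= k < N) g k w / (k.+1%:R ^+ 2 + c ^+ 2 / (4 * pi ^+ 2))) =
  kg_sum c g N w.
Proof.
rewrite big_mkord mulr_sumr; apply: eq_bigr => k _.
rewrite /rate [in RHS]invfM mulrCA mulrA mulrC; congr (_ * _).
Qed.

Lemma powR_prod (I : Type) (s : seq I) (u : I -> R) b :
  (forall i, 0 <= u i) -> (\prod_(i <- s) u i) `^ b = \prod_(i <- s) u i `^ b.
Proof.
move=> u0; elim: s => [|i s IH]; first by rewrite !big_nil powR1.
by rewrite !big_cons powRM ?IH// prodr_ge0.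
Qed.

Let const c N : R :=
  \prod_(k < N) (1 + (c / 2) ^+ 2 / (pi ^+ 2 * k.+1%:R ^+ 2)).

Let constE b c N : \prod_(i < N) (rate c i / rate 0 i) `^ b = const c N `^ b.
Proof.
rewrite /const powR_prod => [|i].
  by apply: eq_bigr => i _; rewrite rate_ratio.
by rewrite -rate_ratio ltW// divr_gt0.
Qed.

Let measurable_kg_sum d (W : measurableType d) c (g : nat -> W -> R) N :
  (forall k, measurable_fun setT (g k)) -> measurable_fun setT (kg_sum c g N).
Proof.
by move=> mg; apply: measurable_sum => k; exact: measurable_funM.
Qed.

(** The tilt for partial sums; its constant is the partial product for
    sinh (c / 2) / (c / 2), to the power b. *)
Let kg_sum_tilt b c d (W : measurableType d) (Pr : probability W R)
    (g : nat -> W -> R) d0 (W0 : measurableType d0) (Pr0 : probability W0 R)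
    (g0 : nat -> W0 -> R) N (F : R -> R) :
  (forall k, measurable_fun setT (g k)) ->
  (forall k, measurable_fun setT (g0 k)) ->
  mutually_independent Pr g -> mutually_independent Pr0 g0 ->
  (forall k, has_pdf Pr (g k) (gamma_pdf b)) ->
  (forall k, has_pdf Pr0 (g0 k) (gamma_pdf b)) ->
  measurable_fun setT F -> (forall x, 0 <= F x) ->
  (\int[Pr]_w (F (kg_sum c g N w))%:E = (const c N `^ b)%:E *
   \int[Pr0]_w (expR (- (c ^+ 2 / 2 * kg_sum 0 g0 N w)) *
                F (kg_sum 0 g0 N w))%R%:E)%E.
Proof.
move=> mg mg0 ig ig0 pg pg0 mF F0.
pose X (i : 'I_N) w := g i w / rate c i.
pose X0 (i : 'I_N) w := g0 i w / rate 0 i.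
pose Fv (v : 'cV[R]_N) := (F (\sum_i v i 0))%:E.
have mdiv (r : R) : measurable_fun setT (fun x : R => x / r).
  exact: measurable_funM.
have mFv : measurable_fun setT Fv.
  apply/measurable_EFinP; apply: measurableT_comp => //.
  by apply: measurable_sum => i; exact: measurable_entry.
pose h (i : 'I_N) x := expR (- (c ^+ 2 / 2 * x)).
have E e (V : measurableType e) (Y : 'I_N -> V -> R) w :
    \sum_i joint Y w i 0 = \sum_i Y i w.
  by apply: eq_bigr => i _; rewrite mxE.
transitivity (\int[Pr]_w Fv (joint X w))%E.
  by apply: eq_integral => w _; rewrite /Fv E.
rewrite (@joint_tilt _ _ _ _ Pr _ _ Pr0 X X0
  (fun i => (rate c i / rate 0 i) `^ b) h).
- rewrite constE; congr (_ * _)%E; apply: eq_integral => w _.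
  rewrite /Fv E -EFinM; congr (_ * _)%:E.
  rewrite /h -expR_sum; congr expR.
  by rewrite sumrN -mulr_sumr.
- by move=> i; exact: measurable_funM.
- by move=> i; exact: measurable_funM.
- exact: (mutually_independent_map (f := fun (i : 'I_N) x => x / rate c i)
    val_inj _ ig).
- exact: (mutually_independent_map (f := fun (i : 'I_N) x => x / rate 0 i)
    val_inj _ ig0).
- by move=> i; apply: powR_gt0; rewrite divr_gt0.
- by move=> i; apply: measurableT_comp => //; exact: measurableT_comp.
- by move=> i x; exact: expR_ge0.
- move=> i A mA; rewrite (gamma_tilt (rate_gt0 c i) (rate_gt0 0 i) (mg i)
    (mg0 i) (pg i) (pg0 i) mA).
  by rewrite rateB.
- exact: mFv.
- by move=> v; rewrite lee_fin.
Qed.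

Let kg_sum_laplace b c d (W : measurableType d) (Pr : probability W R)
    (g : nat -> W -> R) N :
  (forall k, measurable_fun setT (g k)) -> mutually_independent Pr g ->
  (forall k, has_pdf Pr (g k) (gamma_pdf b)) ->
  (\int[Pr]_w (expR (- (c ^+ 2 / 2 * kg_sum 0 g N w)))%:E =
   ((const c N `^ b)^-1)%:E)%E.
Proof.
move=> mg ig pg.
pose h k x := expR (- (c ^+ 2 / 2 * (x / rate 0 k))).
have mh k : measurable_fun setT (h k).
  apply: measurableT_comp => //; apply: measurableT_comp => //.
  by apply: measurable_funM => //; exact: measurable_funM.
have := @independent_integral_prod _ _ _ Pr _ g mg ig h
  (fun k => ((rate c k / rate 0 k) `^ b)^-1) (index_iota 0 N) mh
  (fun k x => expR_ge0 _) _ (iota_uniq _ _).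
rewrite prodfV big_mkord constE => <-.
  apply: eq_integral => w _; congr EFin; rewrite big_mkord -expR_sum; congr expR.
  by rewrite sumrN -mulr_sumr.
by move=> k; rewrite -(gamma_laplace (rate_gt0 c k) (rate_gt0 0 k) (mg k) (pg k)) rateB.
Qed.

Let cvg_const b c : const c N `^ b @[N --> \oo] --> ((div_sinh (c / 2)) `^ b)^-1.
Proof.
have h := @cvg_sinh_prod R (c / 2); have d0 := div_sinh_gt0 (c / 2).
have k0 N : 0 < const c N.
  rewrite /const; elim/big_ind : _ => // [x y|i _]; first exact: mulr_gt0.
  by rewrite -rate_ratio divr_gt0.
have powE x : 0 < x -> x `^ b = expR (b * ln x).
  by move=> x0; rewrite /powR gt_eqF.
rewrite powE// -expRN -mulrN -lnV ?posrE//.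
have -> : (fun N => const c N `^ b) = (fun N => expR (b * ln (const c N))).
  by apply/funext => N; rewrite powE.
apply: (@cvg_at_comp R (fun N => b * ln (const c N)) _ expR); last exact: continuous_expR.
apply: cvgM; first exact: cvg_cst.
apply: (@cvg_at_comp R _ _ (@ln R) h).
by apply: continuous_ln; rewrite invr_gt0.
Qed.

Let realization b c d (W : measurableType d) (Pr : probability W R)
    (g : nat -> W -> R) (Y : W -> R) :=
  [/\ forall k, measurable_fun setT (g k), mutually_independent Pr g,
      forall k, has_pdf Pr (g k) (gamma_pdf b), measurable_fun setT Y &
      {ae Pr, forall w, kg_sum c g N w @[N --> \oo] --> Y w}].

Let kg_sum_ge0 b c d (W : measurableType d) (Pr : probability W R)
    (g : nat -> W -> R) :
  (forall k, measurable_fun setT (g k)) ->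
  (forall k, has_pdf Pr (g k) (gamma_pdf b)) ->
  {ae Pr, forall w, forall N, 0 <= kg_sum c g N w}.
Proof.
move=> mg pg; have := ae_foralln (fun k => gamma_ae_ge0 (mg k) (pg k)).
apply: filterS => w gw N; apply: sumr_ge0 => k _.
by rewrite divr_ge0// ltW.
Qed.

Let realization_ge0 b c d (W : measurableType d) (Pr : probability W R)
    (g : nat -> W -> R) (Y : W -> R) : realization b c Pr g Y ->
  {ae Pr, forall w, 0 <= Y w}.
Proof.
case=> mg ig pg mY gY; apply: filterS2 gY (kg_sum_ge0 c mg pg) => w wY w0.
rewrite -(cvg_lim _ wY)//; apply: limr_ge; first by apply/cvg_ex; exists (Y w).
exact: nearW.
Qed.

Let realization_laplace b c d (W : measurableType d) (Pr : probability W R)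
    (g : nat -> W -> R) (Y : W -> R) : realization b 0 Pr g Y ->
  (\int[Pr]_w (expR (- (c ^+ 2 / 2 * Y w)))%:E)%E = (div_sinh (c / 2) `^ b)%:E.
Proof.
case=> mg ig pg mY gY.
pose u N w := expR (- (c ^+ 2 / 2 * kg_sum 0 g N w)).
have c0 : 0 <= c ^+ 2 / 2 by rewrite divr_ge0 ?sqr_ge0.
have me (F : W -> R) : measurable_fun setT F ->
    measurable_fun setT (fun w => expR (- (c ^+ 2 / 2 * F w))).
  move=> mF; apply: measurableT_comp => //; apply: measurableT_comp => //.
  exact: measurable_funM.
have [_ h] : Pr.-integrable setT (fun w => (expR (- (c ^+ 2 / 2 * Y w)))%:E) /\
    (\int[Pr]_w (u N w)%:E @[N --> \oo] -->
    \int[Pr]_w (expR (- (c ^+ 2 / 2 * Y w)))%:E)%E.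
  apply: cvg_integral_le1.
  - by move=> N; apply: me; exact: measurable_kg_sum.
  - exact: me.
  - apply: filterS gY => w wY.
    apply: (@cvg_at_comp R (fun n => - (c ^+ 2 / 2 * kg_sum 0 g n w)) _ expR).
      by apply: cvgN; apply: cvgM => //; exact: cvg_cst.
    exact: continuous_expR.
  - apply: filterS (kg_sum_ge0 0 mg pg) => w w0 N.
    by rewrite ger0_norm ?expR_ge0// -expR0 ler_expR oppr_le0 mulr_ge0.
apply: (cvg_unique _ h); first exact: ereal_hausdorff.
rewrite (_ : (fun N => _) = (fun N => ((const c N `^ b)^-1)%:E)); last first.
  by apply/funext => N; exact: kg_sum_laplace.
apply: cvg_EFin; first exact: nearW.
rewrite -[X in _ --> X]invrK; apply: cvgV; last exact: cvg_const.
by rewrite invr_eq0 gt_eqF// powR_gt0// div_sinh_gt0.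
Qed.

Let realization_tilt b c d (W : measurableType d) (Pr : probability W R)
    (g : nat -> W -> R) (Y : W -> R)
    d0 (W0 : measurableType d0) (Pr0 : probability W0 R)
    (g0 : nat -> W0 -> R) (Y0 : W0 -> R) (f : R -> R) :
  realization b c Pr g Y -> realization b 0 Pr0 g0 Y0 ->
  continuous f -> (forall x, 0 <= f x <= 1) ->
  (\int[Pr]_w (f (Y w))%:E = ((div_sinh (c / 2) `^ b)^-1)%:E *
     \int[Pr0]_w (expR (- (c ^+ 2 / 2 * Y0 w)) * f (Y0 w))%R%:E)%E.
Proof.
case=> mg ig pg mY gY [mg0 ig0 pg0 mY0 gY0] cf f01.
have f0 x : 0 <= f x by case/andP: (f01 x).
have mf : measurable_fun setT f by exact: continuous_measurable_fun.
have c0 : 0 <= c ^+ 2 / 2 by rewrite divr_ge0 ?sqr_ge0.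
pose F x := expR (- (c ^+ 2 / 2 * x)) * f x.
have cF : continuous F.
  move=> x; apply: cvgM; last exact: cf.
  apply: (@continuous_comp _ _ _ (fun x => - (c ^+ 2 / 2 * x)) expR).
    by apply: cvgN; apply: cvgM; [exact: cvg_cst|exact: cvg_id].
  exact: continuous_expR.
have mF : measurable_fun setT F by exact: continuous_measurable_fun.
have [_ h1] : Pr.-integrable setT (fun w => (f (Y w))%:E) /\
    (\int[Pr]_w (f (kg_sum c g N w))%:E @[N --> \oo] -->
    \int[Pr]_w (f (Y w))%:E)%E.
  apply: cvg_integral_le1.
  - by move=> N; apply: measurableT_comp => //; exact: measurable_kg_sum.
  - exact: measurableT_comp.
  - by apply: filterS gY => w wY; exact: (cvg_at_comp wY (cf (Y w))).
  - by apply: nearW => w N; rewrite ger0_norm//; case/andP: (f01 (kg_sum c g N w)).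
have [i0 h0] : Pr0.-integrable setT (fun w => (F (Y0 w))%:E) /\
    (\int[Pr0]_w (F (kg_sum 0 g0 N w))%:E @[N --> \oo] -->
    \int[Pr0]_w (F (Y0 w))%:E)%E.
  apply: cvg_integral_le1.
  - by move=> N; apply: measurableT_comp => //; exact: measurable_kg_sum.
  - exact: measurableT_comp.
  - by apply: filterS gY0 => w wY; exact: (cvg_at_comp wY (cF (Y0 w))).
  - apply: filterS (kg_sum_ge0 0 mg0 pg0) => w w0 N.
    rewrite ger0_norm ?mulr_ge0 ?expR_ge0// mulr_ile1 ?expR_ge0//.
      by rewrite -[leRHS]expR0 ler_expR oppr_le0 mulr_ge0.
    by case/andP: (f01 (kg_sum 0 g0 N w)).
apply: (cvg_unique _ h1); first exact: ereal_hausdorff.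
rewrite (_ : (fun N => _) = (fun N => (const c N `^ b)%:E *
    \int[Pr0]_w (F (kg_sum 0 g0 N w))%:E)%E); last first.
  by apply/funext => N; exact: kg_sum_tilt.
apply: cvgeM => //; last first.
  by apply: cvg_EFin; [exact: nearW|exact: cvg_const].
by apply: mule_def_fin => //; exact: integrable_fin_num.
Qed.

Let KG_law_realization b c (mu : set R -> \bar R) : KG_law b c mu ->
  exists d (W : measurableType d) (Pr : probability W R)
    (g : nat -> W -> R) (Y : W -> R), realization b c Pr g Y /\
    forall A, measurable A -> mu A = Pr (Y @^-1` A).
Proof.
move=> [d [W [Pr [g [Y [ig pg gY muE]]]]]].
exists d, W, Pr, (fun k => g k : W -> R), (Y : W -> R); split=> //; split=> //.
- apply: filterS gY => w; apply: cvg_trans.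
  by apply: near_eq_cvg; apply: nearW => N; exact: (@kg_sumE _ W c (fun k => g k : W -> R) N w).
Qed.

Let law_integral d (W : measurableType d) (Pr : probability W R) (Y : W -> R)
    (mu : probability R R) (F : R -> \bar R) : measurable_fun setT Y ->
  (forall A, measurable A -> mu A = Pr (Y @^-1` A)) ->
  measurable_fun setT F -> (forall x, (0 <= F x)%E) ->
  (\int[mu]_x F x = \int[Pr]_w F (Y w))%E.
Proof.
move=> mY muE mF F0.
pose m_ : {measure set R -> \bar R} := pushforward Pr Y.
pose m := m_ mY.
rewrite (eq_measure_integral m) => [|A mA _]; last exact: muE.
by rewrite ge0_integral_pushforward.
Qed.

Let measurable_tilt c :
  measurable_fun setT (fun x : R => expR (- (c ^+ 2 / 2 * x))).
Proof.
by apply: measurableT_comp => //; exact: measurableT_comp.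
Qed.

(** The series for c and for 0 live on unrelated probability spaces, so the
    tilt passes to the limit in law: dominated convergence for bounded
    continuous functions, which determine the measure. *)
Lemma KG_law_tilt b c (mu0 mu : probability R R) :
  KG_law b 0 mu0 -> KG_law b c mu -> forall A, measurable A ->
  (mu A = ((div_sinh (c / 2) `^ b)^-1)%:E *
          \int[mu0]_(x in A) (expR (- (c ^+ 2 / 2 * x)))%R%:E)%E.
Proof.
move=> /KG_law_realization[d0 [W0 [Pr0 [g0 [Y0 [r0 mu0E]]]]]].
move=> /KG_law_realization[d [W [Pr [g [Y [r muE]]]]]].
have [_ _ _ mY _] := r; have [_ _ _ mY0 _] := r0.
have k0 : 0 <= (div_sinh (c / 2) `^ b)^-1 by rewrite invr_ge0 powR_ge0.
have mt := measurable_tilt c.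
pose nu : {measure set R -> \bar R} :=
  density_measure mu0 mt (fun x => expR_ge0 _).
pose m2 : {measure set R -> \bar R} := mscale (NngNum k0) nu.
apply: (@eq_measure_continuous _ mu m2) => [|f cf f01].
  by rewrite ltey_eq fin_num_measure.
have mf : measurable_fun setT (fun x => (f x)%:E).
  by apply/measurable_EFinP; exact: continuous_measurable_fun.
have f0 x : (0 <= (f x)%:E)%E by rewrite lee_fin; case/andP: (f01 x).
rewrite (law_integral mY muE)// ge0_integral_mscale//= (realization_tilt r r0)//.
congr (_ * _)%E.
rewrite (@ge0_integral_density _ _ _ mu0 nu (fun x => expR (- (c ^+ 2 / 2 * x))))//.
rewrite (law_integral mY0 mu0E)//.
- by apply: emeasurable_funM => //; exact/measurable_EFinP.
- by move=> x; rewrite mule_ge0// lee_fin expR_ge0.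
Qed.

Lemma KG_law_laplace b c (mu0 : probability R R) : KG_law b 0 mu0 ->
  (\int[mu0]_x (expR (- (c ^+ 2 / 2 * x)))%:E)%E = (div_sinh (c / 2) `^ b)%:E.
Proof.
move=> /KG_law_realization[d0 [W0 [Pr0 [g0 [Y0 [r0 mu0E]]]]]].
have [_ _ _ mY0 _] := r0.
rewrite (law_integral mY0 mu0E); first exact: realization_laplace r0.
- by apply/measurable_EFinP; exact: measurable_tilt.
- by move=> x; rewrite lee_fin expR_ge0.
Qed.

Lemma KG_law_ge0 b c (mu : probability R R) : KG_law b c mu ->
  mu `]-oo, 0[%classic = 0%E.
Proof.
move=> /KG_law_realization[d [W [Pr [g [Y [r muE]]]]]].
rewrite muE//; have [_ _ _ mY _] := r; apply/negligibleP.
  by rewrite -[X in measurable X]setTI; exact: mY.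
apply: negligibleS (realization_ge0 r) => w /=.
by rewrite in_itv/= ltNge => /negP.
Qed.

End kolmogorov_gamma_tilting.

(** * Gaussian integrals on R^p *)

Lemma measurable_inv (R : realType) : measurable_fun setT (fun x : R => x^-1).
Proof.
(* a power of a nonnegative number, since measurability of powers is known *)
apply: (eq_measurable_fun (fun x : R => x * (x ^+ 2) `^ (-1))).
  move=> x _; rewrite powR_inv1 ?sqr_ge0//.
  have [->|x0] := eqVneq x 0; first by rewrite mul0r invr0.
  by rewrite expr2 invfM mulVKf.
apply: measurable_funM => //; apply: (measurableT_comp (measurable_powR (-1))).
exact: measurable_funX.
Qed.

Section measurable_matrix_operations.
Context d (T : measurableType d) (R : realType).

Definition measurable_mx m n (f : T -> 'M[R]_(m, n)) :=
  forall i j, measurable_fun setT (fun x => f x i j).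

Lemma measurable_mx_cst m n (A : 'M[R]_(m, n)) : measurable_mx (fun=> A).
Proof. by move=> i j; exact: measurable_cst. Qed.

Lemma measurable_mxD m n (f g : T -> 'M[R]_(m, n)) :
  measurable_mx f -> measurable_mx g -> measurable_mx (fun x => f x + g x).
Proof.
move=> mf mg i j; apply: (eq_measurable_fun (fun x => f x i j + g x i j)).
  by move=> x _; rewrite mxE.
exact: measurable_funD.
Qed.

Lemma measurable_mxB m n (f g : T -> 'M[R]_(m, n)) :
  measurable_mx f -> measurable_mx g -> measurable_mx (fun x => f x - g x).
Proof.
move=> mf mg i j; apply: (eq_measurable_fun (fun x => f x i j - g x i j)).
  by move=> x _; rewrite !mxE.
exact: measurable_funB.
Qed.

Lemma measurable_mxT m n (f : T -> 'M[R]_(m, n)) :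
  measurable_mx f -> measurable_mx (fun x => (f x)^T).
Proof.
move=> mf i j; apply: (eq_measurable_fun (fun x => f x j i)) => // x _.
by rewrite mxE.
Qed.

Lemma measurable_mxM m n p (f : T -> 'M[R]_(m, n)) (g : T -> 'M[R]_(n, p)) :
  measurable_mx f -> measurable_mx g -> measurable_mx (fun x => f x *m g x).
Proof.
move=> mf mg i j.
apply: (eq_measurable_fun (fun x => \sum_k f x i k * g x k j)).
  by move=> x _; rewrite mxE.
by apply: measurable_sum => k; exact: measurable_funM.
Qed.

Lemma measurable_det n (f : T -> 'M[R]_n) :
  measurable_mx f -> measurable_fun setT (fun x => \det (f x)).
Proof.
move=> mf; apply: measurable_sum => s; apply: measurable_funM => //.
by apply: measurable_prod => i _; exact: mf.
Qed.

Lemma measurable_invmx n (f : T -> 'M[R]_n) :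
  measurable_mx f -> measurable_mx (fun x => invmx (f x)).
Proof.
move=> mf i j; have mdet := measurable_det mf.
have madj : measurable_fun setT (fun x => cofactor (f x) j i).
  apply: measurable_funM => //; apply: measurable_det => k l.
  apply: (eq_measurable_fun (fun x => f x (lift j k) (lift i l))) => // x _.
  by rewrite !mxE.
apply: (eq_measurable_fun (fun x => if \det (f x) == 0 then f x i j else
    (\det (f x))^-1 * cofactor (f x) j i)).
  move=> x _; rewrite /invmx unitmxE unitfE; case: eqVneq => //= _.
  by rewrite !mxE.
apply: measurable_fun_if => //.
- apply: measurable_fun_eqr => //; exact: mdet.
- by apply: measurable_funTS; exact: mf.
- apply: measurable_funTS; apply: measurable_funM => //.
  exact: (measurableT_comp (@measurable_inv R) mdet).
Qed.

End measurable_matrix_operations.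

Section gaussian_integral.
Context {R : realType}.
Local Notation leb := (@lebesgue_measure R).
Implicit Types p : nat.

Local Notation qf Q w := ((w^T *m Q *m w) 0 0).

Lemma ge0_integral_lebesgue_vecS p (f : 'cV[R]_p.+1 -> \bar R) :
  measurable_fun setT f -> (forall v, (0 <= f v)%E) ->
  (\int[lebesgue_vec p.+1]_v f v =
   \int[lebesgue_vec p]_u \int[leb]_x f (cons_vec (x, u)))%E.
Proof.
move=> mf f0.
pose m_ : {measure set 'cV[R]_p.+1 -> \bar R} :=
  pushforward (leb \x lebesgue_vec p)%E (@cons_vec R p).
pose m := m_ (@measurable_cons_vec R p).
rewrite (eq_measure_integral m)//.
have mc := @measurable_cons_vec R p.
rewrite ge0_integral_pushforward// preimage_setT fubini_tonelli2//=.
  exact: (measurableT_comp mf mc).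
Qed.

Lemma gauss1_integral (a m : R) : 0 < a ->
  (\int[leb]_x (expR (- (1 / 2) * (a * (x - m) ^+ 2)))%:E =
   (Num.sqrt (2 * pi / a))%:E)%E.
Proof.
move=> a0; pose s : R := Num.sqrt a^-1.
have s0 : s != 0 by rewrite gt_eqF// sqrtr_gt0 invr_gt0.
have s2 : s ^+ 2 = a^-1 by rewrite sqr_sqrtr// invr_ge0 ltW.
pose k := Num.sqrt (2 * pi / a).
have k0 : 0 < k by rewrite sqrtr_gt0 divr_gt0// mulr_gt0// pi_gt0.
transitivity (\int[leb]_x (k%:E * (normal_pdf m s x)%:E))%E.
  apply: eq_integral => x _; rewrite normal_pdfE// -EFinM; congr EFin.
  rewrite /normal_peak s2 (_ : a^-1 * pi *+ 2 = 2 * pi / a); last first.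
    by rewrite -mulr_natl; ring.
  rewrite mulVKf ?gt_eqF// /normal_fun s2; congr expR.
  by rewrite -mulr_natl; field; rewrite gt_eqF.
rewrite ge0_integralZl_EFin// ?ltW//.
- by rewrite integral_normal_pdf// mule1.
- by move=> x _; rewrite lee_fin normal_pdf_ge0.
- by apply/measurable_EFinP; exact: measurable_normal_pdf.
Qed.

Lemma cons_vecE p (y : R) (t : 'cV[R]_p) : cons_vec (y, t) = col_mx y%:M t.
Proof.
apply/colP => i; rewrite mxE; case: (unliftP ord0 i) => [j|] ->.
  have -> : lift ord0 j = rshift 1 j :> 'I_(1 + p) by apply/val_inj.
  by rewrite (col_mxEd (y%:M : 'M[R]_1)).
have -> : ord0 = lshift p ord0 :> 'I_(1 + p) by apply/val_inj.
by rewrite (col_mxEu (y%:M : 'M[R]_1)) mxE eqxx mulr1n.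
Qed.

(** Completing the square in the first coordinate; S is the Schur complement
    of the upper left entry. *)
Lemma symposdef_Schur p (Q : 'M[R]_p.+1) : symposdef Q ->
  exists a (r : 'rV[R]_p) (S : 'M[R]_p),
  [/\ 0 < a, symposdef S, \det Q = a * \det S &
   forall y (t : 'cV[R]_p),
     qf Q (cons_vec (y, t)) = a * (y + (r *m t) 0 0 / a) ^+ 2 + qf S t].
Proof.
move=> [QT Qpos].
pose a := Q 0 0; pose r : 'rV[R]_p := @ursubmx _ 1 p 1 p Q.
pose D : 'M[R]_p := @drsubmx _ 1 p 1 p Q.
pose S := D - a^-1 *: (r^T *m r).
have QE : Q = block_mx (a%:M : 'M[R]_1) r r^T D.
  have e1 : @ulsubmx _ 1 p 1 p Q = a%:M.
    apply/matrixP => i j; rewrite !ord1 !mxE eqxx mulr1n.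
    by congr (Q _ _); apply/val_inj.
  have e2 : @dlsubmx _ 1 p 1 p Q = r^T by rewrite /r trmx_ursub QT.
  by rewrite -[LHS](@submxK _ 1 p 1 p) e1 e2.
have a0 : 0 < a.
  have := Qpos (cons_vec (1, 0)); rewrite cons_vecE QE.
  rewrite (@tr_col_mx _ 1 p 1) (@mul_row_block _ 1 1 p 1 p) (@mul_row_col _ 1 1 p 1) !trmx0 !mul0mx !mulmx0 !addr0.
  rewrite tr_scalar_mx mul1mx mulmx1 !mxE eqxx mulr1n; apply.
  apply/eqP => /(congr1 (fun v : 'cV[R]_(1 + p) => v (lshift p 0) 0)).
  by rewrite (col_mxEu (1%:M : 'M[R]_1)) !mxE => /eqP; rewrite oner_eq0.
have qfE y (t : 'cV[R]_p) :
    qf Q (cons_vec (y, t)) = a * (y + (r *m t) 0 0 / a) ^+ 2 + qf S t.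
  set k := (r *m t) 0 0.
  have rt : r *m t = k%:M by exact: mx11_scalar.
  have tr : t^T *m r^T = k%:M by rewrite -trmx_mul rt tr_scalar_mx.
  have -> : qf S t = qf D t - a^-1 * k ^+ 2.
    rewrite /S mulmxBr mulmxBl -scalemxAr -scalemxAl !mulmxA tr -[k%:M *m r *m t]mulmxA rt.
    by rewrite -scalar_mxM !mxE eqxx mulr1n expr2.
  rewrite cons_vecE QE (@tr_col_mx _ 1 p 1) (@mul_row_block _ 1 1 p 1 p).
  rewrite (@mul_row_col _ 1 1 p 1) tr_scalar_mx.
  rewrite tr !mulmxDl -[y%:M *m r *m t]mulmxA rt -!scalar_mxM.
  rewrite !mxE eqxx !mulr1n -/(qf D t).
  have an0 : a != 0 by rewrite gt_eqF.
  by move: (qf D t) => q; field.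
exists a, r, S; split=> //.
- split.
    rewrite /S linearB /= linearZ /= trmx_mul trmxK; congr (_ - _).
    by rewrite /D trmx_drsub QT.
  move=> t t0; have := Qpos (cons_vec (- ((r *m t) 0 0 / a), t)).
  rewrite qfE addNr expr0n mulr0 add0r; apply.
  apply: contra t0 => /eqP/(congr1 (@uncons_vec R p)); rewrite cons_vecK.
  rewrite /uncons_vec => -[_ ->]; apply/eqP/colP => i; by rewrite !mxE.
- have -> : Q = block_mx 1%:M 0 (a^-1 *: r^T) 1%:M *m block_mx (a%:M : 'M[R]_1) r 0 S.
    have e1 : (a^-1 *: r^T) *m (a%:M : 'M[R]_1) = r^T.
      by rewrite mul_mx_scalar scalerA divff ?gt_eqF// scale1r.
    have e2 : (a^-1 *: r^T) *m r + S = D by rewrite /S -scalemxAl addrC subrK.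
    by rewrite mulmx_block !mul1mx !mul0mx !addr0 e1 e2.
  rewrite det_mulmx (det_lblock (1%:M : 'M[R]_1)) !det1 !mul1r.
  by rewrite (det_ublock (a%:M : 'M[R]_1)) det_scalar1.
Qed.

Lemma measurable_qf d (T : measurableType d) p (Q : T -> 'M[R]_p)
    (f : T -> 'cV[R]_p) : measurable_mx Q -> measurable_mx f ->
  measurable_fun setT (fun x => qf (Q x) (f x)).
Proof.
move=> mQ mf; apply: measurable_mxM => //.
by apply: measurable_mxM => //; exact: measurable_mxT.
Qed.

Lemma measurable_gauss p (Q : 'M[R]_p) (m : 'cV[R]_p) :
  measurable_fun setT (fun v : 'cV[R]_p => expR (- (1 / 2) * qf Q (v - m))).
Proof.
apply: measurableT_comp => //; apply: measurable_funM => //.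
apply: measurable_qf; first exact: measurable_mx_cst.
apply: measurable_mxB; last exact: measurable_mx_cst.
by move=> i j; exact: measurable_entry.
Qed.

(** Induction on the dimension: by [symposdef_Schur] the first coordinate
    integrates to a one-dimensional Gaussian integral. *)
Lemma gauss_integral p (Q : 'M[R]_p) (m : 'cV[R]_p) : symposdef Q ->
  0 < \det Q /\
  (\int[lebesgue_vec p]_v (expR (- (1 / 2) * qf Q (v - m)))%:E =
   (Num.sqrt ((2 * pi) ^+ p / \det Q))%:E)%E.
Proof.
have p0 : 0 < 2 * pi :> R by rewrite mulr_gt0// pi_gt0.
elim: p Q m => [|p IH] Q m Qpos.
  rewrite det_mx00; split=> //.
  have -> : (\int[lebesgue_vec 0]_v (expR (- (1 / 2) * qf Q (v - m)))%:E =
      \int[\d_(0%R : 'cV[R]_0)]_v (expR (- (1 / 2) * qf Q (v - m)))%:E)%E by [].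
  rewrite integral_dirac//; last by apply/measurable_EFinP; exact: measurable_gauss.
  rewrite diracT mul1e expr0 divr1 sqrtr1; congr EFin.
  by rewrite mxE big_ord0 mulr0 expR0.
have [a [r [S [a0 Spos detQ qfE]]]] := symposdef_Schur Qpos.
pose m1 := m ord0 0; pose m2 : 'cV[R]_p := \col_j m (lift ord0 j) 0.
have [detS intS] := IH S m2 Spos.
split; first by rewrite detQ mulr_gt0.
have mE x u : cons_vec (x, u) - m = cons_vec (x - m1, u - m2) :> 'cV[R]_p.+1.
  apply/colP => i; rewrite !mxE; case: (unliftP ord0 i) => [j|] ->.
    by rewrite /= !mxE.
  by rewrite /m1.
rewrite ge0_integral_lebesgue_vecS; last 2 first.
- by apply/measurable_EFinP; exact: measurable_gauss.
- by move=> v; rewrite lee_fin expR_ge0.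
pose k := Num.sqrt (2 * pi / a).
transitivity (\int[lebesgue_vec p]_u
    (k%:E * (expR (- (1 / 2) * qf S (u - m2)))%:E))%E.
  apply: eq_integral => u _.
  pose c := m1 - (r *m (u - m2)) 0 0 / a.
  rewrite -(gauss1_integral c a0) muleC -ge0_integralZl_EFin ?expR_ge0//; last first.
    apply/measurable_EFinP; apply: measurableT_comp => //.
    apply: measurable_funM => //; apply: measurable_funM => //.
    by apply: measurable_funX; exact: measurable_funB.
  apply: eq_integral => x _; rewrite mE qfE -EFinM -expRD; congr (expR _)%:E.
  by rewrite -mulrDr addrC /c; congr (_ * (_ + a * _ ^+ 2)); ring.
rewrite ge0_integralZl_EFin ?sqrtr_ge0//; last first.
  by apply/measurable_EFinP; exact: measurable_gauss.
rewrite intS -EFinM /k -sqrtrM ?divr_ge0 ?ltW//; congr (Num.sqrt _)%:E.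
by rewrite detQ exprS; field; rewrite !gt_eqF.
Qed.

End gaussian_integral.

Section gaussian_vectors.
Context {R : realType}.
Implicit Types p : nat.

Local Notation qf Q w := ((w^T *m Q *m w) 0 0).

Lemma symposdef_unit p (Q : 'M[R]_p) : symposdef Q -> Q \in unitmx.
Proof.
by move=> /(gauss_integral 0)[d0 _]; rewrite unitmxE unitfE gt_eqF.
Qed.

Lemma symposdef_invmx p (Q : 'M[R]_p) : symposdef Q -> symposdef (invmx Q).
Proof.
move=> Qpos; have uQ := symposdef_unit Qpos; have [QT Qp] := Qpos.
have iT : (invmx Q)^T = invmx Q by rewrite trmx_inv QT.
split=> // v v0; have := Qp (invmx Q *m v).
rewrite trmx_mul iT mulmxA mulmxKV//; apply.
by apply: contra v0 => /eqP/(congr1 (mulmx Q)); rewrite mulmx0 mulKVmx// => ->.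
Qed.

Lemma normal_vec_pdf_precision p (Q : 'M[R]_p) m v : symposdef Q ->
  normal_vec_pdf m (invmx Q) v =
  (Num.sqrt ((2 * pi) ^+ p / \det Q))^-1 * expR (- (1 / 2) * qf Q (v - m)).
Proof. by move=> Qpos; rewrite /normal_vec_pdf det_inv invmxK. Qed.

Lemma normal_vec_pdf_ge0 p m (S : 'M[R]_p) v : 0 <= normal_vec_pdf m S v.
Proof. by rewrite mulr_ge0 ?expR_ge0// invr_ge0 sqrtr_ge0. Qed.

Lemma measurable_normal_vec_pdf d (T : measurableType d) p
    (m : T -> 'cV[R]_p) (S : T -> 'M[R]_p) (v : T -> 'cV[R]_p) :
  measurable_mx m -> measurable_mx S -> measurable_mx v ->
  measurable_fun setT (fun x => normal_vec_pdf (m x) (S x) (v x)).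
Proof.
move=> mm mS mv; apply: measurable_funM.
  apply: (measurableT_comp (@measurable_inv R)).
  apply: (measurableT_comp (continuous_measurable_fun (@sqrt_continuous R))).
  by apply: measurable_funM => //; exact: measurable_det.
apply: measurableT_comp => //; apply: measurable_funM => //.
by apply: measurable_qf; [exact: measurable_invmx|exact: measurable_mxB].
Qed.

Lemma qf_shift p (Q : 'M[R]_p) (v m : 'cV[R]_p) : Q^T = Q ->
  qf Q (v - m) = qf Q v - 2 * (v^T *m (Q *m m)) 0 0 + qf Q (0 - m).
Proof.
move=> Qsym; have e : m^T *m Q *m v = v^T *m Q *m m.
  apply/matrixP => i j; rewrite !ord1.
  have -> : (m^T *m Q *m v) 0 0 = (m^T *m Q *m v)^T 0 0 by rewrite [RHS]mxE.
  by rewrite !trmx_mul trmxK Qsym mulmxA.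
rewrite sub0r (raddfB (@trmx R p 1)) (raddfN (@trmx R p 1)) /= mulmxBr !mulmxBl.
rewrite !mulmxN !mulNmx opprK !mulmxA e.
move: (v^T *m Q *m v) (v^T *m Q *m m) (m^T *m Q *m m) => a b c.
by rewrite !mxE; ring.
Qed.

Lemma normal_vec_mgf p (m s : 'cV[R]_p) (S : 'M[R]_p) : symposdef S ->
  (\int[lebesgue_vec p]_v (normal_vec_pdf m S v * expR ((s^T *m v) 0 0))%:E =
   (expR ((s^T *m m) 0 0 + qf S s / 2))%:E)%E.
Proof.
move=> Spos; have uS := symposdef_unit Spos.
have Qpos := symposdef_invmx Spos; set Q := invmx S in Qpos.
have SE : S = invmx Q by rewrite invmxK.
have [ST _] := Spos; have [QT _] := Qpos.
have [detQ intQ] := gauss_integral (m + S *m s) Qpos.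
have p0 : 0 < 2 * pi :> R by rewrite mulr_gt0// pi_gt0.
pose k := Num.sqrt ((2 * pi) ^+ p / \det Q).
have k0 : 0 < k by rewrite sqrtr_gt0 divr_gt0// exprn_gt0.
pose c := expR ((s^T *m m) 0 0 + qf S s / 2).
transitivity (\int[lebesgue_vec p]_v ((c / k)%:E *
    (expR (- (1 / 2) * qf Q (v - (m + S *m s))))%:E))%E.
  apply: eq_integral => v _; rewrite {1}SE normal_vec_pdf_precision//.
  rewrite -/k -EFinM; congr EFin.
  have sh : qf Q (v - (m + S *m s)) =
      qf Q (v - m) - 2 * (s^T *m (v - m)) 0 0 + qf S s.
    have wT (w : 'cV[R]_p) : (s^T *m w) 0 0 = (w^T *m s) 0 0.
      by rewrite -[in LHS](trmxK w) -trmx_mul mxE.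
    have QSs : Q *m (S *m s) = s by exact: mulKmx.
    have sSQ : s^T *m S *m Q = s^T by exact: mulmxK.
    rewrite opprD addrA (qf_shift (v - m) (S *m s) QT) QSs -wT; congr (_ + _).
    rewrite sub0r (raddfN (@trmx R p 1)) /= mulNmx mulmxN mulNmx opprK trmx_mul ST.
    by rewrite sSQ mulmxA.
  rewrite sh /c.
  have -> : (s^T *m (v - m)) 0 0 = (s^T *m v) 0 0 - (s^T *m m) 0 0.
    by rewrite mulmxBr !mxE.
  move: (qf Q (v - m)) (qf S s) ((s^T *m v) 0 0) ((s^T *m m) 0 0) => a b x y.
  have E : expR (- (1 / 2) * a) * expR x =
      expR (y + b / 2) * expR (- (1 / 2) * (a - 2 * (x - y) + b)).
    by rewrite -!expRD; congr expR; field.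
  by rewrite -mulrA E; ring.
rewrite ge0_integralZl_EFin//.
- by rewrite intQ -EFinM -/k divfK// gt_eqF.
- by apply/measurable_EFinP; exact: measurable_gauss.
- by rewrite divr_ge0 ?expR_ge0// ltW.
Qed.

Lemma normal_vec_total p (m : 'cV[R]_p) (S : 'M[R]_p) : symposdef S ->
  (\int[lebesgue_vec p]_v (normal_vec_pdf m S v)%:E = 1)%E.
Proof.
move=> Spos; have := normal_vec_mgf m 0 Spos.
rewrite trmx0 !mul0mx !mxE mul0r addr0 expR0 => <-.
by apply: eq_integral => v _; rewrite mul0mx mxE expR0 mulr1.
Qed.

Lemma measurable_normal_vec_pdfr p (m : 'cV[R]_p) (S : 'M[R]_p) :
  measurable_fun setT (normal_vec_pdf m S).
Proof.
apply: measurable_normal_vec_pdf; do ?[exact: measurable_mx_cst].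
by move=> i j; exact: measurable_entry.
Qed.

(** Both moments are read off the Laplace transform: from
    2 + (t x)^2 <= exp (t x) + exp (- t x), the second moment E satisfies
    2 + t^2 E <= 2 exp (t^2 A / 2) with A = m_i^2 + S_ii, and t tends to 0. *)
Lemma normal_vec_second_moment p (m : 'cV[R]_p) (S : 'M[R]_p) i : symposdef S ->
  (\int[lebesgue_vec p]_v (normal_vec_pdf m S v * v i 0 ^+ 2)%:E <=
   (m i 0 ^+ 2 + S i i)%:E)%E.
Proof.
move=> Spos; set A := m i 0 ^+ 2 + S i i; set E := (\int[_]_v _)%E.
have S0 : 0 <= S i i.
  have [_ Sp] := Spos; have := Sp (delta_mx i 0).
  rewrite trmx_delta -rowE -colE !mxE.
  have -> : (delta_mx i 0 : 'cV[R]_p) != 0.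
    by apply/eqP => /colP/(_ i); rewrite !mxE !eqxx => /eqP; rewrite oner_eq0.
  by move=> /(_ isT)/ltW.
have A0 : 0 <= A by rewrite addr_ge0// sqr_ge0.
have E0 : (0 <= E)%E.
  by apply: integral_ge0 => v _; rewrite lee_fin mulr_ge0 ?sqr_ge0 ?normal_vec_pdf_ge0.
have mpdf := measurable_normal_vec_pdfr m S.
have me : measurable_fun setT (fun v : 'cV[R]_p => v i 0) by exact: measurable_entry.
have Eu u : 0 < u -> (E <= (A * expR (u * A / 2))%:E)%E.
  move=> u0; pose t := Num.sqrt u.
  have t2 : t ^+ 2 = u by rewrite sqr_sqrtr// ltW.
  pose s (c : R) : 'cV[R]_p := c *: delta_mx i 0.
  have sT c : (s c)^T = c *: delta_mx 0 i by rewrite [LHS]linearZ /= trmx_delta.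
  have sv c v : ((s c)^T *m v) 0 0 = c * v i 0.
    by rewrite sT -scalemxAl -rowE !mxE.
  have sS c : qf S (s c) = c ^+ 2 * S i i.
    by rewrite sT -!scalemxAl -rowE -scalemxAr -colE !mxE mulrA.
  have step : (2%:E + u%:E * E <= (2 * expR (u * A / 2))%:E)%E.
    rewrite -[2%:E]mule1 -(normal_vec_total m Spos).
    rewrite -!ge0_integralZl_EFin ?(ltW u0)//; last 4 first.
    - by move=> v _; rewrite lee_fin mulr_ge0 ?sqr_ge0 ?normal_vec_pdf_ge0.
    - by apply/measurable_EFinP; apply: measurable_funM => //; exact: measurable_funX.
    - by move=> v _; rewrite lee_fin normal_vec_pdf_ge0.
    - exact/measurable_EFinP.
    have mt (c : R) : measurable_fun setT
        (fun v : 'cV[R]_p => (normal_vec_pdf m S v * expR (c * v i 0))%:E).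
      apply/measurable_EFinP; apply: measurable_funM => //.
      by apply: measurableT_comp => //; exact: measurable_funM.
    have mt0 (c : R) v : (0 <= (normal_vec_pdf m S v * expR (c * v i 0))%:E)%E.
      by rewrite lee_fin mulr_ge0 ?expR_ge0 ?normal_vec_pdf_ge0.
    rewrite -ge0_integralD//; last 4 first.
    - by move=> v _; rewrite -EFinM lee_fin mulr_ge0 ?normal_vec_pdf_ge0.
    - by apply: measurable_funeM; exact/measurable_EFinP.
    - move=> v _; rewrite -EFinM lee_fin mulr_ge0 ?(ltW u0)//.
      by rewrite mulr_ge0 ?sqr_ge0 ?normal_vec_pdf_ge0.
    - apply: measurable_funeM; apply/measurable_EFinP.
      by apply: measurable_funM => //; exact: measurable_funX.
    apply: (@le_trans _ _ (\int[lebesgue_vec p]_v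
      ((normal_vec_pdf m S v * expR (t * v i 0))%:E +
       (normal_vec_pdf m S v * expR (- t * v i 0))%:E))%E).
      apply: ge0_le_integral => //.
      - move=> v _; rewrite -!EFinM -EFinD lee_fin addr_ge0//.
          by rewrite mulr_ge0 ?normal_vec_pdf_ge0.
        rewrite mulr_ge0 ?(ltW u0)//.
        by rewrite mulr_ge0 ?sqr_ge0 ?normal_vec_pdf_ge0.
      - apply: emeasurable_funD; apply: measurable_funeM; apply/measurable_EFinP => //.
        by apply: measurable_funM => //; exact: measurable_funX.
      - exact: emeasurable_funD.
      - move=> v _; rewrite -!EFinM -!EFinD lee_fin mulNr.
        rewrite (_ : _ + _ = normal_vec_pdf m S v * (2 + (t * v i 0) ^+ 2)); last first.
          by rewrite exprMn t2; ring.
        by rewrite -mulrDr ler_wpM2l ?normal_vec_pdf_ge0 ?sqr_le_expRDN.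
    rewrite ge0_integralD//.
    have mgf c : (\int[lebesgue_vec p]_v (normal_vec_pdf m S v * expR (c * v i 0))%:E =
        (expR (c * m i 0 + c ^+ 2 * S i i / 2))%:E)%E.
      rewrite -sv -sS -(normal_vec_mgf m (s c) Spos).
      by apply: eq_integral => v _; rewrite sv.
    rewrite !mgf -EFinD lee_fin sqrrN t2 mulNr !expRD -mulrDl.
    apply: (@le_trans _ _ (2 * expR ((t * m i 0) ^+ 2 / 2) * expR (u * S i i / 2))).
      by rewrite ler_wpM2r ?expR_ge0 ?expRDN_le.
    rewrite -mulrA -expRD exprMn t2 /A.
    by rewrite (_ : _ + _ = u * (m i 0 ^+ 2 + S i i) / 2)//; ring.
  have [e Ee e0] : exists2 e, E = e%:E & 0 <= e.
    move: E0 step; case: E => [e e0 _|_|//].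
      by exists e.
    by rewrite gt0_muley ?lte_fin// addey.
  move: step; rewrite Ee -EFinM -EFinD !lee_fin -lerBrDl => step.
  rewrite -(ler_pM2l u0) (le_trans step)//.
  rewrite (_ : _ - 2 = 2 * (expR (u * A / 2) - 1)); last by ring.
  rewrite (_ : u * (A * _) = 2 * (u * A / 2 * expR (u * A / 2))); last by field.
  rewrite ler_pM2l//; move: (u * A / 2) => x.
  have h : expR x * (1 - x) <= 1.
    apply: (@le_trans _ _ (expR x * expR (- x))).
      by rewrite ler_wpM2l ?expR_ge0 ?expR_ge1Dx.
    by rewrite -expRD subrr expR0.
  by move: h; rewrite mulrBr mulr1 lerBlDr -lerBlDl mulrC.
have cA : (A * expR (n.+1%:R^-1 * A / 2))%:E @[n --> \oo] --> A%:E.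
  apply: cvg_EFin; first exact: nearW.
  rewrite -[X in _ --> X]mulr1; apply: cvgM; first exact: cvg_cst.
  have h : n.+1%:R^-1 * A / 2 @[n --> \oo] --> (0 : R).
    rewrite -[X in _ --> X](mul0r (A / 2)); under eq_fun do rewrite -mulrA.
    by apply: cvgM; [exact: cvg_harmonic|exact: cvg_cst].
  by have := cvg_at_comp h (@continuous_expR R 0); rewrite expR0.
rewrite -(cvg_lim _ cA)//; apply: lime_ge; first by apply/cvg_ex; exists A%:E.
by apply: nearW => n; apply: Eu; rewrite invr_gt0.
Qed.

End gaussian_vectors.

(** * Euclidean norm, quadratic forms and the conditional Gaussian law *)

Section quadratic_forms.
Context {R : realType}.
Implicit Types p n : nat.

Local Notation qf Q w := ((w^T *m Q *m w) 0 0).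

Lemma dotC p (u v : 'cV[R]_p) : (u^T *m v) 0 0 = (v^T *m u) 0 0.
Proof. by rewrite -[in LHS](trmxK v) -trmx_mul mxE. Qed.

Lemma dotE p (u v : 'cV[R]_p) : (u^T *m v) 0 0 = \sum_i u i 0 * v i 0.
Proof. by rewrite mxE; apply: eq_bigr => i _; rewrite mxE. Qed.

Lemma l2norm_ge0 p (v : 'cV[R]_p) : 0 <= l2norm v.
Proof. exact: sqrtr_ge0. Qed.

Lemma l2norm_sqr p (v : 'cV[R]_p) : l2norm v ^+ 2 = \sum_i v i 0 ^+ 2.
Proof. by rewrite sqr_sqrtr// sumr_ge0// => i _; exact: sqr_ge0. Qed.

Lemma l2norm_dot p (v : 'cV[R]_p) : l2norm v ^+ 2 = (v^T *m v) 0 0.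
Proof. by rewrite l2norm_sqr dotE; apply: eq_bigr => i _; rewrite expr2. Qed.

(** If v is isotropic for M, the linear term of s |-> qf M (u + s v) must
    vanish, otherwise this affine function would take negative values. *)
Lemma psd_cauchy_schwarz p (M : 'M[R]_p) (u v : 'cV[R]_p) : M^T = M ->
  (forall w : 'cV[R]_p, 0 <= qf M w) ->
  ((u^T *m M *m v) 0 0) ^+ 2 <= qf M u * qf M v.
Proof.
move=> MT Mp; set a := qf M u; set b := (u^T *m M *m v) 0 0; set c := qf M v.
have bT : (v^T *m M *m u) 0 0 = b.
  by rewrite /b -mulmxA dotC trmx_mul MT.
have qfE (s t : R) :
    qf M (s *: u + t *: v) = s ^+ 2 * a + 2 * s * t * b + t ^+ 2 * c.
  have -> : (s *: u + t *: v)^T = s *: u^T + t *: v^T.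
    by apply/rowP => i; rewrite !mxE.
  rewrite !(mulmxDl, mulmxDr) -!scalemxAl -!scalemxAr.
  have D0 (A B : 'M[R]_1) : (A + B) 0 0 = A 0 0 + B 0 0 by rewrite mxE.
  have Z0 x (A : 'M[R]_1) : (x *: A) 0 0 = x * A 0 0 by rewrite mxE.
  by rewrite !(D0, Z0) -/a -/b bT -/c; ring.
have c0 : 0 <= c by exact: Mp.
have [c_gt0|c_le0] := ltP 0 c.
  have := Mp (c *: u + (- b) *: v); rewrite qfE.
  rewrite (_ : _ + _ + _ = c * (a * c - b ^+ 2)); last by ring.
  by rewrite pmulr_rge0// subr_ge0.
have cE : c = 0 by apply/eqP; rewrite eq_le c_le0.
rewrite cE mulr0; have [->|b0] := eqVneq b 0; first by rewrite expr0n.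
have := Mp (1 *: u + (- ((a + 1) / (2 * b))) *: v); rewrite qfE cE mulr0 addr0.
rewrite (_ : _ + _ = -1); first by rewrite ler0N1.
by field.
Qed.

Lemma l2norm_cauchy_schwarz p (u v : 'cV[R]_p) :
  `|(u^T *m v) 0 0| <= l2norm u * l2norm v.
Proof.
have := @psd_cauchy_schwarz p 1%:M u v (trmx1 _ _).
rewrite !mulmx1 -!l2norm_dot => H.
have {}H : ((u^T *m v) 0 0) ^+ 2 <= l2norm u ^+ 2 * l2norm v ^+ 2.
  by apply: H => w; rewrite mulmx1 -l2norm_dot sqr_ge0.
rewrite -(ler_pXn2r (ltn0Sn 1)) ?nnegrE ?mulr_ge0 ?l2norm_ge0//.
by rewrite exprMn -normrX ger0_norm ?sqr_ge0.
Qed.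

Lemma l2normZ p (c : R) (v : 'cV[R]_p) : l2norm (c *: v) = `|c| * l2norm v.
Proof.
rewrite /l2norm -sqrtr_sqr -sqrtrM ?sqr_ge0// mulr_sumr; congr Num.sqrt.
by apply: eq_bigr => i _; rewrite mxE exprMn.
Qed.

Lemma l2norm_eq0 p (v : 'cV[R]_p) : (l2norm v == 0) = (v == 0).
Proof.
apply/idP/eqP => [|->]; last first.
  by rewrite /l2norm big1 ?sqrtr0// => i _; rewrite mxE expr0n.
rewrite sqrtr_eq0 => h; apply/colP => i; rewrite mxE; apply/eqP.
rewrite -sqrf_eq0 eq_le sqr_ge0 andbT (le_trans _ h)//.
by rewrite (bigD1 i)//= lerDl sumr_ge0// => j _; exact: sqr_ge0.
Qed.

Lemma l2norm0 p : l2norm (0 : 'cV[R]_p) = 0.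
Proof. by apply/eqP; rewrite l2norm_eq0. Qed.

Lemma l2norm_mul_bounded m n (A : 'M[R]_(m, n)) : exists2 M, 0 <= M &
  forall v : 'cV[R]_n, l2norm (A *m v) <= M * l2norm v.
Proof.
pose M := Num.sqrt (\sum_i l2norm (row i A)^T ^+ 2).
exists M => [|v]; first exact: sqrtr_ge0.
have M2 : M ^+ 2 = \sum_i l2norm (row i A)^T ^+ 2.
  by rewrite sqr_sqrtr// sumr_ge0// => i _; exact: sqr_ge0.
rewrite -(ler_pXn2r (ltn0Sn 1)) ?nnegrE ?mulr_ge0 ?l2norm_ge0 ?sqrtr_ge0//.
rewrite exprMn M2 l2norm_sqr mulr_suml; apply: ler_sum => i _.
have -> : (A *m v) i 0 = (((row i A)^T)^T *m v) 0 0.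
  by rewrite trmxK -row_mul [RHS]mxE.
have := @psd_cauchy_schwarz n 1%:M (row i A)^T v (trmx1 _ _).
rewrite !mulmx1 -!l2norm_dot; apply => w.
by rewrite mulmx1 -l2norm_dot sqr_ge0.
Qed.

Lemma l2norm_mul_le m n (A : 'M[R]_(m, n)) (v : 'cV[R]_n) :
  l2norm (A *m v) <= opnorm A * l2norm v.
Proof.
have [->|v0] := eqVneq v 0.
  by rewrite mulmx0 !l2norm0 mulr0.
have n0 : 0 < l2norm v by rewrite lt_neqAle eq_sym l2norm_eq0 v0 l2norm_ge0.
rewrite -ler_pdivrMr//; apply: ub_le_sup.
  have [M M0 AM] := l2norm_mul_bounded A; exists M => _ [w /= w1 <-].
  by rewrite (le_trans (AM w))// ler_piMr.
exists ((l2norm v)^-1 *: v).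
  by rewrite /= l2normZ ger0_norm ?invr_ge0 ?l2norm_ge0// mulVf// gt_eqF.
by rewrite -scalemxAr l2normZ ger0_norm ?invr_ge0 ?l2norm_ge0// mulrC.
Qed.

Lemma opnorm_ge0 m n (A : 'M[R]_(m, n)) : 0 <= opnorm A.
Proof.
apply: (@le_trans _ _ (l2norm (A *m 0))); first exact: l2norm_ge0.
apply: ub_le_sup; last by exists 0 => //=; rewrite l2norm0.
have [M M0 AM] := l2norm_mul_bounded A; exists M => _ [w /= w1 <-].
by rewrite (le_trans (AM w))// ler_piMr.
Qed.

(** With u = M b, Cauchy-Schwarz for the form M gives
    |u|^4 = (u^T M b)^2 <= (u^T M u) (b^T M b), and each factor is controlled
    by N.  This avoids comparing the eigenvalues of M and N. *)
Lemma l2norm_mul_psd_le p (M N : 'M[R]_p) (b : 'cV[R]_p) : M^T = M ->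
  (forall w : 'cV[R]_p, 0 <= qf M w) ->
  (forall w : 'cV[R]_p, qf M w <= qf N w) ->
  l2norm (M *m b) <= opnorm N * l2norm b.
Proof.
move=> MT Mp MN; set u := M *m b.
have qN (w : 'cV[R]_p) : qf M w <= opnorm N * l2norm w ^+ 2.
  rewrite (le_trans (MN w))// -mulmxA (le_trans (ler_norm _))//.
  rewrite (le_trans (l2norm_cauchy_schwarz _ _))//.
  by rewrite mulrC expr2 mulrA ler_wpM2r ?l2norm_ge0 ?l2norm_mul_le.
have N0 := opnorm_ge0 N.
have h : (l2norm u ^+ 2) ^+ 2 <= (opnorm N * l2norm u * l2norm b) ^+ 2.
  rewrite [in leLHS]l2norm_dot {2}/u mulmxA (le_trans (psd_cauchy_schwarz _ _ MT Mp))//.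
  rewrite (_ : (_ * _ * _) ^+ 2 =
    (opnorm N * l2norm u ^+ 2) * (opnorm N * l2norm b ^+ 2)); last by ring.
  by rewrite ler_pM.
have [u0|u0] := eqVneq (l2norm u) 0.
  by rewrite u0 mulr_ge0 ?l2norm_ge0.
have up : 0 < l2norm u by rewrite lt_neqAle eq_sym u0 l2norm_ge0.
move: h; rewrite ler_pXn2r ?nnegrE ?mulr_ge0 ?sqr_ge0 ?l2norm_ge0//.
by rewrite mulrAC expr2 ler_pM2r.
Qed.

Lemma symposdef_ge0 p (Q : 'M[R]_p) : symposdef Q ->
  forall w : 'cV[R]_p, 0 <= qf Q w.
Proof.
move=> [_ Qp] w; have [->|w0] := eqVneq w 0; first by rewrite mulmx0 mxE.
exact/ltW/Qp.
Qed.

(** With w = A^-1 u, expand the inequality 0 <= qf B (w - B^-1 u) and use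
    qf B w <= qf A w. *)
Lemma invmx_loewner p (A B : 'M[R]_p) : symposdef A -> symposdef B ->
  (forall w : 'cV[R]_p, qf B w <= qf A w) ->
  forall u : 'cV[R]_p, qf (invmx A) u <= qf (invmx B) u.
Proof.
move=> Ap Bp BA u; have uA := symposdef_unit Ap; have uB := symposdef_unit Bp.
have [BT _] := Bp; have [AT _] := Ap.
pose w := invmx A *m u.
have wAw : qf A w = qf (invmx A) u.
  by rewrite /w trmx_mul trmx_inv AT mulmxKV// mulmxA.
have wu : (w^T *m u) 0 0 = qf (invmx A) u.
  by rewrite /w trmx_mul trmx_inv AT.
clearbody w.
have := symposdef_ge0 Bp (w - invmx B *m u).
have -> : (w - invmx B *m u)^T = w^T - u^T *m invmx B.
  by rewrite [LHS]linearB /= (trmx_mul (invmx B)) trmx_inv BT.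
rewrite !(mulmxBl, mulmxBr) !mulmxA !mulmxKV// !mulmxK//.
have B0 (A' B' : 'M[R]_1) : (A' - B') 0 0 = A' 0 0 - B' 0 0 by rewrite !mxE.
rewrite !B0 (dotC u w) wu => h.
have := BA w; rewrite wAw => h2.
by lra.
Qed.

End quadratic_forms.

Section conditional_gaussian.
Context {R : realType}.
Variables (n p : nat) (X : 'M[R]_(n, p)) (z : 'cV[R]_n)
  (m0 : 'cV[R]_p) (S0 : 'M[R]_p).
Hypothesis S0_posdef : symposdef S0.

Local Notation qf Q w := ((w^T *m Q *m w) 0 0).

Definition post_prec (omega : 'I_n -> R) : 'M[R]_p :=
  X^T *m diag_mx (\row_i omega i) *m X + invmx S0.

Definition drift_const : R :=
  opnorm S0 ^+ 2 * l2norm (X^T *m z + invmx S0 *m m0) ^+ 2 + \tr S0.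

Lemma qf_post_prec (omega : 'I_n -> R) (w : 'cV[R]_p) :
  qf (post_prec omega) w = \sum_i omega i * (X *m w) i 0 ^+ 2 + qf (invmx S0) w.
Proof.
rewrite /post_prec mulmxDr mulmxDl mxE; congr (_ + _).
have -> : w^T *m (X^T *m diag_mx (\row_i omega i) *m X) *m w =
    (X *m w)^T *m (diag_mx (\row_i omega i) *m (X *m w)).
  by rewrite trmx_mul !mulmxA.
rewrite dotE; apply: eq_bigr => i _.
by rewrite mul_diag_mx; move: (X *m w) => v; rewrite !mxE mulrCA expr2.
Qed.

Section nonnegative_weights.
Variable omega : 'I_n -> R.
Hypothesis omega_ge0 : forall i, 0 <= omega i.

Lemma post_prec_posdef : symposdef (post_prec omega).
Proof.
have Sp := symposdef_invmx S0_posdef; have [ST Spos] := Sp; split.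
  rewrite /post_prec [LHS]linearD /= ST !trmx_mul trmxK tr_diag_mx.
  by rewrite mulmxA.
move=> v v0; rewrite qf_post_prec ltr_wpDl ?Spos// sumr_ge0// => i _.
by rewrite mulr_ge0 ?sqr_ge0.
Qed.

Lemma post_cov_posdef : symposdef (post_cov X S0 omega).
Proof. exact/symposdef_invmx/post_prec_posdef. Qed.

Lemma qf_post_cov_le (u : 'cV[R]_p) : qf (post_cov X S0 omega) u <= qf S0 u.
Proof.
have Sp := symposdef_invmx S0_posdef.
have := invmx_loewner post_prec_posdef Sp; rewrite invmxK; apply => w.
rewrite qf_post_prec lerDr sumr_ge0// => i _.
by rewrite mulr_ge0 ?sqr_ge0.
Qed.

(** The mean is Sigma_omega b with Sigma_omega <= Sigma_0, whence the bound
    |Sigma_0|^2 |b|^2 on its square by [l2norm_mul_psd_le]; the trace is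
    monotone. *)
Lemma post_second_moment :
  (\int[lebesgue_vec p]_v (normal_vec_pdf (post_mean X z m0 S0 omega)
     (post_cov X S0 omega) v * l2norm v ^+ 2)%:E <= drift_const%:E)%E.
Proof.
set m := post_mean _ _ _ _ _; set S := post_cov _ _ _.
have Sp : symposdef S := post_cov_posdef.
have mpdf := measurable_normal_vec_pdfr m S.
have -> : (\int[lebesgue_vec p]_v (normal_vec_pdf m S v * l2norm v ^+ 2)%:E =
    \int[lebesgue_vec p]_v \sum_(i < p) (normal_vec_pdf m S v * v i 0 ^+ 2)%:E)%E.
  by apply: eq_integral => v _; rewrite l2norm_sqr mulr_sumr sumEFin.
rewrite ge0_integral_sum//; last 2 first.
- move=> i; apply/measurable_EFinP; apply: measurable_funM => //.
  by apply: measurable_funX; exact: measurable_entry.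
- by move=> i v _; rewrite lee_fin mulr_ge0 ?sqr_ge0 ?normal_vec_pdf_ge0.
apply: (@le_trans _ _ (\sum_(i < p) (m i 0 ^+ 2 + S i i)%:E)%E).
  by apply: lee_sum => i _; exact: normal_vec_second_moment.
rewrite sumEFin lee_fin big_split /= -l2norm_sqr lerD//.
  rewrite -exprMn ler_pXn2r ?nnegrE ?mulr_ge0 ?l2norm_ge0 ?opnorm_ge0//.
  apply: l2norm_mul_psd_le; first by case: Sp.
  - exact: symposdef_ge0.
  - exact: qf_post_cov_le.
apply: ler_sum => i _.
have qfe (M : 'M[R]_p) : qf M (delta_mx i 0 : 'cV[R]_p) = M i i.
  by rewrite trmx_delta -rowE -colE !mxE.
by rewrite -!qfe; exact: qf_post_cov_le.
Qed.

End nonnegative_weights.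

Lemma drift_const_ge0 : 0 <= drift_const.
Proof.
apply: addr_ge0; first by apply: mulr_ge0; exact: sqr_ge0.
apply: sumr_ge0 => i _; have := symposdef_ge0 S0_posdef (delta_mx i 0 : 'cV[R]_p).
by rewrite trmx_delta -rowE -colE !mxE.
Qed.

End conditional_gaussian.

(** * Oscillations under drift and minorization *)

Section bounded_integrals.
Context d (T : measurableType d) (R : realType).
Implicit Types (m : {measure set T -> \bar R}) (g : T -> R).

Lemma bounded_integrable m g (L U : R) : (m setT < +oo)%E ->
  measurable_fun setT g -> (forall x, L <= g x <= U) ->
  m.-integrable setT (EFin \o g).
Proof.
move=> moo mg gLU; apply: measurable_bounded_integrable => //.
exists (`|L| + `|U|); split; first exact: num_real.
move=> M LUM x _ /=; have /andP[gL gU] := gLU x.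
have h1 : - L <= `|L| by rewrite -normrN ler_norm.
have h2 := ler_norm U; have h3 := normr_ge0 L; have h4 := normr_ge0 U.
by rewrite ler_norml; apply/andP; split; lra.
Qed.

Lemma Rintegral_bounds (m : probability T R) g (L U : R) :
  measurable_fun setT g -> (forall x, L <= g x <= U) ->
  L <= \int[m]_x g x <= U.
Proof.
move=> mg gLU.
have moo : (m setT < +oo)%E by rewrite probability_setT ltry.
have cst_int (r : R) : \int[m]_x r = r.
  by rewrite Rintegral_cst//= probability_setT mulr1.
have ic (r : R) : m.-integrable setT (EFin \o cst r).
  by exact: finite_measure_integrable_cst.
have ig := bounded_integrable moo mg gLU.
rewrite -(cst_int L) -(cst_int U).
by apply/andP; split; apply: le_Rintegral => //; do ?[exact: ic|by move=> x _; case/andP: (gLU x)].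
Qed.

(** If moreover g <= Uc on C and g <= U, the integrand on the left is
    nonnegative: it is the gap between g and its upper bound that depends on
    membership in C.  Comparing this integral for two measures one of which
    dominates the other is what exploits a minorization. *)
Lemma integral_gap m g (C : set T) (L U Uc : R) : (m setT < +oo)%E ->
  measurable C -> measurable_fun setT g -> (forall x, L <= g x <= U) ->
  (\int[m]_x ((U - g x) - (U - Uc) * \1_C x)%:E)%E =
  (U * fine (m setT) - \int[m]_x g x - (U - Uc) * fine (m C))%:E.
Proof.
move=> moo mC mg gLU.
have ic (r : R) : m.-integrable setT (EFin \o cst r).
  by apply: (@bounded_integrable _ _ r r) => // x; rewrite lexx.
have ig := bounded_integrable moo mg gLU.
have mi : measurable_fun setT (\1_C : T -> R) by exact: measurable_indic.
have ii : m.-integrable setT (EFin \o (\1_C : T -> R)).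
  apply: (@bounded_integrable _ _ 0 1) => // x.
  by rewrite indicE ler0n lern1; case: (_ \in _).
have igg : m.-integrable setT (EFin \o (fun x => U - g x)).
  apply: (@bounded_integrable _ _ 0 (U - L)) => //.
    exact: measurable_funB.
  by move=> x; have /andP[h1 h2] := gLU x; rewrite subr_ge0 h2 lerB.
have iii : m.-integrable setT (EFin \o (fun x => (U - Uc) * \1_C x)).
  exact: (@integrableZl _ _ _ m _ measurableT (U - Uc) _ ii).
rewrite -[LHS]fineK; last first.
  apply: integrable_fin_num => //.
  exact: (integrableB measurableT igg iii).
congr EFin; rewrite -/(Rintegral m setT _) RintegralB// RintegralB//; last exact: ic.
rewrite RintegralZl// Rintegral_cst//; congr (_ - _ * _).
by rewrite /Rintegral integral_indic// setIT.
Qed.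

End bounded_integrals.

Section drift_and_minorization.
Context d (T : measurableType d) (R : realType).
Variables (P : R.-pker T ~> T) (C : set T) (gamma eps : R)
  (eta : {measure set T -> \bar R}).
Hypotheses (mC : measurable C) (gamma01 : 0 < gamma < 1) (eps01 : 0 < eps <= 1).
Hypothesis PC : forall x, (gamma%:E <= P x C)%E.
Hypothesis eta_total : eta setT = eps%:E.
Hypothesis P_minor : forall x, C x -> forall A, measurable A ->
  (eta A <= P x A)%E.

(** Explicit enclosing intervals, the one over C nested in the global one,
    rather than suprema and infima: the step below needs no attainment and
    works with any valid bounds. *)
Definition spread (g : T -> R) (a b : R) := exists L U Lc Uc : R,
  [/\ L <= Lc /\ Uc <= U, forall x, L <= g x <= U,
      forall x, C x -> Lc <= g x <= Uc, U - L <= a & Uc - Lc <= b].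

Lemma pker_total x : P x setT = 1%E.
Proof. exact: prob_kernel. Qed.

Let Poo x : (P x setT < +oo)%E. Proof. by rewrite pker_total ltry. Qed.

Let q x := fine (P x C).

Let P_fin x A : measurable A -> P x A \is a fin_num.
Proof.
move=> mA; rewrite ge0_fin_numE//; apply: le_lt_trans (Poo x).
by rewrite le_measure ?inE.
Qed.

Let q_bounds x : gamma <= q x <= 1.
Proof.
rewrite -!lee_fin /q fineK ?P_fin// PC/= -(pker_total x).
by rewrite le_measure ?inE.
Qed.

Let upper_all (g : T -> R) (L U Uc : R) x : measurable_fun setT g ->
  (forall y, L <= g y <= U) -> (forall y, C y -> g y <= Uc) -> Uc <= U ->
  \int[P x]_y g y <= gamma * Uc + (1 - gamma) * U.
Proof.
move=> mg gLU gC UcU; have := integral_gap Uc (Poo x) mC mg gLU.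
rewrite pker_total/= mulr1 -/(q x) => E.
have : 0 <= U - \int[P x]_y g y - (U - Uc) * q x.
  rewrite -lee_fin -E; apply: integral_ge0 => y _; rewrite lee_fin indicE.
  have [|Cy] := boolP (y \in C); rewrite ?mulr1 ?mulr0 ?subr0.
    by rewrite inE => /gC; lra.
  by rewrite subr_ge0; case/andP: (gLU y).
have /andP[q0 q1] := q_bounds x; have d0 : 0 <= U - Uc by rewrite subr_ge0.
have := ler_wpM2l d0 q0; lra.
Qed.

Let eta_oo : (eta setT < +oo)%E. Proof. by rewrite eta_total ltry. Qed.

Let e := fine (eta C).

Let e_bounds : 0 <= e <= eps.
Proof.
have eC : (eta C <= eps%:E)%E by rewrite -eta_total le_measure ?inE.
rewrite fine_ge0//= -lee_fin fineK// ge0_fin_numE//.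
by rewrite (le_lt_trans eC)// ltry.
Qed.

Let upper_C (g : T -> R) (L U Uc : R) x : measurable_fun setT g ->
  (forall y, L <= g y <= U) -> (forall y, C y -> g y <= Uc) -> Uc <= U -> C x ->
  \int[P x]_y g y - \int[eta]_y g y <= (1 - eps) * U /\
  \int[P x]_y g y - \int[eta]_y g y <= (gamma - eps) * Uc + (1 - gamma) * U.
Proof.
move=> mg gLU gC UcU Cx.
have E := integral_gap Uc (Poo x) mC mg gLU.
have E' := integral_gap Uc eta_oo mC mg gLU.
rewrite pker_total/= mulr1 -/(q x) in E; rewrite eta_total/= -/e in E'.
have gap0 y : 0 <= (U - g y) - (U - Uc) * \1_C y.
  rewrite indicE; have [|Cy] := boolP (y \in C); rewrite ?mulr1 ?mulr0 ?subr0.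
    by rewrite inE => /gC; lra.
  by rewrite subr_ge0; case/andP: (gLU y).
have : U * eps - \int[eta]_y g y - (U - Uc) * e <=
    U - \int[P x]_y g y - (U - Uc) * q x.
  rewrite -lee_fin -E -E'; apply: ge0_le_measure_integral => //.
  - by move=> A mA; exact: P_minor.
  - apply/measurable_EFinP; apply: measurable_funB; first exact: measurable_funB.
    by apply: measurable_funM => //; exact: measurable_indic.
have d0 : 0 <= U - Uc by rewrite subr_ge0.
have /andP[q0 q1] := q_bounds x; have /andP[e0 e1] := e_bounds.
have qe : e <= q x.
  rewrite -lee_fin /e /q !fineK ?P_fin ?P_minor//.
  by rewrite ge0_fin_numE// (le_lt_trans _ eta_oo)// le_measure ?inE.
have qe' : gamma - eps <= q x - e by lra.
have := ler_wpM2l d0 qe'; have : 0 <= (U - Uc) * (q x - e).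
  by rewrite mulr_ge0// subr_ge0.
by move=> h1 h2 h3; split; lra.
Qed.

(** On C the part eta of P(x, .) contributes the same value to all averages
    and drops out of their oscillation.  The rest has mass 1 - eps, of which at
    least gamma - eps falls in C.  Lower bounds are upper bounds for - g. *)
Lemma spread_step (g : T -> R) (a b b' : R) : measurable_fun setT g ->
  spread g a b ->
  (b' = (1 - eps) * a \/ (eps <= gamma /\ b' = (gamma - eps) * b + (1 - gamma) * a)) ->
  spread (fun x => \int[P x]_y g y) (gamma * b + (1 - gamma) * a) b'.
Proof.
move=> mg [L [U [Lc [Uc [[LLc UcU] gLU gC ULa ULb]]]]] b'E.
pose h y := - g y.
have mh : measurable_fun setT h by exact: measurableT_comp.
have hLU y : - U <= h y <= - L by rewrite !lerN2 andbC.
have hC y : C y -> h y <= - Lc by move=> /gC/andP[? _]; rewrite lerN2.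
have gC' y : C y -> g y <= Uc by move=> /gC/andP[].
have LcL : - Lc <= - L by rewrite lerN2.
have hI (m : {measure set T -> \bar R}) : (m setT < +oo)%E ->
    \int[m]_y h y = - \int[m]_y g y.
  move=> moo; have -> : \int[m]_y h y = \int[m]_y (-1 * g y).
    by apply: eq_Rintegral => y _; rewrite mulN1r.
  by rewrite RintegralZl ?mulN1r//; exact: bounded_integrable moo mg gLU.
pose U' := gamma * Uc + (1 - gamma) * U.
pose L' := gamma * Lc + (1 - gamma) * L.
pose I := \int[eta]_y g y.
have bnd x : L' <= \int[P x]_y g y <= U'.
  apply/andP; split; last exact: (upper_all x mg gLU gC' UcU).
  have := upper_all x mh hLU hC LcL; rewrite hI// /L'; lra.
have [/andP[g0 g1] /andP[e0 e1]] := (gamma01, eps01).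
have base : U' - L' <= gamma * b + (1 - gamma) * a.
  have := ler_wpM2l (ltW g0) ULb.
  have g1' : 0 <= 1 - gamma by lra.
  have := ler_wpM2l g1' ULa; rewrite /U' /L'; lra.
pose Vc := if b' == (1 - eps) * a then (1 - eps) * U + I
  else (gamma - eps) * Uc + (1 - gamma) * U + I.
pose Kc := if b' == (1 - eps) * a then (1 - eps) * L + I
  else (gamma - eps) * Lc + (1 - gamma) * L + I.
exists L', U', (Num.max L' Kc), (Num.min U' Vc).
split=> //; first by rewrite le_max ge_min !lexx.
- move=> x Cx; rewrite ge_max le_min; have /andP[-> ->] := bnd x.
  have [h1 h2] := upper_C mg gLU gC' UcU Cx.
  have [h3 h4] := upper_C mh hLU hC LcL Cx.
  rewrite !hI// in h3 h4; rewrite /Vc /Kc /I.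
  by case: ifP => _; apply/andP; split; lra.
- apply: (@le_trans _ _ (Vc - Kc)).
    by apply: lerB; [rewrite ge_min lexx orbT|rewrite le_max lexx orbT].
  rewrite /Vc /Kc; case: eqVneq => [->|nb].
    have e1' : 0 <= 1 - eps by lra.
    by have := ler_wpM2l e1' ULa; lra.
  case: b'E => [bE|[eg ->]]; first by rewrite bE eqxx in nb.
  have eg' : 0 <= gamma - eps by lra.
  have g1' : 0 <= 1 - gamma by lra.
  by have := ler_wpM2l eg' ULb; have := ler_wpM2l g1' ULa; lra.
Qed.

Lemma spread_le (g : T -> R) (a b a' b' : R) : a <= a' -> b <= b' ->
  spread g a b -> spread g a' b'.
Proof.
move=> aa bb [L [U [Lc [Uc [h1 h2 h3 h4 h5]]]]]; exists L, U, Lc, Uc.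
by split=> //; lra.
Qed.

Lemma spread_diag (g : T -> R) (a b : R) : spread g a b -> spread g a a.
Proof.
move=> [L [U [Lc [Uc [h1 h2 h3 h4 h5]]]]]; exists L, U, L, U.
by split=> // x _.
Qed.

Lemma spread_unit (g : T -> R) : (forall x, 0 <= g x <= 1) -> spread g 1 1.
Proof.
by move=> g01; exists 0, 1, 0, 1; split; rewrite ?subr0//; move=> x _.
Qed.

End drift_and_minorization.

Section rates.
Context {R : realType}.
Variables gamma alpha : R.
Hypotheses (gamma01 : 0 < gamma < 1) (alpha01 : 0 < alpha <= 1).

Let m := Num.min gamma alpha.
Let M := Num.max alpha gamma.

Let m_bounds : 0 < m < 1.
Proof.
have /andP[g0 g1] := gamma01; have /andP[a0 a1] := alpha01.
by rewrite /m lt_min gt_min g0 a0 g1.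
Qed.

Let M_bounds : 0 < M <= 1.
Proof.
have /andP[g0 g1] := gamma01; have /andP[a0 a1] := alpha01.
by rewrite /M lt_max ge_max a0 a1 (ltW g1).
Qed.

Let disc2 : rate_disc gamma alpha ^+ 2 = (1 - m) ^+ 2 + 4 * m * (1 - M).
Proof.
rewrite /rate_disc sqr_sqrtr// addr_ge0 ?sqr_ge0//.
have /andP[m0 m1] := m_bounds; have /andP[M0 M1] := M_bounds.
by rewrite mulr_ge0 ?mulr_ge0 ?subr_ge0 ?(ltW m0).
Qed.

Let disc_gt0 : 0 < rate_disc gamma alpha.
Proof.
have /andP[m0 m1] := m_bounds; have /andP[M0 M1] := M_bounds.
rewrite sqrtr_gt0 ltr_pwDl ?exprn_gt0 ?subr_gt0//.
by rewrite mulr_ge0 ?mulr_ge0 ?subr_ge0 ?(ltW m0).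
Qed.

Let lambdaB_neq0 : lambda_plus gamma alpha - lambda_minus gamma alpha != 0.
Proof.
have -> : lambda_plus gamma alpha - lambda_minus gamma alpha =
    rate_disc gamma alpha by rewrite /lambda_plus /lambda_minus; field.
by rewrite gt_eqF.
Qed.

Lemma rho0 : rho 0 gamma alpha = 1.
Proof.
rewrite /rho !expr0 !mulr1 -[RHS](divff lambdaB_neq0); congr (_ / _); ring.
Qed.

Lemma rho1 : rho 1 gamma alpha = 1.
Proof.
rewrite /rho !expr1 -[RHS](divff lambdaB_neq0); congr (_ / _); ring.
Qed.

(** [lambda_plus] and [lambda_minus] are the roots of
    l^2 = (1 - m) l + m (1 - M). *)
Lemma rho_rec t : rho t.+2 gamma alpha =
  (1 - m) * rho t.+1 gamma alpha + m * (1 - M) * rho t gamma alpha.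
Proof.
have root l : l ^+ 2 = (1 - m) * l + m * (1 - M) -> forall k,
    l ^+ k.+2 = (1 - m) * l ^+ k.+1 + m * (1 - M) * l ^+ k.
  by move=> l2 k; rewrite -addn2 exprD l2 exprS; ring.
have h1 : lambda_plus gamma alpha ^+ 2 =
    (1 - m) * lambda_plus gamma alpha + m * (1 - M).
  have := disc2; rewrite /lambda_plus -/m; move: (rate_disc _ _) => D D2.
  by rewrite expr_div_n sqrrD D2; field.
have h2 : lambda_minus gamma alpha ^+ 2 =
    (1 - m) * lambda_minus gamma alpha + m * (1 - M).
  have := disc2; rewrite /lambda_minus -/m; move: (rate_disc _ _) => D D2.
  by rewrite expr_div_n sqrrB D2; field.
by rewrite /rho (root _ h1) (root _ h2); ring.
Qed.

End rates.

Section iterated_kernel.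
Context d (T : measurableType d) (R : realType).
Variables (P : R.-pker T ~> T).
Local Open Scope ereal_scope.

Lemma kernel_iter0_integral x (f : T -> \bar R) : measurable_fun setT f ->
  \int[kernel_iter P 0 x]_y f y = f x.
Proof.
by move=> mf; rewrite /= integral_dirac// diracT mul1e.
Qed.

Lemma kernel_iterS_integral t x (f : T -> \bar R) : measurable_fun setT f ->
  (forall y, 0 <= f y) ->
  \int[kernel_iter P t.+1 x]_y f y = \int[P x]_y \int[kernel_iter P t y]_u f u.
Proof.
move=> mf f0; apply: ge0_integral_mixture => //.
by move=> A mA; exact: (measurable_kernel (kernel_iter P t)).
Qed.

Lemma measurable_kernel_iter_integral t (f : T -> \bar R) :
  measurable_fun setT f -> (forall y, 0 <= f y) ->
  measurable_fun setT (fun x => \int[kernel_iter P t x]_y f y).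
Proof.
move=> mf f0; apply: measurable_fun_integral_kernel => // A mA.
exact: (measurable_kernel (kernel_iter P t)).
Qed.

Lemma measurable_pker_integral (f : T -> \bar R) :
  measurable_fun setT f -> (forall y, 0 <= f y) ->
  measurable_fun setT (fun x => \int[P x]_y f y).
Proof.
move=> mf f0; apply: measurable_fun_integral_kernel => // A mA.
exact: (measurable_kernel P).
Qed.

(** The iterates are defined by a first step followed by t others; here the
    last step is singled out. *)
Lemma kernel_iterSr_integral t x (f : T -> \bar R) : measurable_fun setT f ->
  (forall y, 0 <= f y) ->
  \int[kernel_iter P t.+1 x]_y f y = \int[kernel_iter P t x]_y \int[P y]_u f u.
Proof.
move=> mf f0; elim: t x => [|t IH] x.
  rewrite kernel_iterS_integral// kernel_iter0_integral; last exact: measurable_pker_integral.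
  by apply: eq_integral => y _; rewrite kernel_iter0_integral.
rewrite kernel_iterS_integral// [RHS]kernel_iterS_integral//.
- by apply: eq_integral => y _; exact: IH.
- exact: measurable_pker_integral.
- by move=> y; exact: integral_ge0.
Qed.

Lemma kernel_iter_total t x : kernel_iter P t x setT = 1.
Proof.
elim: t x => [|t IH] x; first by rewrite /= diracT.
rewrite -[LHS]mul1e -integral_cst// kernel_iterS_integral//.
rewrite -[RHS](pker_total P x) -[RHS]mul1e -integral_cst//.
by apply: eq_integral => y _; rewrite integral_cst// mul1e; exact: IH.
Qed.

Variable Pi : probability T R.
Hypothesis PiP : kernel_invariant P Pi.

Lemma invariant_kernel_iter t (f : T -> \bar R) : measurable_fun setT f ->
  (forall y, 0 <= f y) ->
  \int[Pi]_x \int[kernel_iter P t x]_y f y = \int[Pi]_x f x.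
Proof.
move=> mf f0.
have inv1 (g : T -> \bar R) : measurable_fun setT g -> (forall y, 0 <= g y) ->
    \int[Pi]_x g x = \int[Pi]_x \int[P x]_y g y.
  move=> mg g0; apply: ge0_integral_mixture => //.
    by move=> A mA; exact: (measurable_kernel P).
  by move=> A mA; rewrite PiP.
elim: t => [|t IH].
  by apply: eq_integral => x _; rewrite kernel_iter0_integral.
rewrite -IH [RHS]inv1.
- by apply: eq_integral => x _; rewrite kernel_iterS_integral.
- exact: measurable_kernel_iter_integral.
- by move=> y; exact: integral_ge0.
Qed.

End iterated_kernel.

(** * From oscillations to distances *)

Section convergence_rates.
Context d (T : measurableType d) (R : realType).
Variables (P : R.-pker T ~> T) (Pi : probability T R).
Hypothesis PiP : kernel_invariant P Pi.

Local Notation iter_int t f := (fun x => \int[kernel_iter P t x]_y (f y)).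

Let iter_oo t x : (kernel_iter P t x setT < +oo)%E.
Proof. by rewrite kernel_iter_total ltry. Qed.

Lemma iter_int_fin t (f : T -> R) x : measurable_fun setT f ->
  (forall y, 0 <= f y <= 1) ->
  (\int[kernel_iter P t x]_y (f y)%:E)%E = (\int[kernel_iter P t x]_y f y)%:E.
Proof.
move=> mf f01; rewrite /Rintegral fineK//; apply: integrable_fin_num => //.
exact: (bounded_integrable (iter_oo t x) mf f01).
Qed.

Lemma iter_int_bounds t (f : T -> R) x : measurable_fun setT f ->
  (forall y, 0 <= f y <= 1) -> 0 <= \int[kernel_iter P t x]_y f y <= 1.
Proof.
move=> mf f01; rewrite Rintegral_ge0 => [|y _]; last by case/andP: (f01 y).
rewrite /= -lee_fin -iter_int_fin// -(kernel_iter_total P t x) -[leRHS]mul1e.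
rewrite -integral_cst//; apply: ge0_le_integral => //.
- by move=> y _; rewrite lee_fin; case/andP: (f01 y).
- exact/measurable_EFinP.
- by move=> y _; rewrite lee_fin; case/andP: (f01 y).
Qed.

Lemma iter_intS t (f : T -> R) : measurable_fun setT f ->
  (forall y, 0 <= f y <= 1) ->
  iter_int t.+1 f = (fun x => \int[P x]_y iter_int t f y).
Proof.
move=> mf f01; apply/funext => x; rewrite /Rintegral kernel_iterS_integral.
- congr fine; apply: eq_integral => y _; rewrite iter_int_fin//.
- exact/measurable_EFinP.
- by move=> y; rewrite lee_fin; case/andP: (f01 y).
Qed.

Lemma measurable_iter_int t (f : T -> R) : measurable_fun setT f ->
  (forall y, 0 <= f y <= 1) -> measurable_fun setT (iter_int t f).
Proof.
move=> mf f01; apply: measurableT_comp => //.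
apply: measurable_kernel_iter_integral; first exact/measurable_EFinP.
by move=> y; rewrite lee_fin; case/andP: (f01 y).
Qed.

(** Averaging over the invariant law, the distance to equilibrium of the chain is
   at most the oscillation of the t-step averages. *)
Lemma spread_dist C (f : T -> R) a b t x : measurable_fun setT f ->
  (forall y, 0 <= f y <= 1) -> spread C (iter_int t f) a b ->
  `|\int[kernel_iter P t x]_y f y - \int[Pi]_y f y| <= a.
Proof.
move=> mf f01 [L [U [Lc [Uc [_ LU _ ULa _]]]]].
have -> : \int[Pi]_y f y = \int[Pi]_y iter_int t f y.
  rewrite /Rintegral -(invariant_kernel_iter PiP t).
  - by congr fine; apply: eq_integral => y _; rewrite iter_int_fin.
  - exact/measurable_EFinP.
  - by move=> y; rewrite lee_fin; case/andP: (f01 y).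
have /andP[h1 h2] := Rintegral_bounds Pi (measurable_iter_int t mf f01) LU.
have /andP[h3 h4] := LU x.
by rewrite ler_norml; apply/andP; split; lra.
Qed.

Lemma tv_dist_le t x a :
  (forall f : T -> R, measurable_fun setT f -> (forall y, 0 <= f y <= 1) ->
    `|\int[kernel_iter P t x]_y f y - \int[Pi]_y f y| <= a) ->
  (tv_dist (kernel_iter P t x) Pi <= a%:E)%E.
Proof.
move=> h; apply: ge_ereal_sup => _ [f [mf f01] <-].
rewrite iter_int_fin//.
have -> : (\int[Pi]_y (f y)%:E = (\int[Pi]_y f y)%:E)%E.
  rewrite /Rintegral fineK//; apply: integrable_fin_num => //.
  by apply: (bounded_integrable _ mf f01); rewrite /= probability_setT ltry.
by rewrite -EFinB abse_EFin lee_fin h.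
Qed.

Section weighted.
Variables (V : T -> R) (K : R).
Hypotheses (mV : measurable_fun setT V) (V0 : forall x, 0 <= V x) (K0 : 0 <= K).
Hypothesis PV : forall x, (\int[P x]_y (V y)%:E <= K%:E)%E.

Let PT x : P x setT = 1%E. Proof. exact: prob_kernel. Qed.

Let P1V x : (\int[P x]_y (1 + V y)%:E <= (1 + K)%:E)%E.
Proof.
under eq_integral do rewrite EFinD.
rewrite ge0_integralD//.
- by rewrite integral_cst// PT mule1 EFinD leeD2l.
- by move=> y _; rewrite lee_fin.
- exact/measurable_EFinP.
Qed.

Let pos_le (g : T -> \bar R) x : measurable_fun setT g ->
  (forall y, (0 <= g y <= (1 + V y)%:E)%E) ->
  (0 <= \int[P x]_y g y <= (1 + K)%:E)%E.
Proof.
move=> mg gV; rewrite integral_ge0 => [/=|y _]; last by case/andP: (gV y).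
apply: le_trans (P1V x); apply: ge0_le_integral => //.
- by move=> y _; case/andP: (gV y).
- by apply/measurable_EFinP; exact: measurable_funD.
- by move=> y _; case/andP: (gV y).
Qed.

Variables (mu mu' : {measure set T -> \bar R}).
Hypothesis mu'1 : mu' setT = 1%E.
Hypothesis mu_mix : forall F : T -> \bar R, measurable_fun setT F ->
  (forall y, (0 <= F y)%E) ->
  (\int[mu]_y F y = \int[mu']_x \int[P x]_y F y)%E.

Variable f : T -> R.
Hypotheses (mf : measurable_fun setT f) (fV : forall y, `|f y| <= 1 + V y).

Definition kernel_mean x := fine (\int[P x]_y (f y)%:E).

Let fE := EFin \o f.
Let mfE : measurable_fun setT fE. Proof. exact/measurable_EFinP. Qed.

Let funepos_bound y : (0 <= fE^\+ y <= (1 + V y)%:E)%E.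
Proof.
rewrite funepos_ge0/= funeposE /fE /= -EFin_max lee_fin ge_max.
by rewrite addr_ge0// andbT (le_trans (ler_norm _)).
Qed.

Let funeneg_bound y : (0 <= fE^\- y <= (1 + V y)%:E)%E.
Proof.
rewrite funeneg_ge0/= funenegE /fE /= -EFin_max lee_fin ge_max.
by rewrite addr_ge0// andbT (le_trans (ler_norm _))// normrN.
Qed.

Let A x := fine (\int[P x]_y fE^\+ y).
Let B x := fine (\int[P x]_y fE^\- y).

Let mA : measurable_fun setT A.
Proof.
apply: measurableT_comp => //; apply: measurable_pker_integral => //.
exact: measurable_funepos.
Qed.

Let mB : measurable_fun setT B.
Proof.
apply: measurableT_comp => //; apply: measurable_pker_integral => //.
exact: measurable_funeneg.
Qed.

Let AE x : (\int[P x]_y fE^\+ y = (A x)%:E)%E.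
Proof.
have /andP[h1 h2] := pos_le x (measurable_funepos mfE) funepos_bound.
by rewrite fineK// ge0_fin_numE// (le_lt_trans h2)// ltry.
Qed.

Let BE x : (\int[P x]_y fE^\- y = (B x)%:E)%E.
Proof.
have /andP[h1 h2] := pos_le x (measurable_funeneg mfE) funeneg_bound.
by rewrite fineK// ge0_fin_numE// (le_lt_trans h2)// ltry.
Qed.

Let A_bounds x : 0 <= A x <= 1 + K.
Proof.
by rewrite -!lee_fin -AE; exact: (pos_le x (measurable_funepos mfE) funepos_bound).
Qed.

Let B_bounds x : 0 <= B x <= 1 + K.
Proof.
by rewrite -!lee_fin -BE; exact: (pos_le x (measurable_funeneg mfE) funeneg_bound).
Qed.

Let kernel_meanE x : kernel_mean x = A x - B x.
Proof. by rewrite /kernel_mean integralE AE BE. Qed.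

Lemma kernel_mean_bounds x : - (1 + K) <= kernel_mean x <= 1 + K.
Proof.
have /andP[h1 h2] := A_bounds x; have /andP[h3 h4] := B_bounds x.
by rewrite kernel_meanE; apply/andP; split; lra.
Qed.

Lemma measurable_kernel_mean : measurable_fun setT kernel_mean.
Proof.
rewrite (_ : kernel_mean = fun x => A x - B x); first exact: measurable_funB.
by apply/funext => x; rewrite kernel_meanE.
Qed.

(** Fubini for a signed f, through its positive and negative parts; the
    weight 1 + V makes both integrable. *)
Lemma mixture_mean :
  (\int[mu]_y (f y)%:E = (\int[mu']_x kernel_mean x)%:E)%E.
Proof.
have oo : (mu' setT < +oo)%E by rewrite mu'1 ltry.
have iA := bounded_integrable oo mA A_bounds.
have iB := bounded_integrable oo mB B_bounds.
rewrite integralE !mu_mix//; last 2 first.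
- exact: measurable_funeneg.
- exact: measurable_funepos.
under eq_integral do rewrite AE.
under [X in (_ - X)%E]eq_integral do rewrite BE.
rewrite (_ : kernel_mean = fun x => A x - B x); last first.
  by apply/funext => x; rewrite kernel_meanE.
rewrite RintegralB// EFinB /Rintegral !fineK//; exact: integrable_fin_num.
Qed.

End weighted.

(** After one step from any state, f has mean h with |h| <= 1 + K, so that
    (h / (1 + K) + 1) / 2 takes values in [0, 1]. *)
Lemma weighted_dist_le (V : T -> R) (K : R) t x a :
  measurable_fun setT V -> (forall x, 0 <= V x) -> 0 <= K ->
  (forall x, \int[P x]_y (V y)%:E <= K%:E)%E ->
  (forall f : T -> R, measurable_fun setT f -> (forall y, 0 <= f y <= 1) ->
    `|\int[kernel_iter P t x]_y f y - \int[Pi]_y f y| <= a) ->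
  (weighted_dist (fun u => 1 + V u)%R (kernel_iter P t.+1 x) Pi <=
   (2 * (1 + K) * a)%:E)%E.
Proof.
move=> mV V0 K0 PV h; apply: ge_ereal_sup => _ [f [mf fV] <-].
rewrite (mixture_mean mV V0 PV (kernel_iter_total P t x) _ mf fV); last first.
  by move=> F mF F0; exact: kernel_iterSr_integral.
rewrite (mixture_mean mV V0 PV (probability_setT Pi) _ mf fV); last first.
  move=> F mF F0; rewrite -(invariant_kernel_iter PiP 1)//.
  apply: eq_integral => y _; rewrite kernel_iterS_integral//.
  by apply: eq_integral => u _; rewrite kernel_iter0_integral.
rewrite -EFinB abse_EFin lee_fin.
pose g y := (kernel_mean f y / (1 + K) + 1) / 2.
have K1 : 0 < 1 + K by rewrite ltr_pwDl.
have mk := measurable_kernel_mean mV V0 PV mf fV.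
have kb := kernel_mean_bounds mV V0 PV mf fV.
have mg : measurable_fun setT g.
  by apply: measurable_funM => //; apply: measurable_funD => //; exact: measurable_funM.
have g01 y : 0 <= g y <= 1.
  have /andP[k1 k2] := kb y.
  rewrite /g divr_ge0 ?ler_pdivrMr//=; last first.
    by rewrite -lerBlDr sub0r ler_pdivlMr// mulN1r.
  by rewrite mul1r -lerBrDr (_ : 2 - 1 = 1) ?ler_pdivrMr ?mul1r//; ring.
have gk (m : {measure set T -> \bar R}) : m setT = 1%E ->
    \int[m]_y kernel_mean f y = (1 + K) * (2 * \int[m]_y g y - 1).
  move=> m1; have moo : (m setT < +oo)%E by rewrite m1 ltry.
  have ig := bounded_integrable moo mg g01.
  have i1 : m.-integrable setT (EFin \o cst (1 + K)).
    by apply: (@bounded_integrable _ _ _ _ _ (1 + K) (1 + K)) => // y; rewrite lexx.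
  transitivity (\int[m]_y (2 * (1 + K) * g y - (1 + K))).
    apply: eq_Rintegral => y _; rewrite /g; field; rewrite gt_eqF//.
  rewrite RintegralB//; last exact: (@integrableZl _ _ _ m _ measurableT (2 * (1 + K)) _ ig).
  by rewrite RintegralZl// Rintegral_cst// m1 mulr1; ring.
rewrite (gk _ (kernel_iter_total P t x)) (gk _ (probability_setT Pi)).
rewrite (_ : _ - _ = 2 * (1 + K) *
  (\int[kernel_iter P t x]_y g y - \int[Pi]_y g y)); last by ring.
have c0 : 0 <= 2 * (1 + K) by rewrite mulr_ge0// ltW.
by rewrite normrM (ger0_norm c0); apply: ler_wpM2l => //; exact: h.
Qed.

Section rates_of_convergence.
Variables (C : set T) (gamma eps : R) (eta : {measure set T -> \bar R}).
Hypotheses (mC : measurable C) (gamma01 : 0 < gamma < 1) (eps01 : 0 < eps <= 1).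
Hypothesis PC : forall x, (gamma%:E <= P x C)%E.
Hypothesis eta_total : eta setT = eps%:E.
Hypothesis P_minor : forall x, C x -> forall A, measurable A ->
  (eta A <= P x A)%E.

(** The bound over C is the one that makes the recursion of [spread_step] for
    the global bound hold at the next step: gamma b_t + (1 - gamma) rho_t =
    rho_(t+1). *)
Lemma spread_iter (f : T -> R) t : measurable_fun setT f ->
  (forall y, 0 <= f y <= 1) ->
  spread C (iter_int t f) (rho t gamma eps)
    ((rho t.+1 gamma eps - (1 - gamma) * rho t gamma eps) / gamma).
Proof.
move=> mf f01; have /andP[g0 g1] := gamma01.
have gn0 : gamma != 0 by rewrite gt_eqF.
elim: t => [|t IH].
  rewrite rho1// rho0// mulr1 opprB addrCA subrr addr0 divff//.
  apply: spread_unit => x; exact: iter_int_bounds.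
rewrite iter_intS//.
set r := rho t gamma eps in IH *; set r1 := rho t.+1 gamma eps in IH *.
have := @spread_step _ _ _ P C gamma eps eta mC gamma01 eps01 PC eta_total P_minor
  (iter_int t f) r ((r1 - (1 - gamma) * r) / gamma)
  ((rho t.+2 gamma eps - (1 - gamma) * r1) / gamma)
  (measurable_iter_int t mf f01) IH.
have -> : gamma * ((r1 - (1 - gamma) * r) / gamma) + (1 - gamma) * r = r1 by field.
apply.
rewrite rho_rec// -/r -/r1; have [ge|eg] := leP gamma eps.
  by left; field.
right; split; first exact: ltW.
by field.
Qed.

Lemma spread_iter_double (f : T -> R) t : measurable_fun setT f ->
  (forall y, 0 <= f y <= 1) ->
  spread C (iter_int (2 * t) f) ((1 - gamma * eps) ^+ t) ((1 - gamma * eps) ^+ t).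
Proof.
move=> mf f01; have /andP[g0 g1] := gamma01.
elim: t => [|t IH].
  by rewrite muln0 expr0; apply: spread_unit => x; exact: iter_int_bounds.
rewrite mulnS iter_intS//.
have step := @spread_step _ _ _ P C gamma eps eta mC gamma01 eps01 PC eta_total P_minor.
have := step _ _ _ _ (measurable_iter_int (2 * t) mf f01) IH (or_introl erefl).
rewrite -iter_intS// => IH1.
have := step _ _ _ _ (measurable_iter_int (2 * t).+1 mf f01) IH1 (or_introl erefl).
move=> /spread_diag; rewrite exprS.
apply: spread_le; rewrite le_eqVlt; apply/orP; left; apply/eqP; ring.
Qed.

End rates_of_convergence.
End convergence_rates.

(** * Maximal couplings and the Wasserstein distance *)

Section probability_of_measure.
Context d (T : measurableType d) (R : realType) (m : {measure set T -> \bar R}).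
Hypothesis m1 : (m setT = 1)%E.

Let prob_of (h : (m setT = 1)%E) : set T -> \bar R := m.

HB.instance Definition _ h := Measure.on (prob_of h).
HB.instance Definition _ h :=
  Measure_isProbability.Build _ _ _ (prob_of h) h.

Lemma probability_of_measure : exists P : probability T R, forall A, P A = m A.
Proof. by exists (prob_of m1). Qed.

End probability_of_measure.

Section maximal_coupling.
Context d (T : measurableType d) (R : realType).
Local Open Scope ereal_scope.

(** Hahn decomposition of mu - nu: mu exceeds nu by p on H, and nu exceeds mu
    by q off H. *)
Lemma probability_difference (mu nu : probability T R) :
  exists (H : set T) (p q : {finite_measure set T -> \bar R}),
  [/\ measurable H,
    forall A, measurable A -> mu (A `&` H) = nu (A `&` H) + p A &
    forall A, measurable A -> nu (A `&` ~` H) = mu (A `&` ~` H) + q A].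
Proof.
pose s : {charge set T -> \bar R} :=
  cadd (charge_of_finite_measure mu) (cscale (-1) (charge_of_finite_measure nu)).
have sE A : s A = mu A - nu A by rewrite /s /= /cadd/= cscaleN1.
have [H [N HN]] := Hahn_decomposition s.
have [[mH _] [mN _] HNT HN0] := HN.
have NE : N = ~` H.
  apply/seteqP; split=> x; first by move=> Nx Hx; rewrite -[False]/(set0 x) -HN0.
  by move=> Hx; have : setT x by []; rewrite -HNT => -[].
exists H, (jordan_pos HN), (jordan_neg HN); split=> // A mA.
- have pA : jordan_pos HN A = s (A `&` H).
    by rewrite jordan_posE cjordan_posE /crestr0 mem_set.
  rewrite -[X in _ = _ + X]/(jordan_pos HN A) pA sE addeC subeK//.
  by rewrite fin_num_measure//; exact: measurableI.
- have mAN : measurable (A `&` ~` H) by apply: measurableI => //; rewrite -NE.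
  have qA : jordan_neg HN A = - s (A `&` ~` H).
    by rewrite jordan_negE cjordan_negE /crestr0 mem_set// -NE.
  have f1 : mu (A `&` ~` H) \is a fin_num by rewrite fin_num_measure.
  have f2 : nu (A `&` ~` H) \is a fin_num by rewrite fin_num_measure.
  rewrite -[X in _ = _ + X]/(jordan_neg HN A) qA sE.
  by rewrite fin_num_oppeB// addeA subee// add0e.
Qed.

Variables (mu nu : probability T R) (H : set T)
  (p q : {finite_measure set T -> \bar R}).
Hypothesis mH : measurable H.
Hypothesis pE : forall A, measurable A -> mu (A `&` H) = nu (A `&` H) + p A.
Hypothesis qE : forall A, measurable A -> nu (A `&` ~` H) = mu (A `&` ~` H) + q A.

Let mHC : measurable (~` H). Proof. exact: measurableC. Qed.

Let common : {measure set T -> \bar R} :=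
  measure_add (mrestr nu mH) (mrestr mu mHC).

Let commonE A : measurable A ->
  common A = nu (A `&` H) + mu (A `&` ~` H).
Proof. by move=> _; exact: (measure_addE (mrestr nu mH) (mrestr mu mHC) A). Qed.

Let partition (m : probability T R) A : measurable A ->
  m A = m (A `&` H) + m (A `&` ~` H).
Proof.
move=> mA; rewrite -measureU//; first by rewrite -setIUr setUCr setIT.
- exact: measurableI.
- exact: measurableI.
- by rewrite setIACA setICr setI0.
Qed.

Lemma excess_left A : measurable A -> mu A = common A + p A.
Proof. by move=> mA; rewrite commonE// partition// pE// addeAC. Qed.

Lemma excess_right A : measurable A -> nu A = common A + q A.
Proof. by move=> mA; rewrite commonE// partition// qE// addeA. Qed.

Let delta := fine (p setT).

Let pT : p setT = delta%:E. Proof. by rewrite fineK// fin_num_measure. Qed.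

Let qT : q setT = delta%:E.
Proof.
have h1 := excess_left measurableT; have h2 := excess_right measurableT.
have e : common setT + p setT = common setT + q setT.
  by rewrite -h1 -h2 !probability_setT.
have cf : common setT \is a fin_num.
  rewrite ge0_fin_numE// (@le_lt_trans _ _ (mu setT))//.
    by rewrite h1 leeDl.
  by rewrite probability_setT ltry.
move: e; rewrite pT; move: (q setT) (common setT) cf => x [y| |]//= _.
by case: x => // x [] /addrI ->.
Qed.

Let delta_ge0 : (0 <= delta)%R. Proof. by rewrite fine_ge0. Qed.

Let cV_ge0 : (0 <= delta^-1)%R. Proof. by rewrite invr_ge0. Qed.

Let mdiag : measurable_fun [set: T] (fun x : T => (x, x)).
Proof. exact: measurable_fun_pair. Qed.

Let diag : {measure set (T * T) -> \bar R}.
Proof.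
pose m : {measure set (T * T) -> \bar R} :=
  pushforward common (fun x : T => (x, x)).
exact: m mdiag.
Defined.

Let indep : {measure set (T * T) -> \bar R} := mscale (NngNum cV_ge0) (p \x q).

Let coupling0 : {measure set (T * T) -> \bar R} := measure_add diag indep.

Let coupling0E B : coupling0 B =
  common ((fun x : T => (x, x)) @^-1` B) + (delta^-1)%:E * (p \x q) B.
Proof.
exact: (measure_addE diag indep B).
Qed.

Let normalize (r : {finite_measure set T -> \bar R}) A : measurable A ->
  r setT = delta%:E -> (delta^-1)%:E * (r A * delta%:E) = r A.
Proof.
move=> mA rT; have rA : r A <= delta%:E by rewrite -rT le_measure ?inE.
have [d0|d0] := eqVneq delta 0%R.
  rewrite d0 mule0 mule0; apply/esym/eqP; rewrite eq_le measure_ge0 andbT.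
  by rewrite (le_trans rA)// d0.
by rewrite muleCA -EFinM mulVf// mule1.
Qed.

Let couplingl A : measurable A -> coupling0 (A `*` setT) = mu A.
Proof.
move=> mA; rewrite coupling0E product_measure1E// [X in _ * (_ * X)]qT normalize//.
rewrite excess_left//; congr (common _ + _).
by apply/seteqP; split=> x //= [].
Qed.

Let couplingr A : measurable A -> coupling0 (setT `*` A) = nu A.
Proof.
move=> mA; rewrite coupling0E product_measure1E// [X in _ * (X * _)]pT.
rewrite [X in _ * X]muleC normalize// excess_right//; congr (common _ + _).
by apply/seteqP; split=> x //= [].
Qed.

Let coupling_total : coupling0 setT = 1.
Proof. by rewrite -setXTT couplingl// probability_setT. Qed.

Let coupling_probability : exists G : probability (T * T)%type R,
  forall B, G B = coupling0 B.
Proof. exact: probability_of_measure coupling_total. Qed.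

Let mrestr_integral (m : {measure set T -> \bar R}) D (mD : measurable D)
    (g : T -> \bar R) : measurable_fun setT g -> (forall x, 0 <= g x) ->
  \int[mrestr m mD]_x g x = \int[m]_(x in D) g x.
Proof.
move=> mg g0; have mi : measurable_fun setT (\1_D : T -> R).
  exact: measurable_indic.
rewrite (@ge0_integral_density _ _ _ m (mrestr m mD) (\1_D : T -> R))//.
- rewrite [RHS]integral_mkcond; apply: eq_integral => x _.
  by rewrite patchE indicE; case: ifP => _; rewrite ?mul1e ?mul0e.
- by move=> A mA; rewrite integral_indic// setIC.
Qed.

Lemma excess_integral_left (g : T -> \bar R) : measurable_fun setT g ->
  (forall x, 0 <= g x) ->
  \int[mu]_(x in H) g x = \int[nu]_(x in H) g x + \int[p]_x g x.
Proof.
move=> mg g0; rewrite -(mrestr_integral mu mH)// -(mrestr_integral nu mH)//.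
rewrite -ge0_integral_measure_add//; apply: eq_measure_integral => A mA _.
by apply: etrans (esym (measure_addE (mrestr nu mH) p A)); exact: pE.
Qed.

Lemma excess_integral_right (g : T -> \bar R) : measurable_fun setT g ->
  (forall x, 0 <= g x) ->
  \int[nu]_(x in ~` H) g x = \int[mu]_(x in ~` H) g x + \int[q]_x g x.
Proof.
move=> mg g0; rewrite -(mrestr_integral nu mHC)// -(mrestr_integral mu mHC)//.
rewrite -ge0_integral_measure_add//; apply: eq_measure_integral => A mA _.
by apply: etrans (esym (measure_addE (mrestr mu mHC) q A)); exact: qE.
Qed.

(** The common part of mu and nu stays on the diagonal, at no cost; the two
    excesses, of equal mass delta, are coupled independently, which requires
    the factor 1 / delta (and nothing when delta = 0, both being then zero). *)
Lemma maximal_coupling_cost (cost : T * T -> \bar R) (g : T -> \bar R) :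
  measurable_fun setT cost -> (forall uv, 0 <= cost uv) ->
  measurable_fun setT g -> (forall x, 0 <= g x) ->
  (forall x, cost (x, x) = 0) -> (forall x y, cost (x, y) <= g x + g y) ->
  exists G : probability (T * T)%type R,
  [/\ forall A, measurable A -> G (A `*` setT) = mu A,
      forall A, measurable A -> G (setT `*` A) = nu A &
      \int[G]_uv cost uv <= \int[p]_x g x + \int[q]_x g x].
Proof.
move=> mcost cost0 mg g0 cxx cg.
have [G GE] := coupling_probability.
exists G; split; [by move=> A mA; rewrite GE couplingl|by move=> A mA; rewrite GE couplingr|].
have -> : \int[G]_uv cost uv = \int[coupling0]_uv cost uv.
  by apply: eq_measure_integral => A mA _; exact: GE.
rewrite ge0_integral_measure_add//. rewrite [X in X + _](_ : _ = 0) ?add0e; last first.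
  rewrite (_ : \int[diag]_x cost x = \int[common]_x cost (x, x)).
    by apply: integral0_eq => x _.
  by rewrite ge0_integral_pushforward.
rewrite ge0_integral_mscale// fubini_tonelli1//=.
have mq x : measurable_fun setT (fun y => cost (x, y)).
  exact: measurableT_comp.
apply: (@le_trans _ _ ((delta^-1)%:E *
    \int[p]_x (g x * delta%:E + \int[q]_y g y))).
  apply: lee_wpmul2l; first by rewrite lee_fin.
  apply: ge0_le_integral => //.
  - by move=> x _; exact: integral_ge0.
  - exact: (@measurable_fun_fubini_tonelli_F _ _ _ _ _ q cost).
  - by apply: emeasurable_funD => //; exact: emeasurable_funM.
  - move=> x _; rewrite /fubini_F.
    apply: (@le_trans _ _ (\int[q]_y (g x + g y))).
      by apply: ge0_le_integral => //; exact: emeasurable_funD.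
    have <- : \int[q]_y g x = g x * delta%:E.
      by rewrite -qT; exact: (integral_cst q measurableT (g x)).
    by rewrite -ge0_integralD.
rewrite ge0_integralD//; [|by move=> x _; rewrite mule_ge0 ?lee_fin
  |exact: emeasurable_funM|by move=> x _; exact: integral_ge0].
rewrite ge0_muleDr; [|by apply: integral_ge0 => x _; rewrite mule_ge0 ?lee_fin
  |by apply: integral_ge0 => x _; exact: integral_ge0].
have dd : (delta^-1)%:E * delta%:E <= 1.
  rewrite -EFinM lee_fin; have [->|d0] := eqVneq delta 0%R; first by rewrite mulr0.
  by rewrite mulVf.
have ig (m : {finite_measure set T -> \bar R}) : 0 <= \int[m]_x g x.
  exact: integral_ge0.
have dI (m : {finite_measure set T -> \bar R}) :
    (delta^-1)%:E * (\int[m]_x g x * delta%:E) <= \int[m]_x g x.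
  by rewrite muleCA -[leRHS]mule1 lee_wpmul2l// ig.
apply: leeD.
- rewrite ge0_integralZr//; exact: dI.
- have -> : \int[p]_x (\int[q]_y g y) = (\int[q]_y g y) * delta%:E.
    by rewrite -pT; exact: (integral_cst p measurableT (\int[q]_y g y)).
  exact: dI.
Qed.

End maximal_coupling.

Section wasserstein_weighted.
Context {R : realType}.
Variable p : nat.
Implicit Types u v : 'cV[R]_p.

Lemma l2norm_triangle u v : l2norm (u - v) <= l2norm u + l2norm v.
Proof.
have h0 : 0 <= l2norm u + l2norm v by rewrite addr_ge0 ?l2norm_ge0.
rewrite -(@ler_pXn2r _ 2) ?nnegrE ?l2norm_ge0//.
rewrite (sqrrD (l2norm u)) !l2norm_sqr.
have -> : \sum_i (u - v) i 0 ^+ 2 = \sum_i u i 0 ^+ 2 -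
    (\sum_i u i 0 * v i 0) *+ 2 + \sum_i v i 0 ^+ 2.
  rewrite -sumrMnl -sumrB -big_split; apply: eq_bigr => i _ /=.
  by rewrite !mxE sqrrB.
rewrite lerD2r lerD2l.
have := l2norm_cauchy_schwarz u v.
rewrite ler_norml dotE => /andP[+ _].
move: (\sum_i _) (l2norm u * l2norm v) => a b; lra.
Qed.

Lemma l2norm_le_1sqr u : l2norm u <= 1 + l2norm u ^+ 2.
Proof.
have := sqr_ge0 (l2norm u - 1); have := l2norm_ge0 u.
move: (l2norm u) => x; nra.
Qed.

Lemma measurable_l2norm : measurable_fun setT (@l2norm R p).
Proof.
apply: measurableT_comp => //.
  exact: continuous_measurable_fun (@sqrt_continuous R).
by apply: measurable_sum => i; apply: measurable_funX; exact: measurable_entry.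
Qed.


(** The integrals of |u| over the two excesses add up to the difference of
    the integrals of the function equal to |u| on H and - |u| off H. *)
Lemma wasserstein_le_weighted (mu nu : probability 'cV[R]_p R) :
  (\int[mu]_u (l2norm u)%:E < +oo)%E -> (\int[nu]_u (l2norm u)%:E < +oo)%E ->
  (wasserstein_l2 mu nu <=
   weighted_dist (fun u => 1 + l2norm u ^+ 2)%R mu nu)%E.
Proof.
move=> muoo nuoo.
have [H [a [b [mH aE bE]]]] := probability_difference mu nu.
have mg : measurable_fun setT (fun u : 'cV[R]_p => (l2norm u)%:E).
  by apply/measurable_EFinP; exact: measurable_l2norm.
have g0 u : (0 <= (l2norm u)%:E)%E by rewrite lee_fin l2norm_ge0.
have [||||G [Gl Gr Gc]] := maximal_coupling_cost mH aE bE
  (cost := fun uv => (l2norm (uv.1 - uv.2))%:E) _ _ mg g0.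
- apply/measurable_EFinP; apply: measurableT_comp; first exact: measurable_l2norm.
  apply: measurable_fun_mxP => i j.
  apply: (eq_measurable_fun
    (fun x : 'cV[R]_p * 'cV[R]_p => x.1 i j - x.2 i j)).
    by move=> x _; rewrite !mxE.
  apply: measurable_funB.
    exact: (measurableT_comp (measurable_entry (T := R) i j) measurable_fst).
  exact: (measurableT_comp (measurable_entry (T := R) i j) measurable_snd).
- by move=> uv; rewrite lee_fin l2norm_ge0.
- by move=> u /=; rewrite subrr l2norm0.
- by move=> u v /=; rewrite -EFinD lee_fin l2norm_triangle.
apply: (@le_trans _ _ (\int[G]_uv (l2norm (uv.1 - uv.2))%:E)%E).
  by apply: ereal_inf_lbound; exists G => // A mA; rewrite Gl// Gr.
apply: le_trans Gc _.
pose f (u : 'cV[R]_p) : R := if u \in H then l2norm u else - l2norm u.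
have fI (m : probability 'cV[R]_p R) : (\int[m]_u (f u)%:E =
    \int[m]_(u in H) (l2norm u)%:E - \int[m]_(u in ~` H) (l2norm u)%:E)%E.
  rewrite integralE [X in _ = (X - _)%E]integral_mkcond
    [X in _ = (_ - X)%E]integral_mkcond; congr (_ - _)%E;
    apply: eq_integral => u _; rewrite patchE ?funeposE ?funenegE /f.
    case: ifP => _; first by apply/max_idPl.
    by apply/max_idPr; rewrite lee_fin oppr_le0 l2norm_ge0.
  rewrite in_setC; case: ifP => _ /=.
    by apply/max_idPr; rewrite lee_fin oppr_le0 l2norm_ge0.
  by rewrite opprK; apply/max_idPl; rewrite lee_fin l2norm_ge0.
apply: (@le_trans _ _ `|\int[mu]_u (f u)%:E - \int[nu]_u (f u)%:E|%E).
  rewrite !fI (excess_integral_left mH aE)// (excess_integral_right mH bE)//.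
  have fin (m : probability 'cV[R]_p R) D : measurable D ->
      (\int[m]_u (l2norm u)%:E < +oo)%E ->
      (\int[m]_(u in D) (l2norm u)%:E)%E \is a fin_num.
    move=> mD moo; rewrite ge0_fin_numE ?integral_ge0//.
    by apply: le_lt_trans moo; apply: ge0_subset_integral.
  have f1 := fin nu H mH nuoo.
  have f2 := fin mu (~` H) (measurableC mH) muoo.
  have f3 := fin mu H mH muoo.
  have f4 := fin nu (~` H) (measurableC mH) nuoo.
  rewrite (excess_integral_left mH aE)// in f3.
  rewrite (excess_integral_right mH bE)// in f4.
  have : (0 <= \int[a]_u (l2norm u)%:E)%E by exact: integral_ge0.
  have : (0 <= \int[b]_u (l2norm u)%:E)%E by exact: integral_ge0.
  move: (integral a _ _) (integral b _ _) (integral nu _ _) (integral mu _ _)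
    f1 f2 f3 f4 => x1 x2 x3 x4.
  move: x3 x4 x1 x2 => [x3| |]// [x4| |]// [x1| |]// [x2| |]// _ _ _ _.
  rewrite !lee_fin /= => h2 h1.
  have -> : (x3 + x1 - x4 - (x3 - (x4 + x2)) = x1 + x2)%R by ring.
  exact: ler_norm.
apply: ereal_sup_ubound; exists f => //; split.
  apply: measurable_fun_ifT.
  - by apply: (measurable_fun_bool true); rewrite setTI preimage_mem_true.
  - exact: measurable_l2norm.
  - by apply: measurableT_comp => //; exact: measurable_l2norm.
move=> u; rewrite /f; case: ifP => _; rewrite ?normrN ger0_norm ?l2norm_ge0//;
  exact: l2norm_le_1sqr.
Qed.

End wasserstein_weighted.

(** * The Gibbs kernel as a tilted mixture of Gaussian laws *)

Lemma integral_in_indic d (T : measurableType d) (R : realType)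
    (mu : {measure set T -> \bar R}) (A : set T) (h : T -> R) :
  (\int[mu]_(x in A) (h x)%:E = \int[mu]_x (h x * \1_A x)%:E)%E.
Proof.
rewrite integral_mkcond; apply: eq_integral => x _.
by rewrite patchE indicE; case: ifP => _; rewrite ?mulr1 ?mulr0.
Qed.

Section posterior_measurability.
Context {R : realType} d (T : measurableType d).
Variables (n p : nat) (X : 'M[R]_(n, p)) (z : 'cV[R]_n)
  (m0 : 'cV[R]_p) (S0 : 'M[R]_p).

Lemma measurable_post_cov (omega : T -> 'I_n -> R) :
  (forall i, measurable_fun setT (omega^~ i)) ->
  measurable_mx (fun x => post_cov X S0 (omega x)).
Proof.
move=> mo; apply: measurable_invmx; apply: measurable_mxD.
  apply: measurable_mxM; last exact: measurable_mx_cst.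
  apply: measurable_mxM; first exact: measurable_mx_cst.
  move=> i j; apply: (eq_measurable_fun (fun x => omega x i *+ (i == j))).
    by move=> x _; rewrite !mxE.
  case: (i == j); first exact: mo.
  exact: measurable_cst.
exact: measurable_mx_cst.
Qed.

Lemma measurable_post_mean (omega : T -> 'I_n -> R) :
  (forall i, measurable_fun setT (omega^~ i)) ->
  measurable_mx (fun x => post_mean X z m0 S0 (omega x)).
Proof.
move=> mo; apply: measurable_mxM; last exact: measurable_mx_cst.
exact: measurable_post_cov.
Qed.

Lemma measurable_post_pdf (omega : T -> 'I_n -> R) (v : T -> 'cV[R]_p) :
  (forall i, measurable_fun setT (omega^~ i)) -> measurable_mx v ->
  measurable_fun setT (fun x => normal_vec_pdf
    (post_mean X z m0 S0 (omega x)) (post_cov X S0 (omega x)) (v x)).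
Proof.
move=> mo mv; apply: measurable_normal_vec_pdf => //.
  exact: measurable_post_mean.
exact: measurable_post_cov.
Qed.

Lemma measurable_post_pdf_pair (omega : T -> 'I_n -> R) :
  (forall i, measurable_fun setT (omega^~ i)) ->
  measurable_fun setT (fun x : T * 'cV[R]_p => normal_vec_pdf
    (post_mean X z m0 S0 (omega x.1)) (post_cov X S0 (omega x.1)) x.2).
Proof.
move=> mo; apply: (@measurable_normal_vec_pdf R _ (T * 'cV[R]_p)%type p
  (fun x => post_mean X z m0 S0 (omega x.1))
  (fun x => post_cov X S0 (omega x.1)) snd).
- by move=> i j; apply: (measurableT_comp (measurable_post_mean mo i j)).
- by move=> i j; apply: (measurableT_comp (measurable_post_cov mo i j)).
- move=> i j.
  exact: (measurableT_comp (measurable_entry (T := R) i j) measurable_snd).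
Qed.

Lemma measurable_post_normal (omega : T -> 'I_n -> R) A :
  (forall i, measurable_fun setT (omega^~ i)) -> measurable A ->
  measurable_fun setT (fun x =>
    normal_vec (post_mean X z m0 S0 (omega x)) (post_cov X S0 (omega x)) A).
Proof.
move=> mo mA.
pose f (x : T * 'cV[R]_p) := (normal_vec_pdf
    (post_mean X z m0 S0 (omega x.1)) (post_cov X S0 (omega x.1)) x.2 *
    \1_A x.2)%:E.
apply: (eq_measurable_fun (fubini_F (lebesgue_vec p) f)).
  by move=> x _; rewrite /normal_vec integral_in_indic.
apply: measurable_fun_fubini_tonelli_F.
  apply/measurable_EFinP; apply: measurable_funM.
    exact: measurable_post_pdf_pair.
  by apply: (measurableT_comp _ measurable_snd); exact: measurable_indic.
by move=> x; rewrite lee_fin mulr_ge0 ?normal_vec_pdf_ge0// indicE.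
Qed.

End posterior_measurability.

Section reference_realization.
Context {R : realType}.
Variables (n p : nat) (X : 'M[R]_(n, p)) (z : 'cV[R]_n)
  (m0 : 'cV[R]_p) (S0 : 'M[R]_p) (lambda : R).

Definition post_normal (omega : 'I_n -> R) (A : set 'cV[R]_p) : \bar R :=
  normal_vec (post_mean X z m0 S0 omega) (post_cov X S0 omega) A.

Definition tilt (c omega : 'I_n -> R) : R :=
  \prod_i expR (- (c i ^+ 2 / 2 * omega i)).

Definition tilt_mass (c : 'I_n -> R) : R := \prod_i div_sinh (c i / 2) `^ lambda.

Lemma post_normal_ge0 omega A : (0 <= post_normal omega A)%E.
Proof. by apply: integral_ge0 => v _; rewrite lee_fin normal_vec_pdf_ge0. Qed.

Lemma tilt_ge0 c omega : 0 <= tilt c omega.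
Proof. by apply: prodr_ge0 => i _; rewrite expR_ge0. Qed.

Lemma tilt_mass_gt0 c : 0 < tilt_mass c.
Proof. by apply: prodr_gt0 => i _; rewrite powR_gt0// div_sinh_gt0. Qed.

Lemma measurable_tilt_fun (x y : R) :
  measurable_fun setT (fun t : R => expR (- (x * t + y))).
Proof.
apply: measurableT_comp => //; apply: measurableT_comp => //.
by apply: measurable_funD => //; exact: measurable_funM.
Qed.

Lemma integral_distribution d (W : measurableType d) (Pr : probability W R)
    (Y : {RV Pr >-> R}) (f : R -> R) (A : set R) :
  measurable A -> measurable_fun setT f -> (forall x, 0 <= f x) ->
  (\int[distribution Pr Y]_(x in A) (f x)%:E =
   \int[Pr]_(w in Y @^-1` A) (f (Y w))%:E)%E.
Proof.
move=> mA mf f0; rewrite ge0_integral_pushforward//.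
  by apply/measurable_EFinP; exact: measurable_funTS.
by move=> x _; rewrite lee_fin.
Qed.

Let clip (x : R) : R := Num.max x 0.

(** The reference variables are those of the chain started from 0, where all
    the x_i^T beta vanish.  They are replaced by their positive parts, which
    changes nothing almost surely and makes the matrices Sigma_omega positive
    definite everywhere. *)
Lemma gibbs_reference (P : R.-pker 'cV[R]_p ~> 'cV[R]_p) :
  is_KG_Gibbs_kernel X z m0 S0 lambda P ->
  exists (d : measure_display) (W : measurableType d) (Pr : probability W R)
    (omega : W -> 'I_n -> R),
  [/\ forall i, measurable_fun setT (omega^~ i),
      forall w i, 0 <= omega w i,
      forall c, (\int[Pr]_w (tilt c (omega w))%:E = (tilt_mass c)%:E)%E &
      forall beta A, measurable A -> (P beta A =
        ((tilt_mass (fun i => (X *m beta) i 0))^-1)%:E *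
        \int[Pr]_w ((tilt (fun i => (X *m beta) i 0) (omega w))%:E *
                    post_normal (omega w) A))%E].
Proof.
move=> PG; have [d0 [W0 [Pr0 [om0 [ind0 law0 _]]]]] := PG 0.
have {}law0 i : KG_law lambda 0 (distribution Pr0 (om0 i)).
  by have := law0 i; rewrite mulmx0 mxE.
have mtilt (x : R) : measurable_fun setT (fun t : R => expR (- (x * t))).
  by apply: eq_measurable_fun (measurable_tilt_fun x 0) => t _; rewrite addr0.
have mclip : measurable_fun setT clip by exact: measurable_maxr.
pose omega w i := clip (om0 i w).
have momega i : measurable_fun setT (omega^~ i).
  by apply: (measurableT_comp mclip).
have omega_ge0 w i : 0 <= omega w i by rewrite le_max lexx orbT.
have clipped : \forall w \ae Pr0, forall i, omega w i = om0 i w.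
  apply: filter_forall => i.
  have neg : measurable (om0 i @^-1` `]-oo, 0[%classic).
    by rewrite -[X in measurable X]setTI; exact: measurable_funPT.
  exists (om0 i @^-1` `]-oo, 0[%classic); split => //.
    exact: KG_law_ge0 (law0 i).
  move=> w /= h; rewrite in_itv/= ltNge; apply/negP => o; apply: h.
  by apply/max_idPl.
exists d0, W0, Pr0, omega; split => //.
- move=> c; transitivity
    (\int[Pr0]_w (\prod_i expR (- (c i ^+ 2 / 2 * om0 i w)))%:E)%E.
    apply: ge0_ae_eq_integral => //.
    + apply/measurable_EFinP; apply: measurable_prod => i _.
      exact: (measurableT_comp (mtilt _) (momega i)).
    + apply/measurable_EFinP; apply: measurable_prod => i _.
      exact: (measurableT_comp (mtilt _)).
    + by move=> w _; rewrite lee_fin tilt_ge0.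
    + by move=> w _; rewrite lee_fin (tilt_ge0 c (om0^~ w)).
    + apply: filterS clipped => w e _; congr (_%:E).
      by apply: eq_bigr => i _; rewrite e.
  apply: (independent_integral_prod
    (f := fun i x => expR (- (c i ^+ 2 / 2 * x))) _ ind0).
  + by move=> i.
  + by move=> i; exact: mtilt.
  + by move=> i x; exact: expR_ge0.
  + move=> i; rewrite -(KG_law_laplace (c i) (law0 i)).
    by rewrite integral_distribution// => x; exact: expR_ge0.
  + exact: index_enum_uniq.
move=> beta A mA; set c := fun i => _.
have [d [W [Pr [om [ind law ->]]]]]:= PG beta; last by [].
pose F (v : 'cV[R]_n) : \bar R := post_normal (fun i => v i 0) A.
have mF : measurable_fun setT F.
  by apply: measurable_post_normal => // i; exact: measurable_entry.
have jE d' (W' : measurableType d') (Y : 'I_n -> W' -> R) w :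
    F (joint Y w) = post_normal (Y^~ w) A.
  have e : (fun i => joint Y w i 0) = Y^~ w by apply/funext => i; rewrite mxE.
  by rewrite /F e.
transitivity (\int[Pr]_w F (joint (fun i => om i) w))%E.
  by apply: eq_integral => w _; rewrite jE.
have mom i : measurable_fun setT (om i : W -> R) by exact: measurable_funPT.
have mom0 i : measurable_fun setT (om0 i : W0 -> R) by exact: measurable_funPT.
have k0 i : 0 < (div_sinh (c i / 2) `^ lambda)^-1.
  by rewrite invr_gt0 powR_gt0// div_sinh_gt0.
have h0 i x : 0 <= expR (- (c i ^+ 2 / 2 * x)) by exact: expR_ge0.
have marginal i B : measurable B -> Pr (om i @^-1` B) =
    (((div_sinh (c i / 2) `^ lambda)^-1)%:E *
     \int[Pr0]_(w in om0 i @^-1` B) (expR (- (c i ^+ 2 / 2 * om0 i w)))%:E)%E.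
  move=> mB; have := KG_law_tilt (law0 i) (law i) mB.
  by rewrite integral_distribution// => x; exact: expR_ge0.
have F0 v : (0 <= F v)%E by exact: post_normal_ge0.
transitivity ((\prod_i (div_sinh (c i / 2) `^ lambda)^-1)%:E * \int[Pr0]_w
    ((\prod_i expR (- (c i ^+ 2 / 2 * om0 i w)))%:E *
     F (joint (fun i => om0 i : W0 -> R) w)))%E.
  exact: (joint_tilt mom mom0 ind ind0 k0 (fun i => mtilt _) h0 marginal mF F0).
have -> : \prod_i (div_sinh (c i / 2) `^ lambda)^-1 = (tilt_mass c)^-1.
  by rewrite prodfV.
apply: (f_equal (fun t => ((tilt_mass c)^-1)%:E * t)%E).
apply: ge0_ae_eq_integral; first exact: measurableT.
- apply: emeasurable_funM.
    apply/measurable_EFinP; apply: measurable_prod => i _.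
    exact: (measurableT_comp (mtilt _)).
    by apply: (measurableT_comp mF); exact: measurable_joint.
- apply: emeasurable_funM.
    apply/measurable_EFinP; apply: measurable_prod => i _.
    exact: (measurableT_comp (mtilt _) (momega i)).
    exact: measurable_post_normal.
- move=> w _; rewrite mule_ge0 ?post_normal_ge0//.
    by rewrite lee_fin (tilt_ge0 c (om0^~ w)).
- by move=> w _; rewrite mule_ge0 ?post_normal_ge0// lee_fin tilt_ge0.
- apply: filterS clipped => w e _; rewrite jE.
    by have -> : omega w = om0^~ w by apply/funext => i; rewrite e.
Qed.

End reference_realization.

Section posterior_factorization.
Context {R : realType}.
Local Notation qf Q w := ((w^T *m Q *m w) 0 0).

Lemma normal_vec_pdf_gt0 p m (S : 'M[R]_p) v : symposdef S ->
  0 < normal_vec_pdf m S v.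
Proof.
move=> Spos; rewrite mulr_gt0 ?expR_gt0// invr_gt0 sqrtr_gt0 mulr_gt0//.
  by rewrite exprn_gt0// mulr_gt0// pi_gt0.
by have [] := gauss_integral m Spos.
Qed.

Lemma normal_vec_pdf_shift p m (Q : 'M[R]_p) v : symposdef Q ->
  normal_vec_pdf m (invmx Q) v =
  normal_vec_pdf m (invmx Q) 0 *
    expR (- (1 / 2) * qf Q v + (v^T *m (Q *m m)) 0 0).
Proof.
move=> Qpos; rewrite !normal_vec_pdf_precision// -mulrA -expRD.
congr (_ * expR _); rewrite qf_shift; last by case: Qpos.
move: (qf Q v) (qf Q _) => a b; move: (_ 0 0) => c; lra.
Qed.

Variables (n p : nat) (X : 'M[R]_(n, p)) (z : 'cV[R]_n)
  (m0 : 'cV[R]_p) (S0 : 'M[R]_p).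
Hypothesis S0_posdef : symposdef S0.
Variable omega : 'I_n -> R.
Hypothesis omega_ge0 : forall i, 0 <= omega i.

Local Notation pdf :=
  (normal_vec_pdf (post_mean X z m0 S0 omega) (post_cov X S0 omega)).

(** Completing the square in v: both sides are the exponential of
    v^T (X^T z + S0^-1 m0) - v^T Q v / 2, with Q the posterior precision, up to
    a factor constant in v, which is found by evaluating at v = 0. *)
Lemma prior_tilt_posterior (v : 'cV[R]_p) :
  (\prod_i expR (z i 0 * (X *m v) i 0)) * normal_vec_pdf m0 S0 v *
    tilt (fun i => (X *m v) i 0) omega =
  normal_vec_pdf m0 S0 0 / pdf 0 * pdf v.
Proof.
have Qpos := post_prec_posdef X S0_posdef omega_ge0.
have pdf0 : pdf 0 != 0.
  by rewrite gt_eqF// normal_vec_pdf_gt0//; exact: post_cov_posdef.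
have Qm : post_prec X S0 omega *m post_mean X z m0 S0 omega =
    X^T *m z + invmx S0 *m m0.
  by rewrite /post_mean mulmxA mulmxV ?mul1mx//; exact: symposdef_unit.
rewrite (normal_vec_pdf_shift _ v Qpos).
have := normal_vec_pdf_shift m0 v (symposdef_invmx S0_posdef).
rewrite invmxK => ->; rewrite [RHS]mulrA divfK// mulrCA -mulrA; congr (_ * _).
rewrite /tilt -!expR_sum -!expRD; congr expR.
have e : v^T *m (X^T *m z) = (X *m v)^T *m z by rewrite mulmxA -trmx_mul.
rewrite qf_post_prec Qm mulmxDr e [((X *m v)^T *m z + _) 0 0]mxE (dotE (X *m v)).
have -> : \sum_i (X *m v) i 0 * z i 0 = \sum_i z i 0 * (X *m v) i 0.
  by apply: eq_bigr => i _; rewrite mulrC.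
have -> : \sum_i - ((X *m v) i 0 ^+ 2 / 2 * omega i) =
    - (1 / 2) * \sum_i omega i * (X *m v) i 0 ^+ 2.
  by rewrite mulr_sumr; apply: eq_bigr => i _; field.
move: (\sum_i _) (\sum_i _) (qf _ v) ((v^T *m _) 0 0) => a b c f; lra.
Qed.

End posterior_factorization.

Section mixture_measure.
Context d d' (T : measurableType d) (Y : measurableType d') (R : realType).
Variables (mu : {measure set Y -> \bar R}) (k : Y -> {measure set T -> \bar R}).
Hypothesis mk : forall A, measurable A -> measurable_fun setT (fun y => k y A).
Local Open Scope ereal_scope.

(** The hypothesis is an argument for the same reason as in
    [density_measure]. *)
Definition mixture_measure
    of forall A, measurable A -> measurable_fun setT (fun y => k y A) :=
  fun A : set T => \int[mu]_y k y A.

Local Notation m := (mixture_measure mk).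

Let mixture_measure0 : m set0 = 0.
Proof. by apply: integral0_eq => y _; rewrite measure0. Qed.

Let mixture_measure_ge0 A : 0 <= m A.
Proof. exact: integral_ge0. Qed.

Let mixture_measure_sigma_additive : semi_sigma_additive m.
Proof.
move=> U mU tU mUU; rewrite [X in _ --> X](_ : _ =
  \int[mu]_y (\sum_(n <oo) k y (U n))); last first.
  apply: eq_integral => y _.
  by apply/esym/cvg_lim => //; exact: measure_semi_sigma_additive.
apply/cvg_closeP; split.
  by apply: is_cvg_nneseries => n _ _; exact: integral_ge0.
by rewrite closeE// integral_nneseries// => n; exact: mk.
Qed.

HB.instance Definition _ := isMeasure.Build _ _ _ m
  mixture_measure0 mixture_measure_ge0 mixture_measure_sigma_additive.

End mixture_measure.

Lemma measurable_div_sinh (R : realType) :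
  measurable_fun setT (div_sinh : R -> R).
Proof.
apply: measurable_fun_ifT.
- exact: measurable_fun_eqr.
- exact: measurable_cst.
- have ms : measurable_fun setT (@sinh R).
    apply: measurable_funM => //; apply: measurable_funB => //.
    by apply: measurableT_comp => //; exact: measurableT_comp.
  apply: measurable_funM => //.
  exact: (measurableT_comp (@measurable_inv R) ms).
Qed.

Section gibbs_kernel.
Context {R : realType}.
Variables (n p : nat) (X : 'M[R]_(n, p)) (z : 'cV[R]_n)
  (m0 : 'cV[R]_p) (S0 : 'M[R]_p) (lambda : R).
Hypothesis S0_posdef : symposdef S0.
Hypothesis lambda_gt0 : 0 < lambda.
Context d (W : measurableType d) (Pr : probability W R).
Variable omega : W -> 'I_n -> R.
Hypothesis momega : forall i, measurable_fun setT (omega^~ i).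
Hypothesis omega_ge0 : forall w i, 0 <= omega w i.
Hypothesis laplace : forall c,
  (\int[Pr]_w (tilt c (omega w))%:E = (tilt_mass lambda c)%:E)%E.

Let pdf w := normal_vec_pdf (post_mean X z m0 S0 (omega w)) (post_cov X S0 (omega w)).

Let mpdf w : measurable_fun setT (pdf w).
Proof. exact: measurable_normal_vec_pdfr. Qed.

Let pdf_ge0 w v : 0 <= pdf w v.
Proof. exact: normal_vec_pdf_ge0. Qed.

Definition conditional w : {measure set 'cV[R]_p -> \bar R} :=
  density_measure (lebesgue_vec p) (mpdf w) (pdf_ge0 w).

Lemma measurable_conditional A : measurable A ->
  measurable_fun setT (fun w => conditional w A).
Proof. exact: measurable_post_normal. Qed.

Lemma conditional_total w : conditional w setT = 1%E.
Proof. exact/normal_vec_total/post_cov_posdef. Qed.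

Lemma measurable_sql2norm :
  measurable_fun setT (fun v : 'cV[R]_p => (l2norm v ^+ 2)%:E).
Proof.
by apply/measurable_EFinP; apply: measurable_funX; exact: measurable_l2norm.
Qed.

Lemma sql2norm_ge0 (v : 'cV[R]_p) : (0 <= (l2norm v ^+ 2)%:E)%E.
Proof. by rewrite lee_fin sqr_ge0. Qed.

Lemma conditional_integral w (f : 'cV[R]_p -> \bar R) :
  measurable_fun setT f -> (forall v, (0 <= f v)%E) ->
  (\int[conditional w]_v f v = \int[lebesgue_vec p]_v ((pdf w v)%:E * f v))%E.
Proof.
move=> mf f0.
exact: (@ge0_integral_density _ _ _ (lebesgue_vec p) (conditional w) (pdf w)).
Qed.

Lemma conditional_second_moment w :
  (\int[conditional w]_v (l2norm v ^+ 2)%:E <= (drift_const X z m0 S0)%:E)%E.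
Proof.
have := post_second_moment X z m0 S0_posdef (omega_ge0 w).
rewrite conditional_integral; last exact: sql2norm_ge0.
  by under eq_integral do rewrite EFinM.
exact: measurable_sql2norm.
Qed.

Lemma measurable_conditional_integral (f : 'cV[R]_p -> \bar R) :
  measurable_fun setT f -> (forall v, (0 <= f v)%E) ->
  measurable_fun setT (fun w => \int[conditional w]_v f v)%E.
Proof.
move=> mf f0; apply: (eq_measurable_fun (fubini_F (lebesgue_vec p)
    (fun x : W * 'cV[R]_p => (pdf x.1 x.2)%:E * f x.2)%E)).
  by move=> w _; rewrite conditional_integral.
apply: measurable_fun_fubini_tonelli_F.
  apply: emeasurable_funM; last exact: (measurableT_comp mf measurable_snd).
  by apply/measurable_EFinP; exact: measurable_post_pdf_pair.
by move=> x; rewrite mule_ge0// lee_fin pdf_ge0.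
Qed.

Lemma measurable_tilt_omega c : measurable_fun setT (fun w => tilt c (omega w)).
Proof.
apply: measurable_prod => i _.
have mt : measurable_fun setT (fun x : R => expR (- (c i ^+ 2 / 2 * x))).
  apply: eq_measurable_fun (measurable_tilt_fun (c i ^+ 2 / 2) 0) => t _.
  by rewrite addr0.
exact: (measurableT_comp mt (momega i)).
Qed.

Definition tilted c : {measure set W -> \bar R} :=
  density_measure Pr (measurable_tilt_omega c) (fun w => tilt_ge0 c (omega w)).

Lemma tilted_integral c (f : W -> \bar R) : measurable_fun setT f ->
  (forall w, (0 <= f w)%E) ->
  (\int[tilted c]_w f w = \int[Pr]_w ((tilt c (omega w))%:E * f w))%E.
Proof.
move=> mf f0; apply: (ge0_integral_density (measurable_tilt_omega c)) => // w.
exact: tilt_ge0.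
Qed.

Lemma tilted_total c : tilted c setT = (tilt_mass lambda c)%:E.
Proof. exact: laplace. Qed.

(** With c_i = x_i^T beta this is proportional to P(beta, .); with c_i an upper
    bound of |x_i^T beta| over a set of states it is the minorizing measure. *)
Definition tilted_mixture c : {measure set 'cV[R]_p -> \bar R} :=
  mixture_measure (tilted c) measurable_conditional.

Lemma tilted_mixtureE c A : measurable A -> tilted_mixture c A =
  (\int[Pr]_w ((tilt c (omega w))%:E * post_normal X z m0 S0 (omega w) A))%E.
Proof.
by move=> mA; apply: tilted_integral => //; exact: measurable_conditional.
Qed.

Lemma tilted_mixture_total c : tilted_mixture c setT = (tilt_mass lambda c)%:E.
Proof.
rewrite -tilted_total -[LHS]/(\int[tilted c]_w conditional w setT)%E.
under eq_integral do rewrite conditional_total.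
by rewrite integral_cst// mul1e.
Qed.

Lemma tilted_mixture_second_moment c :
  (\int[tilted_mixture c]_v (l2norm v ^+ 2)%:E <=
   (drift_const X z m0 S0 * tilt_mass lambda c)%:E)%E.
Proof.
rewrite (@ge0_integral_mixture _ _ _ _ _ (tilted c) conditional
  (tilted_mixture c) measurable_conditional)//; first last.
- exact: sql2norm_ge0.
- exact: measurable_sql2norm.
rewrite EFinM -tilted_total -(@integral_cst _ _ _ (tilted c) setT)//.
apply: ge0_le_integral => //.
- by move=> w _; apply: integral_ge0 => v _; exact: sql2norm_ge0.
- exact: measurable_conditional_integral measurable_sql2norm sql2norm_ge0.
- by move=> w _; exact: conditional_second_moment.
Qed.

Variable P : R.-pker 'cV[R]_p ~> 'cV[R]_p.
Hypothesis PE : forall beta A, measurable A -> (P beta A =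
  ((tilt_mass lambda (fun i => (X *m beta) i 0))^-1)%:E *
  \int[Pr]_w ((tilt (fun i => (X *m beta) i 0) (omega w))%:E *
              post_normal X z m0 S0 (omega w) A))%E.

Let fitted (beta : 'cV[R]_p) (i : 'I_n) : R := (X *m beta) i 0.

Lemma gibbs_tilted beta A : measurable A -> (P beta A =
  ((tilt_mass lambda (fitted beta))^-1)%:E * tilted_mixture (fitted beta) A)%E.
Proof. by move=> mA; rewrite PE// tilted_mixtureE. Qed.

Lemma gibbs_drift beta :
  (\int[P beta]_v (l2norm v ^+ 2)%:E <= (drift_const X z m0 S0)%:E)%E.
Proof.
have k0 : 0 < tilt_mass lambda (fitted beta) by exact: tilt_mass_gt0.
have ki : 0 <= (tilt_mass lambda (fitted beta))^-1 by rewrite invr_ge0 ltW.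
have -> : (\int[P beta]_v (l2norm v ^+ 2)%:E =
    \int[mscale (NngNum ki) (tilted_mixture (fitted beta))]_v
    (l2norm v ^+ 2)%:E)%E.
  by apply: eq_measure_integral => A mA _; exact: gibbs_tilted.
rewrite ge0_integral_mscale//.
- apply: (@le_trans _ _ _ _ _ (lee_wpmul2l _ (tilted_mixture_second_moment _))).
    by rewrite lee_fin.
  by rewrite -EFinM/= mulrC mulfK// gt_eqF.
- exact: measurable_sql2norm.
- by move=> v _; exact: sql2norm_ge0.
Qed.

Lemma tilt_mass_le1 (c : 'I_n -> R) : tilt_mass lambda c <= 1.
Proof.
apply: prodr_ile1 => i _; rewrite powR_ge0/=.
have d0 := ltW (div_sinh_gt0 (c i / 2)).
apply: (@le_trans _ _ (1 `^ lambda)); last by rewrite powR1.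
by apply: ge0_ler_powR; rewrite ?nnegrE ?div_sinh_le1// ltW.
Qed.

(** The tilts decrease in |c_i|, and the normalizing factor of P(beta, .) is
    at least 1 because t <= sinh t for t >= 0. *)
Lemma gibbs_minorization c beta A : (forall i, `|(X *m beta) i 0| <= c i) ->
  measurable A -> (tilted_mixture c A <= P beta A)%E.
Proof.
move=> cb mA; rewrite gibbs_tilted//.
have k0 : 0 < tilt_mass lambda (fitted beta) by exact: tilt_mass_gt0.
apply: (@le_trans _ _ (tilted_mixture (fitted beta) A)).
  rewrite !tilted_mixtureE//; apply: ge0_le_integral => //.
  - by move=> w _; rewrite mule_ge0 ?lee_fin ?tilt_ge0 ?post_normal_ge0.
  - apply: emeasurable_funM; last exact: measurable_post_normal.
    by apply/measurable_EFinP; exact: measurable_tilt_omega.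
  - apply: emeasurable_funM; last exact: measurable_post_normal.
    by apply/measurable_EFinP; exact: measurable_tilt_omega.
  - move=> w _; apply: lee_wpmul2r; first exact: post_normal_ge0.
    rewrite lee_fin; apply: ler_prod => i _; rewrite expR_ge0 ler_expR lerN2.
    rewrite ler_wpM2r// ler_wpM2r// -(real_normK (num_real (fitted beta i))).
    by rewrite lerXn2r ?nnegrE// (le_trans _ (cb i)).
rewrite -[leLHS]mul1e; apply: lee_wpmul2r => //.
by rewrite lee_fin invf_ge1// tilt_mass_le1.
Qed.


Variable Pi : probability 'cV[R]_p R.
Variable C : R.
Hypothesis C_gt0 : 0 < C.
Hypothesis PiE : forall A, measurable A -> Pi A =
  (\int[lebesgue_vec p]_(beta in A) (C *
    (KG_pseudo_likelihood X z lambda beta * normal_vec_pdf m0 S0 beta))%R%:E)%E.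

Let joint_density w beta : R :=
  C * (normal_vec_pdf m0 S0 0 / pdf w 0 * pdf w beta).

Let joint_density_ge0 w beta : 0 <= joint_density w beta.
Proof.
by rewrite mulr_ge0 ?(ltW C_gt0)// !mulr_ge0 ?invr_ge0 ?normal_vec_pdf_ge0.
Qed.

Let measurable_joint_density :
  measurable_fun setT (fun x : W * 'cV[R]_p => joint_density x.1 x.2).
Proof.
apply: measurable_funM; first exact: measurable_cst.
apply: measurable_funM; last exact: measurable_post_pdf_pair.
apply: measurable_funM; first exact: measurable_cst.
apply: (measurableT_comp (@measurable_inv R)).
apply: (measurable_post_pdf X z m0 S0
  (omega := fun x : W * 'cV[R]_p => omega x.1) (v := fun=> 0)).
  by move=> i; exact: (measurableT_comp (momega i) measurable_fst).
exact: measurable_mx_cst.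
Qed.

Let posterior_density beta : R :=
  C * (KG_pseudo_likelihood X z lambda beta * normal_vec_pdf m0 S0 beta).

Let posterior_density_ge0 beta : 0 <= posterior_density beta.
Proof.
rewrite mulr_ge0 ?(ltW C_gt0)// mulr_ge0 ?normal_vec_pdf_ge0//.
by apply: prodr_ge0 => i _; rewrite mulr_ge0 ?expR_ge0 ?powR_ge0.
Qed.

Let joint_densityE w beta : joint_density w beta =
  posterior_density beta * (tilt_mass lambda (fitted beta))^-1 *
    tilt (fitted beta) (omega w).
Proof.
rewrite /joint_density.
have e := prior_tilt_posterior X z m0 S0_posdef (omega_ge0 w) beta.
rewrite -[X in C * X]e /posterior_density.
have -> : KG_pseudo_likelihood X z lambda beta =
    (\prod_i expR (z i 0 * (X *m beta) i 0)) * tilt_mass lambda (fitted beta).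
  by rewrite /KG_pseudo_likelihood big_split.
have k0 : tilt_mass lambda (fitted beta) != 0 by rewrite gt_eqF ?tilt_mass_gt0.
rewrite -/(fitted beta); move: k0 (tilt _ _) (\prod_i _) (normal_vec_pdf _ _ _).
by move: (tilt_mass _ _) => k k0 a b c; field.
Qed.

Let posterior_joint beta (f : W -> \bar R) : measurable_fun setT f ->
  (forall w, (0 <= f w)%E) ->
  ((posterior_density beta)%:E * ((tilt_mass lambda (fitted beta))^-1%:E *
     \int[Pr]_w ((tilt (fitted beta) (omega w))%:E * f w)) =
   \int[Pr]_w ((joint_density w beta)%:E * f w))%E.
Proof.
move=> mf f0; have k0 := tilt_mass_gt0 lambda (fitted beta).
rewrite muleA -EFinM -ge0_integralZl//.
- by apply: eq_integral => w _; rewrite joint_densityE EFinM muleA.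
- apply: emeasurable_funM => //; apply/measurable_EFinP.
  exact: measurable_tilt_omega.
- by move=> w _; rewrite mule_ge0// lee_fin tilt_ge0.
- by rewrite lee_fin mulr_ge0// invr_ge0 ltW.
Qed.

Let joint_swap (F : W * 'cV[R]_p -> \bar R) : measurable_fun setT F ->
  (forall x, (0 <= F x)%E) ->
  (\int[lebesgue_vec p]_beta \int[Pr]_w ((joint_density w beta)%:E * F (w, beta)) =
   \int[Pr]_w ((C * (normal_vec_pdf m0 S0 0 / pdf w 0))%:E *
     \int[conditional w]_v F (w, v)))%E.
Proof.
move=> mF F0; pose f (x : W * 'cV[R]_p) := ((joint_density x.1 x.2)%:E * F x)%E.
rewrite -(fubini_tonelli (m1 := Pr) (m2 := lebesgue_vec p) f); last 2 first.
- by apply: emeasurable_funM => //; exact/measurable_EFinP.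
- by move=> x; rewrite mule_ge0// lee_fin joint_density_ge0.
apply: eq_integral => w _.
have mFw : measurable_fun setT (fun v => F (w, v)).
  exact: measurableT_comp.
rewrite conditional_integral// -ge0_integralZl//.
- by apply: eq_integral => v _; rewrite /f /joint_density !EFinM !muleA.
- apply: emeasurable_funM => //; apply/measurable_EFinP; exact: mpdf.
- by move=> v _; rewrite mule_ge0// lee_fin pdf_ge0.
- by rewrite lee_fin mulr_ge0 ?(ltW C_gt0)// mulr_ge0 ?invr_ge0 ?normal_vec_pdf_ge0.
Qed.

Let measurable_fitted i : measurable_fun setT (fitted^~ i).
Proof.
have := measurable_mxM (measurable_mx_cst X)
  (fun i j => measurable_entry (T := R) i j : measurable_fun setT _).
exact.
Qed.

Let measurable_posterior_density : measurable_fun setT posterior_density.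
Proof.
apply: measurable_funM; first exact: measurable_cst.
apply: measurable_funM; last exact: measurable_normal_vec_pdfr.
apply: measurable_prod => i _; apply: measurable_funM.
  apply: measurableT_comp => //; apply: measurable_funM; first exact: measurable_cst.
  exact: measurable_fitted.
apply: (measurableT_comp (measurable_powR lambda)).
have mh : measurable_fun setT (fun beta : 'cV[R]_p => fitted beta i / 2).
  by apply: measurable_funM => //; exact: measurable_fitted.
exact: (measurableT_comp (@measurable_div_sinh R) mh).
Qed.

(** In the joint law of (omega, beta) whose density with respect to
    Pr x Lebesgue is [joint_density], beta has the posterior law and, given
    omega, the law N(m_omega, Sigma_omega).  The chain started from the
    posterior resamples omega given beta, then beta given omega; integrating
    beta first, both sides become the same integral over omega. *)
Lemma gibbs_invariant : kernel_invariant P Pi.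
Proof.
move=> A mA.
transitivity (\int[Pr]_w ((C * (normal_vec_pdf m0 S0 0 / pdf w 0))%:E *
    conditional w A))%E.
  rewrite (@ge0_integral_density _ _ _ (lebesgue_vec p) Pi posterior_density
    measurable_posterior_density posterior_density_ge0 PiE (P^~ A))//; last first.
    exact: measurable_kernel.
  have mN : measurable_fun setT (fun x : W * 'cV[R]_p => conditional x.1 A).
    exact: (measurableT_comp (measurable_conditional mA) measurable_fst).
  transitivity (\int[lebesgue_vec p]_beta \int[Pr]_w
      ((joint_density w beta)%:E * conditional w A))%E.
    apply: eq_integral => beta _; rewrite PE// posterior_joint//.
      exact: measurable_conditional.
    by move=> w; exact: post_normal_ge0.
  apply: etrans; first
    exact: (joint_swap mN (fun x => measure_ge0 (conditional x.1) A)).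
  apply: eq_integral => w _; congr (_ * _)%E.
  apply: (etrans (integral_cst (conditional w) measurableT (conditional w A))).
  by rewrite conditional_total mule1.
rewrite PiE// integral_in_indic.
have mI : measurable_fun setT
    (fun x : W * 'cV[R]_p => (\1_A x.2 : R)%:E).
  apply/measurable_EFinP.
  exact: (measurableT_comp (measurable_indic mA) measurable_snd).
transitivity (\int[lebesgue_vec p]_beta \int[Pr]_w
    ((joint_density w beta)%:E * (\1_A beta)%:E))%E; last first.
  apply: eq_integral => beta _; rewrite -posterior_joint//.
  have k0 := tilt_mass_gt0 lambda (fitted beta).
  rewrite ge0_integralZr//; last by move=> w _; rewrite lee_fin tilt_ge0.
    by rewrite laplace -!EFinM mulKf ?gt_eqF.
  by apply/measurable_EFinP; exact: measurable_tilt_omega.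
apply: etrans; last first; first by apply: esym; apply: (joint_swap mI) => x;
  rewrite lee_fin indicE.
apply: eq_integral => w _; congr (_ * _)%E.
by rewrite integral_indic// setIT.
Qed.

End gibbs_kernel.

(** * Convergence of the Gibbs chain *)

(** Markov's inequality.  When K = 0 (as in dimension 0) it says nothing, but
    then V vanishes almost everywhere. *)
Lemma sublevel_mass d (T : measurableType d) (R : realType)
    (m : {measure set T -> \bar R}) (V : T -> R) (K r : R) :
  m setT = 1%E -> measurable_fun setT V -> (forall x, 0 <= V x) ->
  (\int[m]_x (V x)%:E <= K%:E)%E -> 0 <= K -> 1 < r ->
  measurable [set x | V x <= r * K] /\
  ((1 - 1 / r)%:E <= m [set x | (V x <= r * K)%R])%E.
Proof.
move=> m1 mV V0 mVK K0 r1; set C := [set x | _].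
have r0 : 0 < r by rewrite (lt_trans _ r1).
have mC : measurable C.
  rewrite -[X in measurable X]setTI.
  have -> : C = V @^-1` [set` `]-oo, r * K]].
    by apply/seteqP; split=> x /=; rewrite in_itv.
  exact: mV.
split=> //; have mCc : measurable (~` C) by exact: measurableC.
suff h : (m (~` C) <= (1 / r)%:E)%E.
  have e : (m C + m (~` C) = 1)%E.
    by rewrite -measureU ?setUv ?setICr.
  have fin A : measurable A -> m A \is a fin_num.
    move=> mA; rewrite ge0_fin_numE// (@le_lt_trans _ _ (m setT))//.
      by rewrite le_measure ?inE.
    by rewrite m1 ltry.
  move: h e; move: (m C) (fin _ mC) (m (~` C)) (fin _ mCc).
  move=> [a| |]// _ [b| |]// _; rewrite !lee_fin -EFinD => h [] e; lra.
have mVE : measurable_fun setT (EFin \o V) by exact/measurable_EFinP.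
have [KE|Kn0] := eqVneq K 0.
  have : (\int[m]_x `|(EFin \o V) x| = 0)%E.
    apply/eqP; rewrite eq_le integral_ge0// andbT.
    under eq_integral do rewrite gee0_abs ?lee_fin//.
    by move: mVK; rewrite KE.
  move/(ae_eq_integral_abs m measurableT mVE) => V_ae0.
  suff -> : m (~` C) = 0%E by rewrite lee_fin divr_ge0// ltW.
  apply/(negligibleP m mCc); apply: negligibleS V_ae0 => x Cx /= V0x.
  apply: Cx; rewrite /C /=; have [->] := V0x I; by rewrite KE mulr0.
have K1 : 0 < K by rewrite lt_def Kn0.
rewrite -(@lee_pmul2l _ (r * K)%:E) ?lte_fin ?mulr_gt0//.
have -> : ((r * K)%:E * (1 / r)%:E = K%:E :> \bar R)%E.
  by rewrite -EFinM; congr (_%:E); field; rewrite gt_eqF.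
apply: le_trans mVK; rewrite -integral_cst//.
apply: (@le_trans _ _ (\int[m]_(x in ~` C) (V x)%:E)%E).
  apply: ge0_le_integral => //.
  - by move=> x _; rewrite lee_fin mulr_ge0// ltW.
  - by apply/measurable_EFinP; exact: measurable_funTS.
  - by move=> x /negP; rewrite -ltNge lee_fin => /ltW.
apply: ge0_subset_integral => //.
- by move=> x _; rewrite lee_fin.
Qed.

Lemma wasserstein_le_weighted_measure (R : realType) p
    (mu : {measure set 'cV[R]_p -> \bar R}) (nu : probability 'cV[R]_p R) :
  mu setT = 1%E ->
  (\int[mu]_u (l2norm u)%:E < +oo)%E -> (\int[nu]_u (l2norm u)%:E < +oo)%E ->
  (wasserstein_l2 mu nu <=
   weighted_dist (fun u => 1 + l2norm u ^+ 2)%R mu nu)%E.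
Proof.
move=> mu1 muoo nuoo; have [mu' mu'E] := probability_of_measure mu1.
have intE f : (\int[mu]_u f u = \int[mu']_u f u)%E.
  by apply: eq_measure_integral => A _ _; exact/esym/mu'E.
have -> : wasserstein_l2 mu nu = wasserstein_l2 mu' nu.
  congr ereal_inf; congr image; apply/seteqP; split=> G GC A mA.
    by have [h1 h2] := GC A mA; split => //; apply: etrans h1 _; exact/esym/mu'E.
  by have [h1 h2] := GC A mA; split => //; apply: etrans h1 _; exact: mu'E.
have -> : weighted_dist (fun u => 1 + l2norm u ^+ 2)%R mu nu =
    weighted_dist (fun u => 1 + l2norm u ^+ 2)%R mu' nu.
  congr ereal_sup; congr image; apply/funext => f; by rewrite intE.
by apply: wasserstein_le_weighted => //; rewrite -intE.
Qed.

Lemma l2norm_lty (R : realType) p (m : {measure set 'cV[R]_p -> \bar R}) K :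
  m setT = 1%E -> (\int[m]_v (l2norm v ^+ 2)%:E <= K%:E)%E ->
  (\int[m]_v (l2norm v)%:E < +oo)%E.
Proof.
move=> m1 mK; apply: (@le_lt_trans _ _ (\int[m]_v (1 + (l2norm v ^+ 2)%:E))%E).
  apply: ge0_le_integral => //.
  - by move=> v _; rewrite lee_fin l2norm_ge0.
  - by apply/measurable_EFinP; exact: measurable_l2norm.
  - by apply: emeasurable_funD => //; exact: measurable_sql2norm.
  - by move=> v _; rewrite -EFinD lee_fin l2norm_le_1sqr.
rewrite ge0_integralD//; last 2 first.
- by move=> v _; exact: sql2norm_ge0.
- exact: measurable_sql2norm.
rewrite integral_cst// mul1e; apply: (@le_lt_trans _ _ (1 + K%:E)%E).
  by apply: leeD => //; rewrite m1.
by rewrite -EFinD ltry.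
Qed.

Theorem theorem4p2 (R : realType) (n p : nat)
    (y : 'cV[R]_n) (X : 'M[R]_(n, p)) (m0 : 'cV[R]_p) (S0 : 'M[R]_p)
    (lambda : R)
    (Pi : probability 'cV[R]_p R) (P : R.-pker 'cV[R]_p ~> 'cV[R]_p)
    (z := working_response lambda y)
    (y01 : forall i, 0 < y i 0 < 1)
    (S0_posdef : symposdef S0)
    (lambda_gt0 : 0 < lambda)
    (Pi_posterior : is_KG_posterior X z m0 S0 lambda Pi)
    (P_Gibbs : is_KG_Gibbs_kernel X z m0 S0 lambda P) :
  hyper_uniformly_ergodic (fun beta : 'cV[R]_p => l2norm beta ^+ 2) P Pi /\
  forall r : R, 1 < r ->
    let gamma := 1 - 1 / r in
    let K := opnorm S0 ^+ 2 * l2norm (X^T *m z + invmx S0 *m m0) ^+ 2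
             + \tr S0 in
    let c := fun i => l2norm (row i X)^T * Num.sqrt (r * K) in
    let eps := (\prod_(i < n) div_sinh (c i / 2)) `^ lambda in
    forall (beta : 'cV[R]_p) (t : nat), (1 <= t)%N ->
      [/\ (tv_dist (kernel_iter P t beta) Pi <= (rho t gamma eps)%R%:E)%E,
          (weighted_dist (fun u : 'cV[R]_p => (1 + l2norm u ^+ 2)%R)
             (kernel_iter P (t + 1) beta) Pi
           <= (2 * (1 + K) * rho t gamma eps)%R%:E)%E &
          (wasserstein_l2 (kernel_iter P (t + 1) beta) Pi
           <= (2 * (1 + K) * rho t gamma eps)%R%:E)%E].
Proof.
have [d [W [Pr [omega [momega omega_ge0 laplace PE]]]]] := gibbs_reference P_Gibbs.
have [C0 C0_gt0 PiE] := Pi_posterior.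
have invariant := gibbs_invariant S0_posdef momega omega_ge0 laplace PE C0_gt0 PiE.
have drift := gibbs_drift S0_posdef momega omega_ge0 laplace PE.
have K_ge0 := drift_const_ge0 X z m0 S0_posdef.
set K := drift_const X z m0 S0 in drift K_ge0.
pose V (v : 'cV[R]_p) := l2norm v ^+ 2.
have mV : measurable_fun setT V 
  by apply: measurable_funX; exact: measurable_l2norm.
have V_ge0 v : 0 <= V v by exact: sqr_ge0.
have small r (r1 : 1 < r) : let gamma := 1 - 1 / r in
    let c := fun i => l2norm (row i X)^T * Num.sqrt (r * K) in
    let eps := (\prod_(i < n) div_sinh (c i / 2)) `^ lambda in
    exists (C : set 'cV[R]_p) (eta : {measure set 'cV[R]_p -> \bar R}),
    [/\ measurable C, 0 < gamma < 1 /\ 0 < eps <= 1,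
      forall v, (gamma%:E <= P v C)%E, eta setT = eps%:E &
      forall v, C v -> forall A, measurable A -> (eta A <= P v A)%E].
  move=> gamma c eps; have r0 : 0 < r by rewrite (lt_trans _ r1).
  have epsE : eps = tilt_mass lambda c.
    by rewrite /eps powR_prod// => i; rewrite ltW// div_sinh_gt0.
  have rK0 : 0 <= r * K by rewrite mulr_ge0// ltW.
  exists [set v | V v <= r * K], (tilted_mixture X z m0 S0 Pr momega c).
  have P1 v : P v setT = 1%E by exact: pker_total.
  have PC v := sublevel_mass (P1 v) mV V_ge0 (drift v) K_ge0 r1.
  split.
  - by have [] := PC 0.
  - rewrite epsE tilt_mass_gt0 tilt_mass_le1// /gamma div1r.
    by rewrite subr_gt0 invf_lt1// r1 ltrBlDr ltrDl invr_gt0 r0.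
  - by move=> v; have [] := PC v.
  - by rewrite epsE (tilted_mixture_total X z m0 S0_posdef momega omega_ge0 laplace).
  - move=> v Vv A mA.
    apply: (gibbs_minorization lambda_gt0 momega omega_ge0 PE) => // i.
    have -> : (X *m v) i 0 = (((row i X)^T)^T *m v) 0 0.
      by rewrite trmxK -row_mul [RHS]mxE.
    apply: le_trans (l2norm_cauchy_schwarz _ _) _.
    apply: ler_wpM2l; first exact: l2norm_ge0.
    by rewrite -[leLHS](ger0_norm (l2norm_ge0 v)) -sqrtr_sqr ler_wsqrtr.
have average (m : {measure set 'cV[R]_p -> \bar R}) : m setT = 1%E ->
    (\int[m]_u \int[P u]_v (V v)%:E <= K%:E)%E.
  move=> m1; apply: (@le_trans _ _ (\int[m]_u K%:E)%E); last first.
    by rewrite integral_cst// m1 mule1.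
  apply: ge0_le_integral => //.
  - by move=> u _; apply: integral_ge0 => v _; rewrite lee_fin.
  - by apply: measurable_pker_integral => //; exact/measurable_EFinP.
split.
  split=> //.
  have two1 : 1 < 2 :> R by rewrite ltr1n.
  have [C [eta [mC [gamma01 eps01] PC eta_total minor]]] := small 2 two1.
  move: gamma01 eps01 PC eta_total minor; set gamma := 1 - 1 / 2; set eps := _ `^ _.
  move=> gamma01 eps01 PC eta_total minor.
  exists (gamma * eps), (K + 1); split.
  - have /andP[g0 g1] := gamma01; have /andP[e0 e1] := eps01.
    by rewrite mulr_gt0//= (le_lt_trans _ g1)// ler_piMr// ltW.
  - by rewrite ltr_wpDl.
  move=> beta t t1.
  have dist (f : 'cV[R]_p -> R) : measurable_fun setT f -> (forall v, 0 <= f v <= 1) ->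
      `|\int[kernel_iter P (2 * t) beta]_v f v - \int[Pi]_v f v| <=
      (1 - gamma * eps) ^+ t.
    move=> mf f01; apply: (spread_dist invariant beta mf f01).
    exact: (spread_iter_double mC gamma01 eps01 PC eta_total minor t mf f01).
  split; first exact: tv_dist_le dist.
  rewrite addn1; apply: le_trans (weighted_dist_le invariant mV V_ge0 K_ge0 drift dist) _.
  rewrite lee_fin ler_wpM2r ?ler_wpM2l ?lerD2l ?lerDl// exprn_ge0//.
  have /andP[g0 g1] := gamma01; have /andP[e0 e1] := eps01.
  by rewrite subr_ge0 mulr_ile1// ltW.
move=> r r1 gamma K' c eps beta t t1.
have [C [eta [mC [gamma01 eps01] PC eta_total minor]]] := small r r1.
have dist (f : 'cV[R]_p -> R) : measurable_fun setT f -> (forall v, 0 <= f v <= 1) ->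
    `|\int[kernel_iter P t beta]_v f v - \int[Pi]_v f v| <= rho t gamma eps.
  move=> mf f01; apply: (spread_dist invariant beta mf f01).
  exact: (spread_iter mC gamma01 eps01 PC eta_total minor t mf f01).
have wd := weighted_dist_le invariant mV V_ge0 K_ge0 drift dist.
split; [exact: tv_dist_le dist|by rewrite addn1|].
rewrite addn1; apply: le_trans wd; apply: wasserstein_le_weighted_measure.
- exact: kernel_iter_total.
- apply: (@l2norm_lty _ _ _ K); first exact: kernel_iter_total.
  rewrite kernel_iterSr_integral; first exact/average/kernel_iter_total.
    exact: measurable_sql2norm.
  exact: sql2norm_ge0.
- apply: (@l2norm_lty _ _ _ K); first exact: probability_setT.
  rewrite (@ge0_integral_mixture _ _ _ _ _ Pi P Pi)//.
  - exact/average/probability_setT.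
  - by move=> A mA; exact: measurable_kernel.
  - by move=> A mA; apply/esym/invariant.
  - exact: measurable_sql2norm.
Qed.
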